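(* Let $G$ be a para-$\mathfrak{Nil}$-Hamiltonian group. If $G$ has a finite insoluble subgroup, then $G$ is finite and $G\cong A_5$ or $G\cong \mathrm{SL}(2,5)$.
   Context: A group is minimal non-nilpotent if it is not nilpotent but all its proper subgroups are nilpotent. A group $G$ is para-$\mathfrak{Nil}$-Hamiltonian if $G$ is non-nilpotent and every non-normal subgroup of $G$ is either nilpotent or minimal non-nilpotent. *)

(* Defs.v *)
From mathcomp Require Import all_boot all_order all_algebra all_fingroup all_solvable.
From Stdlib Require Import List.

Set Implicit Arguments.
Unset Strict Implicit.
Unset Printing Implicit Defensive.

Record Grp := MkGrp {
  carrier :> Type;
  gmul : carrier -> carrier -> carrier;
  gone : carrier;
  ginv : carrier -> carrier;
  gmulA : forall x y z, gmul x (gmul y z) = gmul (gmul x y) z;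
  gmul1 : forall x, gmul gone x = x;
  gmulV : forall x, gmul (ginv x) x = gone
}.

Section GroupNotions.
Variable G : Grp.

Definition gsubset (A B : G -> Prop) : Prop := forall x, A x -> B x.

Definition is_subgroup (H : G -> Prop) : Prop :=
  H (gone G) /\ (forall x y, H x -> H y -> H (gmul x y)) /\
  (forall x, H x -> H (ginv x)).

Definition gen (S : G -> Prop) : G -> Prop :=
  fun x => forall K, is_subgroup K -> gsubset S K -> K x.

Definition gcomm (x y : G) : G := gmul (gmul (ginv x) (ginv y)) (gmul x y).

Definition commSub (A B : G -> Prop) : G -> Prop :=
  gen (fun z => exists x y, A x /\ B y /\ z = gcomm x y).

Fixpoint lcs (H : G -> Prop) (n : nat) : G -> Prop :=
  match n with
  | O => H
  | S m => commSub (lcs H m) H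
  end.

Fixpoint dser (H : G -> Prop) (n : nat) : G -> Prop :=
  match n with
  | O => H
  | S m => commSub (dser H m) (dser H m)
  end.

Definition is_trivial (A : G -> Prop) : Prop := forall x, A x -> x = gone G.

Definition nilpotent_sub (H : G -> Prop) : Prop := exists n, is_trivial (lcs H n).
Definition soluble_sub (H : G -> Prop) : Prop := exists n, is_trivial (dser H n).

Definition proper_subgroup (K H : G -> Prop) : Prop :=
  is_subgroup K /\ gsubset K H /\ exists x, H x /\ ~ K x.

Definition min_non_nilpotent_sub (H : G -> Prop) : Prop :=
  is_subgroup H /\ ~ nilpotent_sub H /\
  forall K, proper_subgroup K H -> nilpotent_sub K.

Definition normal_sub (H : G -> Prop) : Prop :=
  forall g x, H x -> H (gmul (gmul (ginv g) x) g).

Definition finite_sub (H : G -> Prop) : Prop :=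
  exists s : list (carrier G), forall x, H x -> In x s.

Definition setT_G : G -> Prop := fun _ => True.

Definition group_nilpotent : Prop := nilpotent_sub setT_G.
Definition group_finite : Prop := finite_sub setT_G.

Definition para_Nil_Hamiltonian : Prop :=
  ~ group_nilpotent /\
  forall H, is_subgroup H -> ~ normal_sub H ->
    nilpotent_sub H \/ min_non_nilpotent_sub H.

Definition isomorphic_to (gT : finGroupType) (K : {set gT}) : Prop :=
  exists f : carrier G -> gT,
    (forall x y, f (gmul x y) = (f x * f y)%g) /\
    (forall x y, f x = f y -> x = y) /\
    (forall x, f x \in K) /\
    (forall y, y \in K -> exists x, f x = y).

End GroupNotions.

Definition A5 : {set {perm 'I_5}} := ('Alt_('I_5))%g.

Definition SL25 : {set {'GL_2['F_5]}} :=
  [set M : {'GL_2['F_5]} | (\det (GLval M) == 1)%R].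

(* Main.v *)
(** Let H be a minimal insoluble finite subgroup of G. A subgroup containing H is
    neither nilpotent nor, by Schmidt's theorem, minimal non-nilpotent, so H is
    normal in G.

    Let S be the simple quotient of H. Every proper subgroup of S is nilpotent or
    minimal non-nilpotent. Maximal Sylow intersections, transfer and counting
    show that each Sylow subgroup P of S is TI and elementary abelian, that
    C_S(x) = P for all x in P^#, and that N_S(P) is a Frobenius group with
    complement of prime order. If #|S| is odd, the exceptional characters
    attached to the primes dividing #|S| satisfy incompatible bounds for the
    prime with smallest Sylow subgroup. If #|S| is even, counting the pairs of
    involutions with a given product yields #|S| = 60 and a subgroup of index 5,
    whence S = A5. The kernel R of H -> S is then a cyclic 2-group, because the
    preimages of the normalisers of a Sylow 3- and a Sylow 5-subgroup are minimal
    non-nilpotent; so R is central, and transfer gives #|R| <= 2. If #|R| = 2, the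
    derived subgroup of the fibre product of H and SL(2,5) over A5 has order 120
    and is the graph of an isomorphism.

    Finally let P be a Sylow 2-subgroup of H. If G were larger than H, the Frattini
    argument would make N_G(P) larger than N_H(P), which is not nilpotent; so
    N_G(P) would be normal in G and N_H(P) normal in H, which is false. *)

Require Import Defs.
From HB Require Import structures.
From Stdlib Require Import List Classical ClassicalEpsilon.
From mathcomp Require Import all_boot all_order all_algebra all_fingroup all_solvable.
From mathcomp Require Import all_field all_character.
From mathcomp Require Import zify ring.

Set Implicit Arguments.
Unset Strict Implicit.
Unset Printing Implicit Defensive.

(** * Transfer, fusion and minimal non-nilpotent groups *)

Section SchmidtTheorem.

Import GroupScope FiniteModule.

(** The finite analysis uses the hypothesis in one form only: a subgroup of H is normal in H or all
    its proper subgroups are nilpotent. In a simple quotient the first alternative disappears for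
    non-trivial proper subgroups, which is why S is studied before H. The Sylow normalisers force
    each non-trivial element of S into exactly one Sylow subgroup, so S^# splits by primes into
    pieces of known size. In odd order characters replace involutions: an exceptional character for
    p takes a constant integer value on the elements of order l, and the parity of this value
    decides how l is used. An odd value is non-zero and adds to the norm of that character; an even
    one forces every exceptional character for l into an induced character of norm q + 1, where q is
    the order of the complement for p. Both norms are limited, while the elements of order l have to
    fill S. G may be infinite, so H is replaced by a finite group with an injective morphism f into
    G, and conjugation by elements of G has to be read back through f. *)

Lemma pnat_neq_coprime (p q m n : nat) :
  p != q -> p.-nat m -> q.-nat n -> coprime m n.
Proof.
move=> neq pm qn; apply: pnat_coprime pm (sub_in_pnat _ qn) => r _.
by rewrite !inE => /eqP->; rewrite eq_sym.
Qed.

(** * Transfer, control of fusion and maximal Sylow intersections *)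

Section Transfer.
Variable gT : finGroupType.
Implicit Types (G H K M P Q : {group gT}).

(* The transfer G -> P / K is trivial on G', while the fusion hypothesis makes
   it send g to the class of g ^+ #|G : P|, where #|G : P| is prime to p. *)
Lemma Sylow_der1_transfer p P K G g :
    p.-Sylow(G) P -> K <| P -> abelian (P / K) -> g \in P -> g \in G^`(1) ->
    (forall k x, x \in G -> (g ^+ k) ^ x \in P -> [~ g ^+ k, x] \in K) ->
  g \in K.
Proof.
move=> sylP /andP[sKP nKP] abPK Pg G'g fusK.
have [sPG pP coPi] := and3P sylP; have Gg := subsetP sPG g Pg.
pose alpha := [morphism of restrm nKP (coset K)].
have imP : alpha @* P = P / K by rewrite morphim_restrm setIid.
have abA : abelian (alpha @* P) by rewrite imP.
have transg0 : transfer G abA g = 0%R.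
  suff /subsetP/(_ g G'g)/mker : G^`(1) \subset 'ker (transfer_morphism G abA) by [].
  rewrite gen_subG; apply/subsetP=> _ /imset2P[x y Gx Gy ->].
  rewrite !inE groupR //= [transfer G abA _](morphR (transfer_morphism G abA)) //.
  by apply/commgP; apply: GRing.addrC.
have partX := rcosets_cycle_partition sPG Gg.
have trX := transversalP partX; set X := transversal _ _ in trX.
have /and3P[_ sXG _] := trX.
have: (fmod abA (alpha g) *+ #|G : P| = 0)%R.
  rewrite -transg0 (transfer_cycle_expansion sPG abA Gg trX).
  rewrite -(sum_index_rcosets_cycle sPG Gg trX) -GRing.sumrMnr.
  apply: eq_bigr => x Xx.
  have Pgx : (g ^+ #|<[g]> : P :* x|) ^ x^-1 \in P.
    by rewrite conjgE invgK mulgA -mem_rcoset mulg_exp_card_rcosets.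
  rewrite -[(_ *+ _)%R]morphX ?mem_morphim //= -morphX //= /restrm.
  have Kc : [~ g ^+ #|<[g]> : P :* x|, x^-1] \in K.
    by apply: fusK Pgx; rewrite groupV (subsetP sXG).
  congr fmod; rewrite conjg_mulR -[LHS]mulg1 -(coset_id Kc) -morphM //.
    by rewrite (subsetP nKP) ?groupX.
  by rewrite (subsetP nKP) ?(subsetP sKP).
move/(congr1 val); rewrite fmval0 fmvalZ fmodK ?mem_morphim //= /restrm.
move/(congr1 (expgn^~ (expg_invn (P / K) #|G : P|))).
have coPK : coprime #|P / K| #|G : P|.
  by rewrite (pnat_coprime (quotient_pgroup _ pP)).
rewrite expg1n expgK ?mem_quotient //.
by move=> Kg1; rewrite coset_idr ?(subsetP nKP).
Qed.

(** If ['N_G(P)] were nilpotent, it would be the product of [P] and a subgroup centralising [P], so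
    by the fusion hypothesis each [[~ g ^+ k, x]] would be a commutator of elements of [P]. As [G]
    is perfect, the transfer would then put [P] inside its own derived subgroup. *)
Lemma perfect_norm_Sylow_not_nil p P G :
    p.-Sylow(G) P -> P :!=: 1 -> G^`(1) = G ->
    (forall x g, x \in P -> g \in G -> x ^ g \in P ->
       exists2 h, h \in 'N_G(P) & x ^ g = x ^ h) ->
  ~~ nilpotent 'N_G(P).
Proof.
move=> sylP ntP defG' fus; apply/negP=> nilN.
have [sPG pP _] := and3P sylP.
have sylPN : p.-Sylow('N_G(P)) P.
  by apply: pHall_subl sylP; rewrite ?subsetIl // subsetI sPG normG.
have defP : 'O_p('N_G(P)) = P by apply: normal_Hall_pcore; rewrite ?normalSG.
have : P \proper P^`(1); last first.
  by move/proper_card; rewrite ltnNge subset_leq_card ?der_sub.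
have [] := boolP (P \subset P^`(1)); last first.
  case/subsetPn=> g Pg /negP[].
  apply: (Sylow_der1_transfer sylP (der_normal 1 P) (sub_der1_abelian _) Pg) => //.
    by rewrite defG' (subsetP sPG).
  move=> k x Gx Pgx; have Pgk : g ^+ k \in P by rewrite groupX.
  have [h Nh ->] : exists2 h, h \in P & [~ g ^+ k, x] = [~ g ^+ k, h].
    have [h Nh eqh] := fus _ _ Pgk Gx Pgx.
    have := Nh; rewrite -(dprodW (nilpotent_pcoreC p nilN)) defP.
    case/mulsgP=> a b Pa Cb defh; exists a => //.
    have cPb : b \in 'C(P).
      have [_ _ /subsetP cPC _] := dprodP (nilpotent_pcoreC p nilN).
      by rewrite -defP cPC.
    rewrite !commgEl eqh defh conjgM; congr (_ * _).
    by apply/conjg_fixP/commgP; apply: commute_sym; apply: (centP cPb); rewrite groupJ.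
  exact: mem_commg.
move=> sPP'; have := sol_der1_proper (pgroup_sol pP) (subxx P) ntP.
by case/andP=> _; rewrite sPP'.
Qed.

(** Burnside's argument: [P] and [P :^ g] are both Sylow in the centraliser of [x ^ g], hence
    conjugate there by some [c], and [g * c] normalises [P] while moving [x] as [g] does. *)
Lemma abelian_Sylow_fusion p P G x g :
    p.-Sylow(G) P -> abelian P -> x \in P -> g \in G -> x ^ g \in P ->
  exists2 h, h \in 'N_G(P) & x ^ g = x ^ h.
Proof.
move=> sylP abP Px Gg Pxg; have [sPG pP _] := and3P sylP.
set C := 'C_G[x ^ g].
have sPC : P \subset C by rewrite subsetI sPG sub_cent1 (subsetP abP).
have sPgC : P :^ g \subset C.
  rewrite subsetI conj_subG //= sub_cent1.
  have -> : (x ^ g \in 'C(P :^ g)) = (x \in 'C(P)) by rewrite centJ memJ_conjg.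
  by rewrite (subsetP abP).
have sylPC : p.-Sylow(C) P by apply: pHall_subl sylP; rewrite ?subsetIl.
have sylPgC : p.-Sylow(C) (P :^ g).
  by apply: (pHall_subl sPgC (subsetIl _ _)); rewrite pHallJ.
have [c /setIP[Gc cc] defP] := Sylow_trans sylPgC sylPC.
exists (g * c); last first.
  by rewrite conjgM; apply/esym/conjg_fixP/commgP; apply/commute_sym/cent1P.
rewrite inE groupM //=; apply/normP.
by rewrite conjsgM -defP.
Qed.

Lemma TI_Sylow_fusion P G :
    (forall g, g \in G -> P :&: P :^ g != 1 -> P :^ g = P) ->
  forall x g, x \in P -> g \in G -> x ^ g \in P ->
  exists2 h, h \in 'N_G(P) & x ^ g = x ^ h.
Proof.
move=> TIP x g Px Gg Pxg; have [-> | ntx] := eqVneq x 1.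
  by exists 1; rewrite ?group1 // !conj1g.
exists g => //; rewrite inE Gg; apply/normP; apply: TIP => //.
by apply/trivgPn; exists (x ^ g); rewrite ?conjg_eq1 // inE Pxg memJ_conjg.
Qed.

(** A [p]-subgroup [V] of ['N_G(D)] containing ['N_P(D)] lies in a conjugate of [P] that meets [P]
    in more than [D], hence in [P] by maximality. So ['N_P(D)] is Sylow. Were it normal, its product
    with ['N_(P :^ g)(D)] would be such a [V], forcing ['N_(P :^ g)(D)] into [D] although
    normalisers grow in the [p]-group [P :^ g]. *)
Lemma max_Sylow_inter p P G g (D := P :&: P :^ g) :
    p.-Sylow(G) P -> g \in G -> P :^ g != P ->
    (forall h, h \in G -> P :^ h != P -> #|P :&: P :^ h| <= #|D|) ->
  p.-Sylow('N_G(D)) 'N_P(D) /\ ~~ ('N_P(D) <| 'N_G(D)).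
Proof.
move=> sylP Gg neqP maxD; have [sPG pP _] := and3P sylP.
have sylPg : p.-Sylow(G) (P :^ g) by rewrite pHallJ.
have maxD' h : h \in G -> D \proper P :&: P :^ h -> P :^ h = P.
  move=> Gh ltD; apply/eqP/idPn => neq.
  by have := proper_card ltD; rewrite ltnNge maxD.
have pN (U : {group gT}) : p.-group U -> D \proper U -> D \proper 'N_U(D).
  move=> pU; exact: nilpotent_proper_norm (pgroup_nil pU).
have sDP : D \proper P.
  rewrite properEneq subsetIl andbT; apply: contraNneq neqP => defD.
  by rewrite eq_sym eqEcard cardJg leqnn andbT -{1}defD subsetIr.
have sDPg : D \proper P :^ g.
  rewrite properEneq subsetIr andbT; apply: contraNneq neqP => defD.
  by rewrite eqEcard cardJg leqnn andbT -{1}defD subsetIl.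
have nP (V : {group gT}) : p.-group V -> V \subset 'N_G(D) ->
    'N_P(D) \subset V -> V \subset P.
  move=> pV sVN sNV; have sVG := subset_trans sVN (subsetIl _ _).
  have [h Gh sVPh] := Sylow_Jsub sylP sVG pV.
  have sVP : V \subset P :^ h^-1 by rewrite -sub_conjg.
  rewrite -(maxD' h^-1) ?groupV //.
  apply: proper_sub_trans (pN P pP sDP) _.
  by rewrite subsetI subsetIl (subset_trans sNV).
split.
  have pNP : p.-group 'N_P(D) := pgroupS (subsetIl _ _) pP.
  have [V sylV sNV] := Sylow_superset (setSI 'N(D) sPG) pNP.
  have [sVN pV _] := and3P sylV.
  suff -> : 'N_P(D) = V by [].
  apply/eqP; rewrite eqEsubset sNV subsetI nP //=.
  by apply: subset_trans sVN (subsetIr _ _).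
apply/negP=> /andP[sNN nNN].
have pPg : p.-group (P :^ g) by rewrite pgroupJ.
have /nP : p.-group ('N_P(D) <*> 'N_(P :^ g)(D)).
  rewrite norm_joinEr ?pgroupM ?(pgroupS (subsetIl _ _)) //.
  by apply: subset_trans nNN; rewrite setSI // (pHall_sub sylPg).
rewrite join_subG sNN joing_subl setSI ?(pHall_sub sylPg) //= => /(_ isT isT).
rewrite join_subG => /andP[_ sNP].
have := pN (P :^ g)%G pPg sDPg; rewrite properE subsetI => /andP[_ /negP[]].
by rewrite subsetI sNP subsetIl.
Qed.

Lemma TI_or_max_Sylow_inter P G :
    (forall g, g \in G -> P :&: P :^ g != 1 -> P :^ g = P)
  \/ exists g, [/\ g \in G, P :^ g != P, P :&: P :^ g != 1
     & forall h, h \in G -> P :^ h != P -> #|P :&: P :^ h| <= #|P :&: P :^ g|].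
Proof.
pose bad g := [&& g \in G, P :^ g != P & P :&: P :^ g != 1].
case: (pickP bad) => [g0 bad0 | noBad]; last first.
  by left=> g Gg ntD; apply/eqP; have := noBad g; rewrite /bad Gg ntD andbT => /negbFE.
right; case: (arg_maxnP (fun g => #|P :&: P :^ g|) bad0) => g /and3P[Gg ne nt] maxg.
exists g; split=> // h Gh neh.
have [-> | nth] := eqVneq (P :&: P :^ h) 1; first by rewrite cards1 cardG_gt0.
by apply: maxg; apply/and3P.
Qed.
End Transfer.

(** Covers nilpotent and minimal non-nilpotent groups at once, the two possibilities left to a
    non-normal subgroup. *)
Definition proper_nil (gT : finGroupType) (M : {set gT}) :=
  forall L : {group gT}, L \proper M -> nilpotent L.

Lemma proper_nil_quo (gT : finGroupType) (M N : {group gT}) :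
  proper_nil M -> N <| M -> proper_nil (M / N).
Proof.
move=> nilM nNM L ltLM.
have [L1 defL sNL1 sL1M] := inv_quotientS nNM (proper_sub ltLM).
rewrite defL quotient_nil // nilM // properEneq sL1M andbT.
by apply: contraTneq ltLM => eqL1; rewrite defL eqL1 properxx.
Qed.

Lemma nil_Sylow_normal (gT : finGroupType) p (P N : {group gT}) :
  nilpotent N -> p.-Sylow(N) P -> P <| N.
Proof. by move=> nilN sylP; rewrite (nilpotent_Hall_pcore nilN sylP) pcore_normal. Qed.

Lemma simple_perfect (gT : finGroupType) (G : {group gT}) :
  simple G -> ~~ solvable G -> G^`(1) = G.
Proof.
move=> /simpleP[_ simG] nsol; case: (simG _ (der_normal 1 G)) => // G'1.
by case/negP: nsol; rewrite abelian_sol //; apply/derG1P.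
Qed.

Lemma simple_norm_proper (gT : finGroupType) (D G : {group gT}) :
  simple G -> D \proper G -> D :!=: 1 -> 'N_G(D) \proper G.
Proof.
move=> /simpleP[_ simG] ltD ntD; rewrite properEneq subsetIl andbT.
apply: contraNneq ntD => /setIidPl nDG.
have [-> // | defD] : D :=: 1 \/ D :=: G by apply: simG; rewrite /normal proper_sub.
by rewrite defD properxx in ltD.
Qed.

(** Induction on the order reduces to a simple [M]. If the conjugates of a Sylow subgroup [P] meet
    trivially, ['N_M(P)] controls fusion and is nilpotent, against the transfer. Otherwise a maximal
    intersection [D] gives a nilpotent group ['N_M(D)] with a Sylow subgroup that is not normal. *)
Lemma proper_nil_sol (gT : finGroupType) (M : {group gT}) :
  proper_nil M -> solvable M.
Proof.
have [n] := ubnP #|M|; elim: n => // n IHn in gT M * => leMn nilM.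
have [/nilpotent_sol // | nnilM] := boolP (nilpotent M).
have [simM | ] := boolP (simple M); last first.
  have ntM : M :!=: 1 by apply: contraNneq nnilM => ->; apply: nilpotent1.
  have [[N [nNM ntN]] | noN] : (exists N : {group gT}, [/\ N <| M, N :!=: 1 & N \proper M]) \/
     ~ exists N : {group gT}, [/\ N <| M, N :!=: 1 & N \proper M].
  - pose test (N : {group gT}) := [&& N <| M, N :!=: 1 & N \proper M].
    case: (pickP test) => [N /and3P[]|noN]; first by left; exists N.
    by right=> -[N [? ? ?]]; have /and3P[] := noN N.
  - move=> ltNM _; rewrite (series_sol nNM) nilpotent_sol ?nilM // IHn //.
      apply: leq_trans (ltn_quotient ntN (proper_sub ltNM)) _; exact: leMn.
    exact: proper_nil_quo.
  case/negP; apply/simpleP; split=> // N nNM; have [-> | ntN] := eqVneq N 1%G; first by left.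
  right; apply/eqP; rewrite eqEproper normal_sub //=; apply/negP=> ltNM.
  by case: noN; exists N.
apply/idPn=> nsolM; have defM' := simple_perfect simM nsolM.
have M_gt1 : 1 < #|M| by rewrite cardG_gt1; apply: contraNneq nnilM => ->; apply: nilpotent1.
set p := pdiv #|M|; have p_pr : prime p := pdiv_prime M_gt1.
have [P sylP] := Sylow_exists p M; have [sPM pP _] := and3P sylP.
have ntP : P :!=: 1.
  by rewrite -cardG_gt1 (card_Hall sylP) p_part_gt1 mem_primes p_pr pdiv_dvd cardG_gt0.
have ltPM : P \proper M.
  by rewrite properEneq sPM andbT; apply: contraNneq nnilM => <-; apply: pgroup_nil pP.
have [TIP | [g [Mg neqP ntD maxD]]] := TI_or_max_Sylow_inter P M.
  have /negP[] := perfect_norm_Sylow_not_nil sylP ntP defM' (TI_Sylow_fusion TIP).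
  by rewrite nilM ?simple_norm_proper.
have [sylN /negP[]] := max_Sylow_inter sylP Mg neqP maxD.
apply: (nil_Sylow_normal _ sylN); apply: nilM; apply: simple_norm_proper => //.
by apply: sub_proper_trans ltPM; apply: subsetIl.
Qed.

(** The shape of a minimal non-nilpotent group. The last two fields express that the proper
    subgroups [P * Q0] and [P0 * Q] are nilpotent, so that their coprime factors commute. *)
Record Schmidt (gT : finGroupType) (p q : nat) (M P Q : {group gT}) : Prop := {
  Schmidt_prime1 : prime p;
  Schmidt_prime2 : prime q;
  Schmidt_neq : p != q;
  Schmidt_Sylow1 : p.-Sylow(M) P;
  Schmidt_Sylow2 : q.-Sylow(M) Q;
  Schmidt_normal : P <| M;
  Schmidt_prod : P * Q = M;
  Schmidt_cyclic : cyclic Q;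
  Schmidt_ncent : ~~ (Q \subset 'C(P));
  Schmidt_cent2 : forall Q0 : {group gT}, Q0 \proper Q -> Q0 \subset 'C(P);
  Schmidt_cent1 : forall P0 : {group gT},
    P0 \proper P -> Q \subset 'N(P0) -> P0 \subset 'C(Q)
}.

(** A normal subgroup [K] of prime index [q] is nilpotent, so for [r != q] the Sylow [r]-subgroup of
    [M] is the normal ['O_r(K)]. One of them, [P], fails to normalise a Sylow [q]-subgroup [Q]; then
    [P * Q] cannot be proper. If [Q] were not cyclic, each of its elements would generate a proper
    subgroup and so centralise [P]. *)
Lemma Schmidt_exists (gT : finGroupType) (M : {group gT}) :
  proper_nil M -> ~~ nilpotent M ->
  exists p q (P Q : {group gT}), Schmidt p q M P Q.
Proof.
move=> nilM nnilM; have solM := proper_nil_sol nilM.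
have ntM : M :!=: 1 by apply: contraNneq nnilM => ->; apply: nilpotent1.
have [K nKM prK] := sol_prime_factor_exists solM ntM.
have [sKM nKM'] := andP nKM.
have ltKM : K \proper M by rewrite properE sKM -indexg_gt1 prime_gt1.
have nilK := nilM K ltKM; set q := #|M : K| in prK.
have sylr r : r != q -> r.-Sylow(M) 'O_r(K).
  move=> neqr; have sylO := nilpotent_pcore_Hall r nilK.
  rewrite pHallE (subset_trans (pcore_sub _ _) sKM) (card_Hall sylO) -(Lagrange sKM).
  rewrite partnM ?cardG_gt0 ?indexg_gt0 //= [X in (_ * X)%N]part_p'nat ?muln1 //.
  by rewrite pnatE // !inE eq_sym.
have norr r : 'O_r(K) <| M by apply: gFnormal_trans.
have [Q sylQ] := Sylow_exists q M; have [sQM qQ _] := and3P sylQ.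
pose N := 'N_M(Q).
have [p [p_pr neqpq nNP]] : exists p, [/\ prime p, p != q & ~~ ('O_p(K) \subset 'N(Q))].
  (* Otherwise [Q] is normal in [M], and with the ['O_r(K)] every Sylow subgroup lies in ['F(M)], so
     [M] is nilpotent. *)
  have: ~~ (#|M| %| #|N|).
    apply/negP=> dvN; case/negP: nnilM.
    have nQM : Q <| M.
      rewrite /normal sQM; apply/setIidPl/eqP.
      by rewrite eqEcard subsetIl dvdn_leq ?cardG_gt0.
    suff /eqP <- : 'F(M) == M by apply: Fitting_nil.
    rewrite eqEcard Fitting_sub dvdn_leq ?cardG_gt0 //.
    apply/dvdn_partP=> // r _; have [-> | /sylr sylO] := eqVneq r q.
      by rewrite -(card_Hall sylQ) cardSg // Fitting_max // (pgroup_nil qQ).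
    by rewrite -(card_Hall sylO) cardSg ?Fitting_max ?norr ?(pgroup_nil (pHall_pgroup sylO)).
  have [[p [p_pr neq nN]] | noN] : (exists p, [/\ prime p, p != q & ~~ ('O_p(K) \subset 'N(Q))]) \/
     forall p, prime p -> p != q -> 'O_p(K) \subset 'N(Q).
  - case: (boolP (all [pred p | (p != q) ==> ('O_p(K) \subset 'N(Q))] (primes #|M|))).
      move/allP=> allN; right=> p p_pr neq.
      have [/allN/implyP-> // | nop] := boolP (p \in primes #|M|).
      have -> : 'O_p(K) = 1; last exact: sub1G.
      apply/card1_trivg; rewrite (card_Hall (sylr p neq)); apply/eqP.
      by move: nop; rewrite -p_part_gt1 -leqNgt eqn_leq part_gt0 andbT.
    case/allPn=> p; rewrite mem_primes => /andP[p_pr _] /=.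
    by rewrite negb_imply => /andP[]; left; exists p.
  - by exists p.
  case/negP; apply/dvdn_partP=> // r; rewrite mem_primes => /andP[r_pr _].
  have [-> | neq] := eqVneq r q.
    by rewrite -(card_Hall sylQ) cardSg // subsetI sQM normG.
  by rewrite -(card_Hall (sylr r neq)) cardSg // subsetI (pHall_sub (sylr r neq)) noN.
pose P := 'O_p(K)%G; have sylP : p.-Sylow(M) P := sylr p neqpq.
have [sPM pP _] := and3P sylP; have nPM : P <| M := norr p.
have nPQ : Q \subset 'N(P) := subset_trans sQM (normal_norm nPM).
have copq : coprime #|P| #|Q|.
  exact: pnat_neq_coprime pP qQ.
have nilPQ (P0 Q0 : {group gT}) : P0 \subset P -> Q0 \subset Q -> Q0 \subset 'N(P0) ->
    P0 * Q0 != M -> Q0 \subset 'C(P0).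
  move=> sP0 sQ0 nP0 neqM; have /nilM nil0 : P0 <*> Q0 \proper M.
    rewrite properEneq join_subG (subset_trans sP0) ?(subset_trans sQ0) //= andbT.
    by rewrite norm_joinEr.
  apply: (sub_nilpotent_cent2 nil0 (joing_subl _ _) (joing_subr _ _)).
  by rewrite (coprimeSg sP0) ?(coprimegS sQ0).
have defM : P * Q = M.
  apply/eqP/idPn=> neqM; case/negP: nNP.
  by rewrite cents_norm // centsC nilPQ.
have ncent : ~~ (Q \subset 'C(P)) by apply: contra nNP => cQ; rewrite cents_norm // centsC.
have cent2 (Q0 : {group gT}) : Q0 \proper Q -> Q0 \subset 'C(P).
  move=> ltQ0; have sQ0 := proper_sub ltQ0.
  apply: nilPQ => //; first exact: subset_trans nPQ.
  apply: contraTneq (proper_card ltQ0) => defM0; rewrite -leqNgt.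
  rewrite -(leq_pmul2l (cardG_gt0 P)) -(coprime_cardMg copq) defM -defM0.
  by rewrite mul_cardG leq_pmulr ?cardG_gt0.
exists p, q, P, Q; split=> // [|P0 ltP0 nP0].
  have [// | ncyc] := boolP (cyclic Q); case/negP: ncent; apply/subsetP=> x Qx.
  have /cent2 : <[x]> \proper Q.
    rewrite properEneq cycle_subG Qx andbT.
    by apply: contraNneq ncyc => <-; apply: cycle_cyclic.
  by rewrite cycle_subG.
rewrite centsC; apply: nilPQ => //; first exact: proper_sub.
apply: contraTneq (proper_card ltP0) => defM0; rewrite -leqNgt.
rewrite -(leq_pmul2r (cardG_gt0 Q)) -(coprime_cardMg copq) defM -defM0.
by rewrite mul_cardG leq_pmulr ?cardG_gt0.
Qed.

End SchmidtTheorem.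

(** * Simple groups whose proper subgroups are nilpotent or minimal non-nilpotent *)

Section FrobeniusNormalisers.

Import GroupScope.

(** * Sylow subgroups of a minimal non-nilpotent group *)

Section SchmidtSylow.
Variable gT : finGroupType.
Implicit Types (M P Q U : {group gT}).

Lemma Schmidt_card p q M P Q : Schmidt p q M P Q -> #|M| = (#|P| * #|Q|)%N.
Proof.
case=> _ _ neq sylP sylQ _ <- _ _ _ _; rewrite coprime_cardMg //.
exact: pnat_neq_coprime (pHall_pgroup sylP) (pHall_pgroup sylQ).
Qed.

Lemma Schmidt_ncent_normal p q M P Q : Schmidt p q M P Q -> ~~ (Q <| M).
Proof.
case=> _ _ neq sylP sylQ /andP[_ nPM] _ _ /negP ncQ _ _; apply/negP=> /andP[_ nQM]; case: ncQ.
rewrite centsC; apply/commG1P/trivgP.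
have <- : P :&: Q = 1.
  apply: coprime_TIg; exact: pnat_neq_coprime (pHall_pgroup sylP) (pHall_pgroup sylQ).
rewrite subsetI commg_subl commg_subr.
by rewrite (subset_trans (pHall_sub sylQ)) ?(subset_trans (pHall_sub sylP)).
Qed.

Lemma Schmidt_nnil p q M P Q : Schmidt p q M P Q -> ~~ nilpotent M.
Proof.
move=> schM; apply: contra (Schmidt_ncent_normal schM) => nilM.
exact: nil_Sylow_normal (Schmidt_Sylow2 schM).
Qed.

Lemma Schmidt_pi p q M P Q r :
  Schmidt p q M P Q -> prime r -> r %| #|M| -> (r == p) || (r == q).
Proof.
move=> schM r_pr; rewrite (Schmidt_card schM) Euclid_dvdM // => /orP[dvP | dvQ].
  by have := pgroupP (pHall_pgroup (Schmidt_Sylow1 schM)) r r_pr dvP; rewrite inE => ->.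
by have := pgroupP (pHall_pgroup (Schmidt_Sylow2 schM)) r r_pr dvQ; rewrite inE orbC => ->.
Qed.

Lemma Schmidt_normal_Sylow p q M P Q r U :
    Schmidt p q M P Q -> prime r -> r.-Sylow(M) U -> U :!=: 1 -> U <| M ->
  r = p /\ U :=: P.
Proof.
move=> schM r_pr sylU ntU nUM.
have rM : r %| #|M|.
  have [_ rU _] := and3P sylU; have [_ + _] := pgroup_pdiv rU ntU.
  by move/dvdn_trans; apply; apply: cardSg (pHall_sub sylU).
have eqU s (V : {group gT}) : r = s -> s.-Sylow(M) V -> U :=: V.
  move=> <- sylV; have [x Mx ->] := Sylow_trans sylU sylV.
  by apply/esym/normP; apply: (subsetP (normal_norm nUM)).
case/orP: (Schmidt_pi schM r_pr rM) => /eqP eqr.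
  by split=> //; apply: eqU eqr (Schmidt_Sylow1 schM).
case/negP: (Schmidt_ncent_normal schM).
by rewrite /normal -(eqU _ _ eqr (Schmidt_Sylow2 schM)).
Qed.

Lemma Schmidt_cyclic_Sylow p q M P Q r U :
    Schmidt p q M P Q -> prime r -> r.-Sylow(M) U -> ~~ (U <| M) ->
  r = q /\ cyclic U.
Proof.
move=> schM r_pr sylU nnU.
have ntU : U :!=: 1 by apply: contraNneq nnU => ->; rewrite normal1.
have rM : r %| #|M|.
  have [_ rU _] := and3P sylU; have [_ + _] := pgroup_pdiv rU ntU.
  by move/dvdn_trans; apply; apply: cardSg (pHall_sub sylU).
case/orP: (Schmidt_pi schM r_pr rM) => /eqP eqr; rewrite eqr in sylU *.
  have [x Mx defU] := Sylow_trans (Schmidt_Sylow1 schM) sylU.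
  case/negP: nnU; rewrite defU (normP _) ?(Schmidt_normal schM) //.
  by apply: (subsetP (normal_norm (Schmidt_normal schM))).
have [x Mx ->] := Sylow_trans (Schmidt_Sylow2 schM) sylU.
by rewrite cyclicJ (Schmidt_cyclic schM).
Qed.

End SchmidtSylow.

(** * Sylow normalisers in the simple group *)

Section SimpleStructure.
Variables (gT : finGroupType) (G : {group gT}).
Hypotheses (simG : simple G) (nsolG : ~~ solvable G).
Hypothesis nil2 : forall K : {group gT}, K \proper G -> proper_nil K.
Implicit Types (P Q T : {group gT}).

Lemma simple_ltG (p : nat) P : p.-group P -> P \subset G -> P \proper G.
Proof.
move=> pP sPG; rewrite properEneq sPG andbT.
by apply: contraNneq nsolG => defP; rewrite -defP (pgroup_sol pP).
Qed.

Lemma Schmidt_Sylow_norm p P :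
    prime p -> p.-Sylow(G) P -> P :!=: 1 -> ~~ nilpotent 'N_G(P) ->
  exists q (Q : {group gT}), Schmidt p q 'N_G(P) P Q.
Proof.
move=> p_pr sylP ntP nnilN; have [sPG pP _] := and3P sylP.
have ltN := simple_norm_proper simG (simple_ltG pP sPG) ntP.
have [r [q [P1 [Q schN]]]] := Schmidt_exists (nil2 ltN) nnilN.
have sylPN : p.-Sylow('N_G(P)) P.
  by apply: pHall_subl sylP; rewrite ?subsetIl // subsetI sPG normG.
have [eqp eqP] : p = r /\ P :=: P1.
  by apply: (Schmidt_normal_Sylow schN) => //; rewrite normalSG.
exists q, Q; move: schN; rewrite -eqp.
by have <- : P = P1 by apply: val_inj.
Qed.

(** For a maximal non-trivial intersection [D], the group ['N_G(D)] has a non-normal Sylow subgroup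
    ['N_P(D)], so it is minimal non-nilpotent and ['N_P(D)] is cyclic. This spreads to [P], and the
    coprime action of a complement on the cyclic group [P] leaves no room for [D]. *)
Lemma simple_Sylow_TI p P :
    prime p -> p.-Sylow(G) P -> P :!=: 1 ->
  forall g, g \in G -> P :&: P :^ g != 1 -> P :^ g = P.
Proof.
move=> p_pr sylP ntP; have [sPG pP _] := and3P sylP.
case: (TI_or_max_Sylow_inter P G) => // -[g [Gg neqP ntD maxD]].
have [sylN nnN] := max_Sylow_inter sylP Gg neqP maxD.
set D := P :&: P :^ g in ntD sylN nnN *.
have sDP : D \subset P := subsetIl _ _.
have ltDG : D \proper G := sub_proper_trans sDP (simple_ltG pP sPG).
have ltN := simple_norm_proper simG ltDG ntD.
have nnilN : ~~ nilpotent 'N_G(D).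
  by apply: contra nnN => nilN; apply: nil_Sylow_normal sylN.
have [r [q [P1 [Q schN]]]] := Schmidt_exists (nil2 ltN) nnilN.
have [_ cycU] := Schmidt_cyclic_Sylow schN p_pr sylN nnN.
have sDU : D \subset 'N_P(D) by rewrite subsetI sDP normG.
(* [D] is characteristic in the cyclic group ['N_P(D)], so the normaliser of ['N_P(D)] in [P] still
   normalises [D], and the growth of normalisers stops at [P]. *)
have defP : 'N_P(D) = P.
  apply/eqP/idPn=> neqU.
  have ltU : 'N_P(D) \proper P by rewrite properEneq neqU subsetIl.
  have := nilpotent_proper_norm (pgroup_nil pP) ltU.
  rewrite properE => /andP[_ /negP[]].
  rewrite subsetI subsetIl /=; apply: subset_trans (subsetIr _ _) _.
  by apply: char_norms; rewrite sub_cyclic_char.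
have cycP : cyclic P by rewrite -defP.
have abP := cyclic_abelian cycP.
have nnilNP : ~~ nilpotent 'N_G(P).
  apply: (perfect_norm_Sylow_not_nil sylP ntP (simple_perfect simG nsolG)) => x h.
  exact: (abelian_Sylow_fusion sylP abP).
have [q1 [Q1 schP]] := Schmidt_Sylow_norm p_pr sylP ntP nnilNP.
have nPQ1 : Q1 \subset 'N(P).
  exact: subset_trans (pHall_sub (Schmidt_Sylow2 schP)) (subsetIr _ _).
have coPQ : coprime #|P| #|Q1|.
  have [pP1 qQ1] := (pHall_pgroup (Schmidt_Sylow1 schP), pHall_pgroup (Schmidt_Sylow2 schP)).
  exact: pnat_neq_coprime (Schmidt_neq schP) pP1 qQ1.
have ltDP : D \proper P.
  rewrite properEneq sDP andbT; apply: contraNneq neqP => defD.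
  by rewrite eq_sym eqEcard cardJg leqnn andbT -{1}defD subsetIr.
have cDQ : D \subset 'C(Q1).
  apply: (Schmidt_cent1 schP ltDP); apply: subset_trans nPQ1 _.
  by apply: char_norms; rewrite sub_cyclic_char.
case/negP: (Schmidt_ncent schP).
(* [[~: P, Q1]] meets ['C(Q1)] trivially. If it is [P], the subgroup [D], which [Q1] centralises, is
   trivial; if it is proper, it is centralised by [Q1] and hence trivial. *)
case: (eqVneq [~: P, Q1] P) => [defPQ | neqPQ].
  case/eqP: ntD; apply/trivgP.
  rewrite -(coprime_abel_cent_TI nPQ1 coPQ abP) subsetI cDQ andbT.
  by rewrite defPQ.
have sPQP : [~: P, Q1] \subset P by rewrite commg_subl.
have : [~: P, Q1] \subset 'C(Q1).
  apply: (Schmidt_cent1 schP); first by rewrite properEneq neqPQ.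
  exact: commg_normr.
move=> cPQ; rewrite centsC; apply/commG1P/trivgP.
by rewrite -(coprime_abel_cent_TI nPQ1 coPQ abP) subsetI subxx.
Qed.

Lemma simple_Sylow_Schmidt p P :
    prime p -> p.-Sylow(G) P -> P :!=: 1 ->
  exists q (Q : {group gT}), Schmidt p q 'N_G(P) P Q.
Proof.
move=> p_pr sylP ntP; apply: Schmidt_Sylow_norm => //.
apply: (perfect_norm_Sylow_not_nil sylP ntP (simple_perfect simG nsolG)).
by apply: TI_Sylow_fusion; apply: simple_Sylow_TI sylP ntP.
Qed.

Lemma simple_Sylow_normedTI p P :
  prime p -> p.-Sylow(G) P -> P :!=: 1 -> normedTI P^# G 'N_G(P).
Proof.
move=> p_pr sylP ntP; apply/normedTI_memJ_P; split; rewrite ?subsetIl //.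
  by rewrite setD_eq0 subG1.
move=> a g /setD1P[nta Pa] Gg; rewrite in_setD1 conjg_eq1 nta inE Gg /=.
apply/idP/normP=> [Pag | nPg]; last by rewrite -nPg memJ_conjg.
apply: (simple_Sylow_TI p_pr sylP ntP Gg).
by apply/trivgPn; exists (a ^ g); rewrite ?conjg_eq1 // inE Pag memJ_conjg.
Qed.

Lemma simple_cent_Sylow p P x y :
    prime p -> p.-Sylow(G) P -> x \in P -> x != 1 -> y \in 'C_G[x] -> y \in 'N_G(P).
Proof.
move=> p_pr sylP Px ntx; have ntP : P :!=: 1 by apply/trivgPn; exists x.
by apply/subsetP/(cent1_normedTI (simple_Sylow_normedTI p_pr sylP ntP)); rewrite !inE ntx.
Qed.

(** Otherwise an element [z] of order [q] generates a proper subgroup of the cyclic group [Q] and is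
    central in ['N_G(P)]. For a Sylow [q]-subgroup [T] above [Q], the trivial intersection property
    gives ['N_G(P) \subset 'N_G(T)]. Equality holds because the smaller group is not nilpotent, and
    then [Q = T] is normal in ['N_G(P)]. *)
Lemma simple_Schmidt_prime p q P Q :
  p.-Sylow(G) P -> Schmidt p q 'N_G(P) P Q -> #|Q| = q.
Proof.
move=> sylP schM; have q_pr := Schmidt_prime2 schM.
have sylQ := Schmidt_Sylow2 schM; have [sQM qQ _] := and3P sylQ.
have ntQ : Q :!=: 1 by apply: contraNneq (Schmidt_ncent schM) => ->; apply: sub1G.
have [_ dvqQ _] := pgroup_pdiv qQ ntQ.
have [z Qz oz] := Cauchy q_pr dvqQ.
have ntz : z != 1 by rewrite -order_gt1 oz prime_gt1.
apply/eqP/idPn=> neqQ.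
have cPz : <[z]> \subset 'C(P).
  apply: (Schmidt_cent2 schM); rewrite properEcard cycle_subG Qz /= -orderE oz.
  by rewrite ltn_neqAle eq_sym neqQ dvdn_leq.
have sMC : 'N_G(P) \subset 'C_G[z].
  rewrite subsetI subsetIl -(Schmidt_prod schM) mul_subG ?sub_cent1 //.
    by rewrite -cycle_subG.
  by apply: subsetP Qz; apply: cyclic_abelian (Schmidt_cyclic schM).
have [T sylT sQT] := Sylow_superset (subset_trans sQM (subsetIl _ _)) qQ.
have [sTG qT _] := and3P sylT; have Tz := subsetP sQT z Qz.
have ntT : T :!=: 1 by apply/trivgPn; exists z.
have ltN := simple_norm_proper simG (simple_ltG qT sTG) ntT.
have sMN : 'N_G(P) \subset 'N_G(T).
  by apply/subsetP=> y /(subsetP sMC) /(simple_cent_Sylow q_pr sylT Tz ntz).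
have defM : 'N_G(P) = 'N_G(T).
  apply/eqP/idPn=> neqM; case/negP: (Schmidt_nnil schM).
  by apply: (nil2 ltN); rewrite properEneq neqM.
case/negP: (Schmidt_ncent_normal schM); rewrite /= defM.
have -> : Q :=: T; last by rewrite normalSG.
by apply/esym/(sub_pHall sylQ qT sQT); rewrite /= defM subsetI sTG normG.
Qed.

(* If z in P were centralised by Q, then z would normalise a Sylow q-subgroup
   T above Q; the conjugates of N(P) and of T would then contain too many
   elements for G. *)
Lemma simple_Schmidt_fpf p q P Q :
  p.-Sylow(G) P -> Schmidt p q 'N_G(P) P Q -> 'C_P(Q) = 1.
Proof.
move=> sylP schM; have [p_pr q_pr] := (Schmidt_prime1 schM, Schmidt_prime2 schM).
have neqpq := Schmidt_neq schM; have oQ := simple_Schmidt_prime sylP schM.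
have sylQ := Schmidt_Sylow2 schM; have [sQM qQ _] := and3P sylQ.
have [sPG pP _] := and3P sylP.
pose M := 'N_G(P)%G; rewrite -[('N_G(P))%G]/M in schM sylQ sQM *.
apply/eqP/idPn=> /trivgPn[z /setIP[Pz cQz] ntz].
have ntP : P :!=: 1 by apply/trivgPn; exists z.
have sMG : M \subset G := subsetIl _ _.
have [T sylT sQT] := Sylow_superset (subset_trans sQM sMG) qQ.
have [sTG qT _] := and3P sylT.
have ntQ : Q :!=: 1 by rewrite -cardG_gt1 oQ prime_gt1.
have ntT : T :!=: 1 by apply: contraNneq ntQ => T1; rewrite -subG1 -T1.
have Nz : z \in 'N_G(T).
  have [y Qy nty] := trivgPn _ ntQ.
  apply: (simple_cent_Sylow q_pr sylT (subsetP sQT y Qy) nty).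
  rewrite inE (subsetP sPG) //=; apply/cent1P; apply: (centP cQz).
  exact: Qy.
have [r [R schN]] := simple_Sylow_Schmidt q_pr sylT ntT.
have oR := simple_Schmidt_prime sylT schN.
have pz : p.-elt z := mem_p_elt pP Pz.
have pdz : p %| #[z].
  by have [|_ -> //] := pgroup_pdiv pz; rewrite cycle_eq1.
have eqr : p = r.
  have /orP[/eqP eqpq|/eqP//] := Schmidt_pi schN p_pr (dvdn_trans pdz (order_dvdG Nz)).
  by rewrite eqpq eqxx in neqpq.
have oM : #|M| = (#|P| * q)%N by rewrite (Schmidt_card schM) oQ.
have oN : #|'N_G(T)| = (#|T| * p)%N by rewrite (Schmidt_card schN) oR eqr.
(* If [P] had order [p], it would be generated by [z], which [Q] centralises. *)
have nP : (p * p <= #|P|)%N.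
  have [[|[|k]] oP] := p_natP pP; rewrite oP ?expn0 ?expn1.
  - by rewrite -cardG_gt1 oP in ntP.
  - case/negP: (Schmidt_ncent schM); have <- : <[z]> = P.
      apply/eqP; rewrite eqEcard cycle_subG Pz oP expn1 dvdn_leq ?order_gt0 //.
    by rewrite centsC cycle_subG.
  by rewrite !expnS mulnA leq_pmulr ?expn_gt0 ?prime_gt0.
(* If [T] had order [q], it would be [Q], centralised by [z]; but [<[z]>] would be a Sylow
   [p]-subgroup of ['N_G(T)], a conjugate of the complement [R]. *)
have nT : (q * q <= #|T|)%N.
  have [[|[|k]] oT] := p_natP qT; rewrite oT ?expn0 ?expn1.
  - by rewrite -cardG_gt1 oT in ntT.
  - have defT : T :=: Q by apply/eqP; rewrite eq_sym eqEcard sQT oT oQ expn1 leqnn.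
    have sylz : p.-Sylow('N_G(T)) <[z]>.
      rewrite pHallE cycle_subG Nz oN partnM ?cardG_gt0 ?prime_gt0 //.
      rewrite part_p'nat; last by rewrite (pi_pnat qT) // !inE eq_sym.
      rewrite part_pnat_id ?pnat_id // mul1n eqn_dvd pdz andbT.
      have := order_dvdG Nz; rewrite oN mulnC Gauss_dvdl //.
      exact: pnat_neq_coprime pz qT.
    have sylR := Schmidt_Sylow2 schN; rewrite -eqr in sylR.
    have [n Nn defR] := Sylow_trans sylz sylR.
    case/negP: (Schmidt_ncent schN); rewrite defR.
    have <- : T :^ n = T by apply/normP; case/setIP: Nn.
    by rewrite centJ conjSg cycle_subG defT.
  by rewrite !expnS mulnA leq_pmulr ?expn_gt0 ?prime_gt0.
(* These are the elements of [M] with non-trivial [p]-part. This part lies in [P^#], so [A] inherits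
   the trivial intersection property, with normaliser [M]. *)
pose A := M :\: class_support Q M.
have nPM : P <| M by rewrite /= normalSG.
have pq1 (x : gT) : p.-elt x -> q.-elt x -> x = 1.
  move=> px qx; apply/eqP; rewrite -order_eq1 -dvdn1.
  have /eqP <- : coprime #[x] #[x]; last by rewrite gcdnn.
  exact: pnat_neq_coprime px qx.
have clQ x : x \in class_support Q M -> q.-elt x.
  rewrite class_supportEr => /bigcupP[m _]; apply: mem_p_elt.
  by rewrite pgroupJ.
have Ap a : a \in A -> a.`_p != 1 /\ a.`_p \in P.
  case/setDP=> Ma nQa; split; last first.
    have Map : a.`_p \in M by rewrite /constt groupX.
    by rewrite (mem_normal_Hall (Schmidt_Sylow1 schM)) ?p_elt_constt.
  apply: contraNneq nQa => ap1.
  have qa : q.-group <[a]>.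
    have p'a : p^'.-elt a by rewrite -(consttC p a) ap1 mul1g p_elt_constt.
    apply: pnat_dvd (pnat_id q_pr); have := order_dvdG Ma.
    rewrite oM mulnC Gauss_dvdl // coprime_sym; exact: pnat_coprime pP p'a.
  have saM : <[a]> \subset M by rewrite cycle_subG.
  have [m Mm] := Sylow_Jsub sylQ saM qa.
  rewrite sub_conjg cycle_subG => Qa; rewrite class_supportEr.
  by apply/bigcupP; exists m^-1; rewrite ?groupV.
have tiA : normedTI A G M.
  apply/normedTI_memJ_P; split=> //.
    apply/set0Pn; exists z; rewrite inE (subsetP (normal_sub nPM)) // andbT.
    by apply: contra ntz => /clQ qz; apply/eqP/pq1.
  move=> a g Aa Gg; have [ntap Pap] := Ap a Aa; apply/idP/idP=> [Aag | Mg].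
    have [_] := Ap _ Aag; rewrite consttJ => Papg.
    have /normedTI_memJ_P[_ _ ti] := simple_Sylow_normedTI p_pr sylP ntP.
    by rewrite -(ti a.`_p g) // in_setD1 ?conjg_eq1 ?ntap.
  case/setDP: Aa => Ma nQa; rewrite inE groupJ // andbT.
  apply: contra nQa => /imset2P[x y Qx My eqag].
  by rewrite -(conjgK g a) eqag -conjgM; apply: imset2_f; rewrite ?groupM ?groupV.
have oA := card_support_normedTI tiA.
have oB := card_support_normedTI (simple_Sylow_normedTI q_pr sylT ntT).
have le1 : (#|class_support A G| + #|class_support T^# G| + 1 <= #|G|)%N.
  have A1 a : a \in class_support A G -> a.`_p != 1 /\ a \in G.
    case/imset2P=> b g Ab Gg ->; have [ntb _] := Ap b Ab.
    by rewrite consttJ conjg_eq1 groupJ // (subsetP sMG) //; case/setDP: Ab.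
  have B1 b : b \in class_support T^# G -> [/\ b != 1, b \in G & q.-elt b].
    case/imset2P=> t g /setD1P[ntt Tt] Gg ->.
    split; [by rewrite conjg_eq1 | by rewrite groupJ // (subsetP sTG) |].
    by rewrite p_eltJ (mem_p_elt qT).
  have dAB : class_support A G :&: class_support T^# G = set0.
    apply/setP=> x; rewrite !inE; apply/negP=> /andP[/A1[/eqP ntx _] /B1[_ _ qx]].
    apply: ntx; apply: pq1 (p_elt_constt _ _) _; rewrite /constt.
    by apply: mem_p_elt qx (mem_cycle _ _).
  rewrite -cardsUI dAB cards0 addn0 addn1 (cardsD1 1 G) group1 ltnS.
  apply: subset_leq_card; apply/subsetP=> x; rewrite in_setD1.
  case/setUP=> [/A1[ntx ->] | /B1[-> ->] //]; rewrite andbT.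
  by apply: contraNneq ntx => ->; rewrite constt1.
have oCQ : (#|class_support Q M| <= 1 + q.-1 * #|M : 'N_M(Q)|)%N.
  have -> : class_support Q M = 1 |: class_support Q^# M.
    apply/setP=> x; rewrite in_setU1 !class_supportEr; apply/bigcupP/orP.
      case=> m Mm Qx; have [-> | ntx] := eqVneq x 1; [by left | right].
      by apply/bigcupP; exists m; rewrite // conjD1g !inE ntx.
    case=> [/eqP-> | /bigcupP[m Mm]]; first by exists 1; rewrite ?group1.
    by rewrite conjD1g => /setD1P[_ Qx]; exists m.
  apply: leq_trans (leq_card_setU _ _).1 _; rewrite cards1 leq_add2l.
  have -> : class_support Q^# M = cover (Q^# :^: M) by rewrite class_supportEr cover_imset.
  apply: leq_trans (leq_card_cover _).1 _.
  rewrite (eq_bigr (fun _ => q.-1)); last first.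
    by move=> _ /imsetP[m _ ->]; rewrite cardJg (cardsD1 1 Q) group1 in oQ *; rewrite -oQ.
  by rewrite sum_nat_const mulnC card_conjugates normD1.
(* The fixed point [z] enters here: ['N_M(Q)] contains ['C_P(Q) * Q], of order at least [p * q], so
   [Q] has few conjugates and [A] is large. *)
have iN : (#|M : 'N_M(Q)| * p <= #|P|)%N.
  have sCN : 'C_P(Q) * Q \subset 'N_M(Q).
    rewrite mul_subG // subsetI; last by rewrite sQM normG.
    by rewrite (subset_trans (subsetIl _ _) (normal_sub nPM)) subIset // cent_sub orbT.
  have pC : (p * q <= #|'N_M(Q)|)%N.
    apply: leq_trans (subset_leq_card sCN).
    have tiCQ : 'C_P(Q) :&: Q = 1.
      apply/trivgP/subsetP=> x /setIP[/setIP[Px _] Qx]; rewrite inE; apply/eqP.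
      exact: pq1 (mem_p_elt pP Px) (mem_p_elt qQ Qx).
    rewrite TI_cardMg // oQ leq_pmul2r ?prime_gt0 // dvdn_leq ?cardG_gt0 //.
    by apply: dvdn_trans pdz (order_dvdG _); rewrite inE Pz.
  rewrite -(leq_pmul2r (prime_gt0 q_pr)) -oM -(Lagrange (subsetIl M 'N(Q))) -mulnA.
  by rewrite mulnC leq_pmul2r ?indexg_gt0.
have oG1 := Lagrange sMG; have oG2 := Lagrange (subsetIl G 'N(T)).
have oA1 : (#|A| + #|class_support Q M| = #|M|)%N.
  rewrite -(cardsID (class_support Q M) M) addnC; congr (_ + _)%N.
  apply: eq_card => x; rewrite inE; apply/idP/andP=> [cx | [] //]; split=> //.
  by case/imset2P: cx => y m /(subsetP sQM) My Mm ->; rewrite groupJ.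
have oT1 : #|T^#| = #|T|.-1 by rewrite (cardsD1 1 T) group1.
move: le1; rewrite oA oB oT1 -oG1 oM.
rewrite oN in oG2; rewrite oM in oG1 oA1.
have [p1 q1] := (prime_gt1 p_pr, prime_gt1 q_pr).
move: oG1 oG2 oA1 oCQ iN nP nT (cardG_gt0 T) (cardG_gt0 P).
set i := #|G : M|; set j := #|G : 'N_G(T)|; set e := #|M : 'N_M(Q)|.
set u := #|class_support Q M|.
move: #|P| #|T| #|A| #|G| i j e u => P1 T1 A1 n i j e u; clear -p1 q1.
move=> oG1 oG2 oA1 oCQ iN nP nT T0 P0 le1.
have le2 : (T1.-1 * j + 1 <= u * i)%N by nia.
have le3 : (u * i * p <= i * p + q.-1 * (i * P1))%N.
  rewrite -mulnA; apply: leq_trans (leq_mul oCQ (leqnn (i * p)%N)) _.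
  by rewrite mulnDl mul1n leq_add2l -mulnA leq_mul2l mulnCA leq_mul2l iN !orbT.
have le4 : (T1 * p * j + p <= T1.-1 * j * p + p + j * p)%N by nia.
(* This contradicts [p * p <= P1] and [q * q <= T1], which make each of [i * p] and [j * p] at most
   half of [i * P1]. *)
have le5 : (i * P1 + p <= i * p + j * p)%N.
  have e1 : (P1 * q * i = i * P1 + q.-1 * (i * P1))%N by nia.
  have := leq_mul le2 (leqnn p); rewrite mulnDl mul1n; lia.
have le6 : (2 * (i * p) <= i * P1)%N by nia.
have le7 : (q * (q * (j * p)) <= q * (i * P1))%N by nia.
rewrite leq_pmul2l in le7; last by lia.
have le8 : (2 * (j * p) <= i * P1)%N by nia.
lia.
Qed.

Lemma simple_Schmidt_irr p q P Q (P0 : {group gT}) :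
    p.-Sylow(G) P -> Schmidt p q 'N_G(P) P Q ->
  P0 \proper P -> Q \subset 'N(P0) -> P0 :=: 1.
Proof.
move=> sylP schM ltP0 nP0; apply/trivgP.
rewrite -(simple_Schmidt_fpf sylP schM) subsetI proper_sub //.
exact: (Schmidt_cent1 schM).
Qed.

End SimpleStructure.

(** The interface between the local analysis and the two global counts, which see Sylow subgroups
    only through this record. [FS_fpf] is the Frobenius condition and [FS_irr] the irreducibility of
    the action of [Q] on [P]. *)
Record Frobenius_Sylow (gT : finGroupType) (G : {group gT}) (p q : nat)
    (P Q : {group gT}) : Prop := {
  FS_prime1 : prime p;
  FS_prime2 : prime q;
  FS_neq : p != q;
  FS_Sylow : p.-Sylow(G) P;
  FS_nt : P :!=: 1;
  FS_sub : Q \subset 'N_G(P);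
  FS_card : #|Q| = q;
  FS_prod : P * Q = 'N_G(P);
  FS_cardN : #|'N_G(P)| = (#|P| * q)%N;
  FS_abelem : p.-abelem P;
  FS_TI : normedTI P^# G 'N_G(P);
  FS_cent : forall x, x \in P^# -> 'C_G[x] = P;
  FS_irr : forall P0 : {group gT}, P0 \proper P -> Q \subset 'N(P0) -> P0 :=: 1;
  FS_fpf : forall x y, x \in P -> y \in 'N_G(P) -> x ^ y = x -> x = 1 \/ y \in P;
  FS_nnil : ~~ nilpotent 'N_G(P)
}.

(** The derived and Frattini subgroups of [P] are proper and [Q]-invariant, hence trivial by
    irreducibility. For [x] in [P^#] the centraliser in ['N_G(P)] contains [P] with index dividing
    the prime [q]; index [q] would put [x] in ['C_P(Q) = 1]. *)
Theorem simple_Frobenius_Sylow (gT : finGroupType) (G : {group gT}) :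
    simple G -> ~~ solvable G ->
    (forall K : {group gT}, K \proper G -> proper_nil K) ->
  forall (p : nat) (P : {group gT}), prime p -> p.-Sylow(G) P -> P :!=: 1 ->
  exists q (Q : {group gT}), Frobenius_Sylow G p q P Q.
Proof.
move=> simG nsolG nil2 p P p_pr sylP ntP.
have [q [Q schM]] := simple_Sylow_Schmidt simG nsolG nil2 p_pr sylP ntP.
have oQ := simple_Schmidt_prime simG nsolG nil2 sylP schM.
have irr P0 := simple_Schmidt_irr simG nsolG nil2 sylP schM (P0 := P0).
have fpf := simple_Schmidt_fpf simG nsolG nil2 sylP schM.
have q_pr := Schmidt_prime2 schM; have [sPG pP _] := and3P sylP.
have sylQ := Schmidt_Sylow2 schM; have [sQM qQ _] := and3P sylQ.
have nPQ : Q \subset 'N(P) := subset_trans sQM (subsetIr _ _).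
have abP : abelian P.
  apply/derG1P; apply: irr; first exact: sol_der1_proper (pgroup_sol pP) (subxx P) ntP.
  exact: gFnorm_trans.
have abelP : p.-abelem P.
  rewrite -(trivg_Phi pP); apply/eqP; apply: irr; last exact: gFnorm_trans.
  exact: Phi_proper.
have TI := simple_Sylow_normedTI simG nsolG nil2 p_pr sylP ntP.
have cPN x y : x \in P -> y \in 'N_G(P) -> x ^ y = x -> x = 1 \/ y \in P.
  move=> Px Ny cxy; have [-> | ntx] := eqVneq x 1; first by left.
  right; apply/idPn=> nPy.
  have [sCM sPC] : 'C_('N_G(P))[x] \subset 'N_G(P) /\ P \subset 'C_('N_G(P))[x].
    rewrite subsetIl !subsetI sPG normG sub_cent1 //; split=> //.
    exact: (subsetP abP).
  have yC : y \in 'C_('N_G(P))[x].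
    by rewrite inE Ny; apply/cent1P; apply/esym/commgP/conjg_fixP.
  have oM := Schmidt_card schM; rewrite oQ /= in oM.
  have : #|'C_('N_G(P))[x]| = #|'N_G(P)|.
    apply/eqP; rewrite eqn_dvd cardSg //= oM -(Lagrange sPC) dvdn_pmul2l ?cardG_gt0 //.
    have : #|'C_('N_G(P))[x] : P| %| q.
      by rewrite -(dvdn_pmul2l (cardG_gt0 P)) -oM Lagrange // cardSg.
    case/primeP: q_pr => _ /[apply]; case/orP=> /eqP iC; last by rewrite iC.
    by case/negP: nPy; apply: subsetP yC; rewrite -indexg_eq1 iC.
  move/eqP=> oC; have eqC : 'C_('N_G(P))[x] = 'N_G(P).
    by apply/eqP; rewrite eqEcard sCM (eqP oC) leqnn.
  have : x \in 'C_P(Q).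
    by rewrite inE Px -sub_cent1; apply: subset_trans sQM _; rewrite /= -eqC subsetIr.
  by rewrite fpf => /set1P x1; rewrite x1 eqxx in ntx.
have nt : ~~ nilpotent 'N_G(P) := Schmidt_nnil schM.
exists q, Q; split=> //.
- exact: Schmidt_neq schM.
- exact: Schmidt_prod schM.
- by rewrite (Schmidt_card schM) oQ.
move=> x /setD1P[ntx Px]; apply/eqP; rewrite eqEsubset subsetI sPG sub_cent1.
rewrite (subsetP abP) // !andbT; apply/subsetP=> y Cy.
have Ny := simple_cent_Sylow simG nsolG nil2 p_pr sylP Px ntx Cy.
have [|x1|//] := cPN x y Px Ny; last by rewrite x1 eqxx in ntx.
by apply/conjg_fixP/commgP; apply/commute_sym; apply/cent1P; case/setIP: Cy.
Qed.

End FrobeniusNormalisers.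

(** * Even order: counting involutions *)

Section EvenOrder.

Import GroupScope.

(** * The numerical equation for involutions *)

Section InvolutionArithmetic.
Local Open Scope nat_scope.

Lemma prod_primes_dvd (K : seq nat) m :
  uniq K -> all prime K -> all (fun p => p %| m) K -> \prod_(p <- K) p %| m.
Proof.
elim: K => [|p K IHK] /=; first by rewrite big_nil dvd1n.
case/andP=> npK uK /andP[p_pr prK] /andP[pm Km].
rewrite big_cons Gauss_dvd ?pm ?IHK // big_seq.
apply: (big_ind (coprime p)) => [|x y px py|r Kr]; rewrite ?coprimen1 ?coprimeMr ?px //.
rewrite prime_coprime // dvdn_prime2 ?(allP prK r Kr) //.
by apply: contraNneq npK => ->.
Qed.

Lemma prod_ge_sum (K : seq nat) :
  all prime K -> 1 + \sum_(p <- K) p.-1 <= \prod_(p <- K) p.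
Proof.
elim: K => [|p K IHK] /=; first by rewrite !big_nil.
case/andP=> p_pr /IHK; rewrite !big_cons; have := prime_gt1 p_pr.
move: (\sum_(_ <- _) _) (\prod_(_ <- _) _) => s t; nia.
Qed.

(* The last hypothesis counts the pairs of involutions by their product; 2 ^ a
   is the order of a Sylow 2-subgroup, m its number of conjugates and K the set
   of primes whose Sylow normalisers are dihedral. *)
Lemma involution_arith a q u m (K : seq nat) :
    0 < a -> prime q -> 2 ^ a = u * q + 1 -> 1 < m ->
    uniq K -> all prime K -> 2 \notin K ->
    {in K, forall p, p %| m * (2 ^ a * q)} ->
    2 * (m.-1 * (u * q) ^ 2) = 2 ^ a * q * \sum_(p <- K) p.-1 ->
  [/\ 2 ^ a = 4, q = 3, m = 5, 3 \in K & 5 \in K].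
Proof.
move=> a_gt0 q_pr def2a m_gt1 uK prK K2 dvK eqs; have q_gt1 := prime_gt1 q_pr.
have ev2a : ~~ odd (2 ^ a) by rewrite oddX /= orbF -lt0n.
have odd_uq : odd (u * q) by move: ev2a; rewrite def2a oddD /= addbT negbK.
have u_gt0 : 0 < u by case: u odd_uq {def2a eqs}.
have [odd_u odd_q] : odd u /\ odd q by move: odd_uq; rewrite oddM => /andP[].
set s := \sum_(p <- K) p.-1 in eqs.
have {}eqs : 2 * (m.-1 * (u ^ 2 * q)) = 2 ^ a * s.
  by apply/eqP; rewrite -(eqn_pmul2l (ltnW q_gt1)); apply/eqP; nia.
have /dvdnP[s2 defs] : 2 %| s.
  rewrite /s big_seq; apply: dvdn_sum => p Kp; rewrite dvdn2.
  have p_pr := allP prK p Kp; have [p2|odd_p] := even_prime p_pr.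
    by rewrite -p2 Kp in K2.
  by rewrite -subn1 oddB ?prime_gt0 // odd_p.
have co2 : coprime (2 ^ a) (u ^ 2 * q).
  by rewrite coprimeXl // coprime2n oddM oddX odd_u odd_q.
have /dvdnP[k defk] : 2 ^ a %| m.-1.
  rewrite -(Gauss_dvdl _ co2); apply/dvdnP; exists s2; nia.
have k_gt0 : 0 < k by case: k defk; rewrite ?mul0n; lia.
have defm : m = 1 + 2 ^ a * k by lia.
have {}defs : s = 2 * (u ^ 2 * q * k).
  apply/eqP; rewrite -(eqn_pmul2l (expn_gt0 2 a)); apply/eqP; nia.
(* The primes of [K] other than [q] are prime to [2 ^ a * q], so their product divides [m]. Since
   [1 + \sum p.-1] is at most the product, [m] bounds [s] up to the contribution of [q]. *)
pose K' := [seq p <- K | p != q].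
have uK' : uniq K' by rewrite filter_uniq.
have prK' : all prime K' by apply/allP=> p; rewrite mem_filter => /andP[_ /(allP prK)].
have dvK' : \prod_(p <- K') p %| m.
  apply: prod_primes_dvd => //; apply/allP=> p; rewrite mem_filter => /andP[neq Kp].
  have p_pr := allP prK p Kp; have := dvK p Kp; rewrite Gauss_dvdl // coprimeMr.
  rewrite coprimeXr ?prime_coprime ?dvdn_prime2 ?neq //.
  by apply: contraNneq K2 => <-.
have le1 := prod_ge_sum prK'.
have le2 : \prod_(p <- K') p <= m by rewrite dvdn_leq // ltnW.
have [Kq | nKq] := boolP (q \in K); last first.
  have eqK : K' = K.
    by apply/all_filterP/allP=> p Kp; apply: contraNneq nKq => <-.
  rewrite eqK -/s in le1 le2; exfalso.
  have : 2 * (u ^ 2 * q * k) <= (u * q + 1) * k.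
    by rewrite -def2a -defs -(leq_add2l 1) -defm (leq_trans le1).
  rewrite mulnA leq_pmul2r // -mulnn -mulnA => le3.
  have le4 : q <= u * q by rewrite leq_pmull.
  have : u * q <= u * (u * q) by rewrite leq_pmull.
  by clear -le3 le4 q_gt1; lia.
have defs' : s = q.-1 + \sum_(p <- K') p.-1.
  rewrite /s (perm_big _ (perm_to_rem Kq)) big_cons /=; congr (_ + _).
  by rewrite rem_filter.
set s' := \sum_(p <- K') p.-1 in le1 defs'.
have leK : 2 * (u ^ 2 * q * k) <= q.-1 + (u * q + 1) * k.
  rewrite -def2a -defs defs' leq_add2l -(leq_add2l 1) -defm.
  exact: leq_trans le1 le2.
have u1 : u = 1.
  apply/eqP; rewrite eqn_leq u_gt0 andbT leqNgt; apply/negP=> u_gt1.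
  have le3 : 2 * (u * q) <= u * (u * q) by rewrite leq_pmul2r // muln_gt0 u_gt0 ltnW.
  have le4 : q <= u * q by rewrite leq_pmull.
  have le5 : u * q * k <= u * (u * q) * k by rewrite leq_pmul2r // leq_pmull.
  have le6 : 2 * (u * q) * k <= u * (u * q) * k by rewrite leq_pmul2r.
  have le7 : k <= u * q * k by rewrite leq_pmull // muln_gt0 u_gt0 ltnW.
  have le8 : u * q <= u * q * k by rewrite leq_pmulr.
  move: leK; rewrite -mulnn -(mulnA u) mulnDl mul1n.
  by clear -le4 le5 le6 le7 le8 q_gt1; lia.
have k1 : k = 1.
  apply/eqP; rewrite eqn_leq k_gt0 andbT leqNgt; apply/negP=> k_gt1.
  move: leK; rewrite u1 exp1n !mul1n mulnDl mul1n; clear -k_gt1 q_gt1 => leK.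
  by nia.
rewrite u1 k1 exp1n !mul1n ?muln1 in def2a defm defs.
have prodK' : \prod_(p <- K') p = m.
  move: le1 le2; rewrite defm def2a; move: (\prod_(_ <- _) _) => t.
  by clear -defs defs' q_gt1; lia.
have dv_prod r : prime r -> r %| m -> r \in K'.
  rewrite -prodK' => r_pr; rewrite Euclid_dvd_prod // big_has => /hasP[p Kp].
  by rewrite dvdn_prime2 ?(allP prK' p Kp) // => /eqP->.
(* Now [q], [2 ^ a = q + 1] and [m = q + 2] are consecutive, so 3 divides one of them. If it divides
   [m], then 3 is in [K'] and the product of the remaining primes is too small for their sum. *)
have q3 : q = 3.
  have [q30 | q31 | q32] : [\/ 3 %| q, 3 %| q + 1 | 3 %| q + 2].
    have : q %% 3 < 3 by rewrite ltn_mod.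
    rewrite /dvdn -(modnDml q 1) -(modnDml q 2).
    by case: (q %% 3) => [|[|[|]]] // _; [apply: Or31 | apply: Or33 | apply: Or32].
  - by move: q30; rewrite dvdn_prime2 // => /eqP.
  - by move: q31; rewrite -def2a Euclid_dvdX.
  have K'3 : 3 \in K' by apply: dv_prod => //; rewrite defm def2a addnC -addnA.
  have e1 : \prod_(p <- K') p = 3 * \prod_(p <- rem 3 K') p.
    by rewrite (perm_big _ (perm_to_rem K'3)) big_cons.
  have e2 : s' = 2 + \sum_(p <- rem 3 K') p.-1.
    by rewrite /s' (perm_big _ (perm_to_rem K'3)) big_cons.
  have /prod_ge_sum : all prime (rem 3 K').
    by apply/allP=> p /mem_rem /(allP prK').
  move: e1 e2; rewrite prodK' defm def2a.
  move: (\sum_(_ <- _) _) (\prod_(_ <- _) _) => s3 t3.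
  by clear -q_gt1 defs defs'; lia.
have m5 : m = 5 by rewrite defm def2a q3.
split=> //; first by rewrite def2a q3.
  by rewrite -q3.
by have := dv_prod 5 isT; rewrite m5 mem_filter => /(_ isT) /andP[].
Qed.
End InvolutionArithmetic.

Lemma sum_mem_card (T : finType) (A G : {set T}) :
  A \subset G -> (\sum_(x in G) (x \in A) = #|A|)%N.
Proof.
move=> /subsetP sAG; rewrite -sum1_card big_mkcond [RHS]big_mkcond.
apply: eq_bigr => x _; case: (boolP (x \in A)) => [/sAG-> // | _].
by case: ifP.
Qed.

(** A fixed choice for each [p] lets sums range over primes instead of subgroups. *)
Definition some_Sylow (gT : finGroupType) (G : {group gT}) p : {group gT} :=
  sval (Sylow_exists p G).

Lemma some_SylowP (gT : finGroupType) (G : {group gT}) p : p.-Sylow(G) (some_Sylow G p).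
Proof. exact: svalP (Sylow_exists p G). Qed.

Definition Sylow_support (gT : finGroupType) (G : {group gT}) p :=
  class_support (some_Sylow G p)^# G.

(** * Element orders and products of two involutions *)

Section FrobeniusSylow.
Variables (gT : finGroupType) (G : {group gT}).
Hypothesis FS : forall (p : nat) (P : {group gT}),
  prime p -> p.-Sylow(G) P -> P :!=: 1 ->
  exists q (Q : {group gT}), Frobenius_Sylow G p q P Q.
Implicit Types (p q : nat) (P Q : {group gT}).

Lemma FS_order p q P Q x : Frobenius_Sylow G p q P Q -> x \in P^# -> #[x] = p.
Proof.
by move=> fs /setD1P[ntx Px]; apply: (abelem_order_p (FS_abelem fs) Px ntx).
Qed.

Lemma FS_sub_Sylow p q P Q : Frobenius_Sylow G p q P Q -> P \subset G.
Proof. by move=> fs; apply: pHall_sub (FS_Sylow fs). Qed.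

Lemma FS_sub_norm p q P Q : Frobenius_Sylow G p q P Q -> P \subset 'N_G(P).
Proof. by move=> fs; rewrite subsetI normG (FS_sub_Sylow fs). Qed.

(** [x] centralises its [p]-part for a prime [p] dividing its order, and the centraliser of that
    part is a Sylow [p]-subgroup. Hence every non-trivial element has prime order, and the sets
    [Sylow_support] partition [G^#]. *)
Lemma FS_mem x : x \in G -> x != 1 ->
  exists p q P Q, Frobenius_Sylow G p q P Q /\ x \in P.
Proof.
move=> Gx ntx; have ox : 1 < #[x] by rewrite order_gt1.
set p := pdiv #[x]; have p_pr : prime p := pdiv_prime ox.
have nty : x.`_p != 1.
  by rewrite -order_gt1 order_constt p_part_gt1 mem_primes p_pr order_gt0 pdiv_dvd.
have Gy : x.`_p \in G by rewrite groupX.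
have sG : <[x.`_p]> \subset G by rewrite cycle_subG.
have [P sylP] := Sylow_superset sG (p_elt_constt p x).
rewrite cycle_subG => Py; have ntP : P :!=: 1 by apply/trivgPn; exists x.`_p.
have [q [Q fs]] := FS p_pr sylP ntP; exists p, q, P, Q; split=> //.
rewrite -(FS_cent fs (x := x.`_p)) ?in_setD1 ?nty //.
by rewrite inE Gx; apply/cent1P; apply: commuteX.
Qed.

Lemma FS_conj p q q' P P' Q Q' :
  Frobenius_Sylow G p q P Q -> Frobenius_Sylow G p q' P' Q' -> #|P| = #|P'| /\ q = q'.
Proof.
move=> fs fs'; have [g Gg defP] := Sylow_trans (FS_Sylow fs) (FS_Sylow fs').
have oP : #|P'| = #|P| by rewrite defP cardJg.
split=> //; apply/eqP; rewrite -(eqn_pmul2l (cardG_gt0 P)) -(FS_cardN fs).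
by rewrite -oP -(FS_cardN fs') defP normJ -{2}(conjGid Gg) -conjIg cardJg.
Qed.

(** The [q]-group [Q] fixes only the identity of [P], so the orbits are counted modulo [q]. *)
Lemma FS_dvd p q P Q : Frobenius_Sylow G p q P Q -> q %| #|P|.-1.
Proof.
move=> fs; have q_pr := FS_prime2 fs.
have qQ : q.-group Q by rewrite /pgroup (FS_card fs) pnat_id.
have nPQ : Q \subset 'N(P) := subset_trans (FS_sub fs) (subsetIr _ _).
have acts : [acts Q, on P | 'J] by rewrite -astabsJ in nPQ.
have := pgroup_fix_mod qQ acts; rewrite afixJ.
have -> : 'C_P(Q) = 1.
  have ntQ : Q :!=: 1 by rewrite -cardG_gt1 (FS_card fs) prime_gt1.
  have [y Qy nty] := trivgPn _ ntQ.
  apply/trivgP/subsetP=> x /setIP[Px cxQ]; rewrite inE; apply/eqP.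
  have cxy : x ^ y = x by apply/conjg_fixP/commgP; apply: (centP cxQ).
  have [//|Py] := FS_fpf fs Px (subsetP (FS_sub fs) y Qy) cxy.
  have := order_dvdG Qy; rewrite (FS_card fs) (FS_order fs) ?in_setD1 ?nty //.
  by rewrite dvdn_prime2 ?(FS_prime1 fs) // (negbTE (FS_neq fs)).
by rewrite cards1 -subn1 => /eqP; rewrite eqn_mod_dvd ?cardG_gt0.
Qed.

Lemma FS_norm_elt p q P Q x g :
  Frobenius_Sylow G p q P Q -> x \in P^# -> g \in G -> x ^ g \in P -> g \in 'N_G(P).
Proof.
move=> fs Px Gg Pxg; have /normedTI_memJ_P[_ _ ti] := FS_TI fs.
by rewrite -(ti x) // in_setD1 conjg_eq1 Pxg andbT; case/setD1P: Px.
Qed.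

(** [N] is dihedral of order [2 * p]. For [y] outside [P], both [y ^+ 2] and [x * x ^ y] are
    elements of [P] fixed by [y], hence trivial. As [y] inverts [P], every cyclic subgroup of [P] is
    [Q]-invariant, and irreducibility gives [#|P| = p]. *)
Lemma FS_involution p P Q (N := 'N_G(P)) : Frobenius_Sylow G p 2 P Q ->
  [/\ forall y, y \in N :\: P -> #[y] = 2,
      forall x y, x \in P -> y \in N :\: P -> x ^ y = x^-1,
      forall y, y \in N -> #[y] = 2 -> y \notin P,
      #|P| = p & #|N :\: P| = p].
Proof.
move=> fs.
have inv y : y \in N :\: P -> #[y] = 2.
  case/setDP=> Ny nPy; apply/prime_nt_dvdP => //.
    by rewrite order_eq1; apply: contraNneq nPy => ->.
  rewrite order_dvdn; apply/eqP.
  have Py2 : y ^+ 2 \in P.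
    have := Ny; rewrite /N -(FS_prod fs) => /mulsgP[a b Pa Qb ->].
    have nPb : b \in 'N(P) by case/setIP: (subsetP (FS_sub fs) b Qb).
    have bV : b^-1 = b by apply/eqP; rewrite eq_invg_mul -(expg_cardG Qb) (FS_card fs).
    have -> : (a * b) ^+ 2 = a * a ^ b by rewrite expgS expg1 conjgE bV !mulgA.
    by rewrite groupM // memJ_norm.
  have [//|//|] := FS_fpf fs Py2 Ny; last by rewrite (negPf nPy).
  by apply/conjg_fixP/commgP/commute_sym/commuteX.
have invJ x y : x \in P -> y \in N :\: P -> x ^ y = x^-1.
  move=> Px Dy; have [Ny nPy] := setDP Dy.
  have abP := abelem_abelian (FS_abelem fs).
  have Pxy : x ^ y \in P by rewrite memJ_norm //; case/setIP: Ny.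
  have y2 : y * y = 1 by have := expg_order y; rewrite inv.
  have fixy : (x * x ^ y) ^ y = x * x ^ y.
    by rewrite conjMg -conjgM y2 conjg1; apply: (centsP abP).
  have [e | Py] := FS_fpf fs (groupM Px Pxy) Ny fixy; last by rewrite Py in nPy.
  by apply/eqP; rewrite eq_sym eq_invg_mul e.
have odd_p : p != 2 by rewrite (FS_neq fs).
have notP y : y \in N -> #[y] = 2 -> y \notin P.
  move=> Ny oy; apply: contra odd_p => Py.
  by rewrite -oy (FS_order fs) // in_setD1 -order_gt1 oy.
have sPN : P \subset N := FS_sub_norm fs.
have oP : #|P| = p.
  have [x Px ntx] := trivgPn _ (FS_nt fs).
  have ox : #[x] = p by apply: (FS_order fs); rewrite in_setD1 ntx.
  rewrite -ox orderE; congr #|pred_of_set _|; apply/eqP/idPn=> neqP.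
  have ltx : <[x]> \proper P by rewrite properEneq eq_sym neqP cycle_subG.
  case/eqP: ntx; apply/set1P; rewrite -cycle_subG (FS_irr fs ltx) //.
  apply/subsetP=> y Qy; have [-> | nty] := eqVneq y 1; first exact: group1.
  have Ny := subsetP (FS_sub fs) y Qy.
  have oy : #[y] = 2.
    by apply/prime_nt_dvdP; rewrite ?order_eq1 // -(FS_card fs) order_dvdG.
  rewrite inE -cycleJ cycle_subG invJ ?groupV ?cycle_id //.
  by rewrite inE Ny notP.
split=> //; rewrite cardsD (setIidPr sPN) (FS_cardN fs) oP; lia.
Qed.

Local Notation Syl := (some_Sylow G).
Local Notation cs := (Sylow_support G).
Let sylS p : p.-Sylow(G) (Syl p) := some_SylowP G p.
Let K := [seq p <- primes #|G| | #|'N_G(Syl p)| == (#|Syl p| * 2)%N].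
Let I := [set x in G | #[x] == 2].

Lemma FS_Syl p : prime p -> p %| #|G| -> exists q Q, Frobenius_Sylow G p q (Syl p) Q.
Proof.
move=> p_pr pG; apply: FS => //.
by rewrite -cardG_gt1 (card_Hall (sylS p)) p_part_gt1 mem_primes p_pr cardG_gt0.
Qed.

Lemma mem_dihedral_primes p : p \in K -> exists Q, Frobenius_Sylow G p 2 (Syl p) Q.
Proof.
rewrite mem_filter mem_primes => /andP[/eqP oN /and3P[p_pr _ pG]].
have [q [Q fs]] := FS_Syl p_pr pG; exists Q.
suff <- : q = 2 by [].
by apply/eqP; rewrite -(eqn_pmul2l (cardG_gt0 (Syl p))) -oN (FS_cardN fs).
Qed.

Lemma FS_dvdG p q P Q : Frobenius_Sylow G p q P Q -> prime p /\ p %| #|G|.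
Proof.
move=> fs; split; first exact: FS_prime1 fs.
have [x Px ntx] := trivgPn _ (FS_nt fs).
rewrite -(FS_order fs (x := x)) ?in_setD1 ?ntx //.
by rewrite order_dvdG // (subsetP (FS_sub_Sylow fs)).
Qed.

Lemma FS_dihedral p P Q : Frobenius_Sylow G p 2 P Q -> p \in K.
Proof.
move=> fs; have [p_pr pG] := FS_dvdG fs.
have [q [Q' fs']] := FS_Syl p_pr pG; have [_ eq2] := FS_conj fs fs'.
by rewrite mem_filter (FS_cardN fs') -eq2 eqxx mem_primes p_pr pG cardG_gt0.
Qed.

Lemma order_cs p x : prime p -> p %| #|G| -> x \in cs p -> #[x] = p.
Proof.
move=> p_pr pG /imset2P[y g Py Gg ->]; have [q [Q fs]] := FS_Syl p_pr pG.
by rewrite orderJ (FS_order fs).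
Qed.

Lemma mem_cs p q P Q x : Frobenius_Sylow G p q P Q -> x \in P^# -> x \in cs p.
Proof.
move=> fs; have [g Gg ->] := Sylow_trans (sylS p) (FS_Sylow fs).
by rewrite -conjD1g => /imsetP[y Sy ->]; apply: imset2_f.
Qed.

(** If [i] and [i * x] are involutions, [i] inverts [x]. When [x] is an involution, [i] therefore
    runs over its elementary abelian centraliser without [1] and [x]. When [x] has odd prime order
    [p], [i] lies in the normaliser of the Sylow subgroup of [x], which has even order only in the
    dihedral case and then offers [p] choices. *)
Lemma count_involution_pairs x (P2 := Syl 2) : 2 %| #|G| -> x \in G ->
  #|[set i in I | i * x \in I]| =
    ((x == 1%g) * #|I| + (x \in I) * (#|P2| - 2) + \sum_(p <- K) (x \in cs p) * p)%N.
Proof.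
move=> evG Gx; have [q2 [Q2 fs2]] := FS_Syl (isT : prime 2) evG.
have Kpr p : p \in K -> prime p /\ p %| #|G|.
  by rewrite mem_filter mem_primes => /andP[_ /and3P[]].
have Knot2 p : p \in K -> p != 2.
  by case/mem_dihedral_primes=> Q fs; rewrite (FS_neq fs).
have sumE r : #[x] = r -> r \notin K -> (\sum_(p <- K) (x \in cs p) * p = 0)%N.
  move=> ox nKr; rewrite big_seq big1 // => p Kp; have [p_pr pG] := Kpr p Kp.
  case: (boolP (x \in cs p)) => [/(order_cs p_pr pG) | _]; last by rewrite mul0n.
  by rewrite ox => eqr; rewrite eqr Kp in nKr.
have I1 : 1%g \notin I by rewrite inE order1 andbF.
have [-> | ntx] := eqVneq x 1%g.
  rewrite (negPf I1) mul1n mul0n addn0.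
  rewrite big_seq big1 ?addn0 => [|p Kp].
    by apply: eq_card => i; rewrite !inE mulg1 andbb.
  have [p_pr pG] := Kpr p Kp; case: (boolP (_ \in cs p)) => [|_ //].
  by move/(order_cs p_pr pG); rewrite order1 => p1; rewrite -p1 in p_pr.
rewrite mul0n add0n.
have invE i : i \in I -> i^-1 = i /\ i \in G.
  by rewrite inE => /andP[Gi /eqP oi]; rewrite invg_expg oi.
have [Ix | nIx] := boolP (x \in I).
  rewrite mul1n; have := Ix; rewrite inE => /andP[_ /eqP ox].
  rewrite (sumE 2) //; last by apply/negP=> /Knot2.
  have [p [q [P [Q [fs Px]]]]] := FS_mem Gx ntx.
  have Px' : x \in P^# by rewrite in_setD1 ntx.
  have p2 : p = 2 by rewrite -ox (FS_order fs Px').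
  rewrite p2 in fs; have [-> _] := FS_conj fs2 fs; rewrite addn0.
  have -> : [set i in I | i * x \in I] = P :\: [set 1%g; x].
    apply/setP=> i; rewrite in_set in_setD in_set2 negb_or; apply/andP/idP.
      case=> Ii Iix; have [iV Gi] := invE i Ii; have [ixV _] := invE _ Iix.
      have [xV _] := invE x Ix.
      have -> : i != 1%g by apply: contraNneq I1 => <-.
      have -> : i != x.
        by apply: contraNneq I1 => eqi; rewrite -{1}(mulgV x) xV -{1}eqi.
      rewrite -(FS_cent fs Px') inE Gi; apply/cent1P.
      by move: ixV; rewrite invMg iV xV /commute => ->.
    case/andP=> /andP[nt1 ntx'] Pi.
    have oI y : y \in P^# -> y \in I.
      move=> Py; rewrite inE (FS_order fs Py) eqxx andbT.
      by case/setD1P: Py => _; apply: subsetP (FS_sub_Sylow fs) y.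
    split; apply: oI; rewrite in_setD1 ?nt1 // groupM // andbT.
    have [xV _] := invE x Ix.
    by apply: contraNneq ntx' => ix1; rewrite -(mulgK x i) ix1 mul1g xV.
  rewrite cardsD (setIidPr _) ?cards2 1?eq_sym ?ntx //.
  by apply/subsetP=> y /set2P[]->; rewrite ?group1.
rewrite mul0n add0n; have [p [q [P [Q [fs Px]]]]] := FS_mem Gx ntx.
have Px' : x \in P^# by rewrite in_setD1 ntx.
have ox := FS_order fs Px'.
have p_neq2 : p != 2 by rewrite -ox; apply: contra nIx; rewrite inE Gx.
have normI i : i \in I -> i * x \in I -> i \in 'N_G(P).
  move=> Ii Iix; have [iV Gi] := invE i Ii; have [ixV _] := invE _ Iix.
  apply: (FS_norm_elt fs Px' Gi); have -> : x ^ i = x^-1; last by rewrite groupV.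
  by rewrite conjgE iV mulgA -ixV invMg -mulgA mulVg mulg1.
have [q2eq | neq2] := eqVneq q 2.
  rewrite q2eq in fs; have [invN invJ notP oP oNP] := FS_involution fs.
  have Kp := FS_dihedral fs.
  rewrite (bigD1_seq p) ?filter_uniq ?primes_uniq //= (mem_cs fs Px') mul1n.
  rewrite big_seq_cond big1 ?addn0 => [|r /andP[Kr neqr]]; last first.
    have [r_pr rG] := Kpr r Kr; case: (boolP (x \in cs r)) => [/(order_cs r_pr rG) | _ //].
    by rewrite ox => eqr; rewrite eqr eqxx in neqr.
  rewrite -oNP; apply: eq_card => i; rewrite in_set; apply/andP/idP=> [[Ii Iix] | Di].
    have Ni := normI i Ii Iix; rewrite inE Ni notP //.
    by apply/eqP; move: Ii; rewrite inE => /andP[].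
  have [Ni nPi] := setDP Di; have Gi : i \in G by case/setIP: Ni.
  rewrite !inE Gi invN //=; split=> //; rewrite groupM //= invN //.
  by rewrite in_setD groupMr // nPi groupM // (subsetP (FS_sub_norm fs)).
have nKp : p \notin K.
  apply/negP=> /mem_dihedral_primes[Q' fs']; have [_ eq2] := FS_conj fs fs'.
  by rewrite eq2 eqxx in neq2.
rewrite (sumE p) //; apply/eqP; rewrite cards_eq0; apply/eqP/setP=> i.
rewrite in_set in_set0; apply/negP=> /andP[Ii Iix]; have Ni := normI i Ii Iix.
have : 2 %| #|'N_G(P)|.
  by move: Ii; rewrite inE => /andP[_ /eqP <-]; apply: order_dvdG.
rewrite (FS_cardN fs) Euclid_dvdM // [_ %| q]dvdn_prime2 ?(FS_prime2 fs) // eq_sym.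
rewrite (negPf neq2) orbF => /(pgroupP (abelem_pgroup (FS_abelem fs)) 2 isT).
by rewrite inE eq_sym (negPf p_neq2).
Qed.

Lemma card_cs p q P Q :
  Frobenius_Sylow G p q P Q -> #|cs p| = (#|P|.-1 * #|G : 'N_G(P)|)%N.
Proof.
move=> fs; have -> : cs p = class_support P^# G.
  have [g Gg ->] := Sylow_trans (sylS p) (FS_Sylow fs).
  by rewrite -conjD1g class_supportGidl.
by rewrite (card_support_normedTI (FS_TI fs)) (cardsD1 1 P) group1.
Qed.

Theorem FS_even_order : simple G -> 2 %| #|G| ->
  [/\ #|G| = 60,
      exists P Q, Frobenius_Sylow G 2 3 P Q /\ #|G : 'N_G(P)| = 5,
      exists P Q, Frobenius_Sylow G 3 2 P Q
    & exists P Q, Frobenius_Sylow G 5 2 P Q].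
Proof.
move=> simG evG; have [q [Q2 fs2]] := FS_Syl (isT : prime 2) evG.
set P2 := Syl 2 in fs2; set m := #|G : 'N_G(P2)|.
have [[|a] oP2] := p_natP (abelem_pgroup (FS_abelem fs2)).
  by have := FS_nt fs2; rewrite -cardG_gt1 oP2.
have oG : #|G| = (m * (2 ^ a.+1 * q))%N.
  by rewrite -(Lagrange (subsetIl G 'N(P2))) (FS_cardN fs2) oP2 mulnC.
have oI : #|I| = ((2 ^ a.+1).-1 * m)%N.
  rewrite -oP2 -(card_cs fs2); apply: eq_card => x; rewrite inE.
  apply/andP/idP=> [[Gx /eqP ox] | csx]; last first.
    rewrite (order_cs _ evG csx) //; split=> //; case/imset2P: csx => y g.
    by case/setD1P=> _ /(subsetP (FS_sub_Sylow fs2)) Gy Gg ->; rewrite groupJ.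
  have ntx : x != 1 by rewrite -order_gt1 ox.
  have [p [r [P [Q [fs Px]]]]] := FS_mem Gx ntx.
  have Px' : x \in P^# by rewrite in_setD1 ntx.
  have p2 : p = 2 by rewrite -(FS_order fs Px').
  by rewrite p2 in fs; apply: mem_cs fs Px'.
have dvq := FS_dvd fs2; rewrite oP2 in dvq.
have /dvdnP[u defu] := dvq.
(* Pairs of involutions [i], [i * x] are sorted by their product [x]. *)
have sumI : (#|I| * #|I| = #|I| + #|I| * (2 ^ a.+1 - 2) + \sum_(p <- K) #|cs p| * p)%N.
  transitivity (\sum_(x in G) #|[set i in I | (i * x)%g \in I]|)%N.
    under eq_bigr => x Gx do rewrite cardsE -sum1_card big_mkcondr /=.
    rewrite exchange_big /= -sum_nat_const; apply: eq_bigr => i Ii.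
    have Gi : i \in G by move: Ii; rewrite inE => /andP[].
    rewrite -big_mkcondr sum1_card -(card_lcoset I i^-1).
    apply: eq_card => x; rewrite mem_lcoset invgK.
    transitivity ((x \in G) && (i * x \in I)) => //.
    case Iix: (i * x \in I); rewrite ?andbF // andbT -(groupMl _ Gi); apply/esym.
    by move: Iix; rewrite inE => /andP[->].
  under eq_bigr => x Gx do rewrite (count_involution_pairs evG Gx).
  rewrite !big_split /= -/P2 oP2; congr (_ + _ + _)%N.
  - rewrite -big_distrl /= (bigD1 1) //= eqxx big1 ?addn0 ?mul1n //.
    by move=> x /andP[_ /negPf->].
  - rewrite -big_distrl /=; congr (_ * _)%N.
    by apply: sum_mem_card; apply/subsetP=> x; rewrite inE => /andP[].
  rewrite exchange_big /=; apply: eq_bigr => p _.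
  rewrite -big_distrl /=; congr (_ * _)%N; apply: sum_mem_card; apply/subsetP=> x.
  case/imset2P=> y g /setD1P[_ /(subsetP (pHall_sub (sylS p))) Gy] Gg ->.
  exact: groupJ.
have K2 : 2 \notin K by apply/negP=> /mem_dihedral_primes[Q fs]; have := FS_neq fs.
have cs2 p : p \in K -> (2 * (#|cs p| * p) = p.-1 * #|G|)%N.
  case/mem_dihedral_primes=> Q fs; have [_ _ _ oP _] := FS_involution fs.
  rewrite (card_cs fs) oP -(Lagrange (subsetIl G 'N(Syl p))) (FS_cardN fs) oP.
  by move: p.-1 #|_ : _| => ? ?; lia.
have sumK : (2 * \sum_(p <- K) #|cs p| * p = #|G| * \sum_(p <- K) p.-1)%N.
  rewrite !big_distrr /= big_seq [RHS]big_seq; apply: eq_bigr => p /cs2->.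
  exact: mulnC.
have m_gt1 : 1 < m.
  have ltP2 : P2 \proper G.
    rewrite properEcard (FS_sub_Sylow fs2) /=.
    apply: leq_trans (subset_leq_card (subsetIl G 'N(P2))).
    by rewrite (FS_cardN fs2) ltn_Pmulr ?cardG_gt0 ?prime_gt1 ?(FS_prime2 fs2).
  by rewrite indexg_gt1; case/andP: (simple_norm_proper simG ltP2 (FS_nt fs2)).
have K_pr : all prime K.
  by apply/allP=> p; rewrite mem_filter mem_primes => /andP[_ /and3P[]].
have uK : uniq K by rewrite filter_uniq ?primes_uniq.
have defu' : (2 ^ a.+1 = u * q + 1)%N by have := expn_gt0 2 a.+1; lia.
have [||||e1 e2 e3 K3 K5] := @involution_arith a.+1 q u m K _ _ defu' m_gt1 uK K_pr K2.
- by [].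
- exact: FS_prime2 fs2.
- by move=> p; rewrite mem_filter mem_primes -oG => /andP[_ /and3P[]].
- apply/eqP; rewrite -(eqn_pmul2l (ltnW m_gt1)); apply/eqP.
  have v1 : (2 ^ a.+1).-1 = (u * q)%N by lia.
  move: sumI sumK; rewrite oI v1 oG defu'.
  move: (\sum_(p <- K) #|cs p| * p)%N (\sum_(p <- K) p.-1)%N => s1 s2.
  have : 0 < u * q.
    have h : 0 < 2 ^ a by rewrite expn_gt0.
    by rewrite -v1 expnS; clear -h; lia.
  case: (u * q)%N => // w _; move: (m) m_gt1 => [|n] // _.
  by rewrite -mulnn /= addn1 subSS subSS subn0; clear; lia.
split; first by rewrite oG e1 e2 e3.
- by exists P2, Q2; split=> //; move: fs2; rewrite e2.
- by have [Q fs] := mem_dihedral_primes K3; exists (Syl 3), Q.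
by have [Q fs] := mem_dihedral_primes K5; exists (Syl 5), Q.
Qed.

End FrobeniusSylow.

End EvenOrder.

(** * Odd order: exceptional characters *)

Section OddOrderCharacters.

Import Order.TTheory GroupScope GRing.Theory Num.Theory.
Local Open Scope ring_scope.

Lemma sum_sqr_ge (T : finType) (C : {set T}) (b : T -> int) :
  (\sum_(j in C) b j) ^+ 2 <= #|C|%:Z * \sum_(j in C) b j ^+ 2.
Proof.
set n := #|C|%:Z; set S := \sum_(j in C) b j.
have sq_ge0 : 0 <= \sum_(j in C) (n * b j - S) ^+ 2.
  by apply: sumr_ge0 => j _; apply: sqr_ge0.
have sqE : \sum_(j in C) (n * b j - S) ^+ 2 =
    n * (n * \sum_(j in C) b j ^+ 2 - S ^+ 2).
  rewrite (eq_bigr (fun j => n ^+ 2 * b j ^+ 2 + (- 2 * n * S) * b j + S ^+ 2)).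
    rewrite !big_split /= -!big_distrr /= sumr_const -mulr_natr natz -/n -/S; ring.
  by move=> j _; ring.
rewrite sqE in sq_ge0; have [C0 | ntC] := eqVneq C set0.
  by rewrite /S C0 !big_set0 mulr0 expr0n.
have n_gt0 : 0 < n by rewrite /n ltz_nat card_gt0.
by rewrite pmulr_rge0 // subr_ge0 in sq_ge0.
Qed.

(** The right-hand side is unchanged when [c] is subtracted from [a]. The shifted function is 1 on
    [A], 0 on [B] and integral elsewhere, where it is at most its square; Cauchy-Schwarz on the
    complement does the rest. In use, [a] lists multiplicities in a restriction to [P]. *)
Lemma variance_bound (T : finType) (a : T -> int) (A B : {set T}) (q : nat) (c : int) :
    #|A| = q -> #|B| = q -> [disjoint A & B] ->
    {in A, forall j, a j = c + 1} -> {in B, forall j, a j = c} ->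
  (q%:Z * (#|T|%:Z - q%:Z) <= #|T|%:Z * \sum_j a j ^+ 2 - (\sum_j a j) ^+ 2).
Proof.
move=> oA oB dAB aA aB; pose C := ~: (A :|: B).
have [b defb] : exists b : T -> int, forall j, a j = b j + c.
  by exists (fun j => a j - c) => j; rewrite subrK.
have splitT (f : T -> int) :
    \sum_j f j = \sum_(j in A) f j + \sum_(j in B) f j + \sum_(j in C) f j.
  rewrite (bigID (mem (A :|: B))) /=; congr (_ + _).
    by rewrite -bigU //=; apply: eq_bigl => j; rewrite inE.
  by apply: eq_bigl => j; rewrite in_setC.
have cT : #|T|%:Z = q%:Z + q%:Z + #|C|%:Z.
  by rewrite -(cardsC (A :|: B)) cardsU (disjoint_setI0 dAB) cards0 subn0 oA oB !PoszD.
have Sa : \sum_j a j = \sum_j b j + c * #|T|%:Z.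
  rewrite (eq_bigr (fun j => b j + c)) => [|j _]; last by rewrite defb.
  by rewrite big_split /= sumr_const -mulr_natr natz.
have Sa2 : \sum_j a j ^+ 2 = \sum_j b j ^+ 2 + 2 * c * (\sum_j b j) + c ^+ 2 * #|T|%:Z.
  rewrite (eq_bigr (fun j => b j ^+ 2 + 2 * c * b j + c ^+ 2)) => [|j _]; last by rewrite defb; ring.
  by rewrite !big_split /= -big_distrr /= sumr_const -[_ *+ #|_|]mulr_natr !natz.
have bA : \sum_(j in A) b j = q%:Z /\ \sum_(j in A) b j ^+ 2 = q%:Z.
  have b1 j : j \in A -> b j = 1.
    by move=> Aj; apply: (addIr c); rewrite -defb aA // addrC.
  by split; rewrite (eq_bigr (fun=> 1)) ?sumr_const ?oA ?natz // => j /b1->.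
have bB : \sum_(j in B) b j = 0 /\ \sum_(j in B) b j ^+ 2 = 0.
  have b0 j : j \in B -> b j = 0.
    by move=> Bj; apply: (addIr c); rewrite -defb aB // add0r.
  by split; rewrite big1 // => j /b0->.
have := sum_sqr_ge C b.
have le2 : \sum_(j in C) b j <= \sum_(j in C) b j ^+ 2.
  by apply: ler_sum => j _; nia.
move: Sa Sa2; rewrite !splitT !bA.1 !bA.2 !bB.1 !bB.2 cT => -> -> {cT splitT}.
move: le2; set S1 := \sum_(j in C) b j; set S2 := \sum_(j in C) _.
move: S1 S2 => S1 S2 le2 leCS.
rewrite -subr_ge0.
rewrite (_ : _ - _ = (#|C|%:Z * S2 - S1 ^+ 2) + 2 * q%:Z * (S2 - S1)); last by ring.
by rewrite addr_ge0 ?subr_ge0 // mulr_ge0 ?subr_ge0.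
Qed.

Lemma half_natr_int (n : nat) : ((n%:R / 2%:R : algC) \is a Num.int) = ~~ odd n.
Proof.
apply/intrP/idP=> [[m eqm] | evn]; last first.
  exists n./2; rewrite -{1}[n]odd_double_half (negPf evn) add0n -muln2 natrM.
  by rewrite mulfK ?pnatr_eq0.
have /eqP : n%:R = (m * 2)%:~R :> algC by rewrite rmorphM /= -eqm mulfVK ?pnatr_eq0.
rewrite pmulrn eqr_int => /eqP eqn.
by rewrite (_ : n = `|m| * 2)%N ?oddM ?andbF //; lia.
Qed.

Lemma vchar_inv (gT : finGroupType) (G : {group gT}) (phi : 'CF(G)) x :
  phi \in 'Z[irr G] -> phi x^-1%g = (phi x)^*.
Proof.
by case/vcharP=> [chi1 N1 [chi2 N2 ->]]; rewrite !cfunE !char_inv // rmorphB.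
Qed.

(* In odd order the non-trivial elements come in pairs {x, x^-1}. *)
Lemma odd_real_vchar (gT : finGroupType) (G : {group gT}) (phi : 'CF(G)) :
    odd #|G| -> phi \in 'Z[irr G] -> phi^*%CF = phi ->
  (phi 1%g - '[phi, 1]) / 2%:R \is a Num.int.
Proof.
move=> oddG Zphi realphi.
have Zc : '[phi, 1] \is a Num.int by rewrite Cint_cfdot_vchar // rpred1.
pose lt (x : gT) := (enum_rank x < enum_rank x^-1%g)%N.
pose beta := \sum_(x in G^# | lt x) phi x.
have Abeta : beta \in Aint by apply: rpred_sum => x _; apply: Aint_vchar.
have sumE : #|G|%:R * '[phi, 1] = phi 1%g + 2%:R * beta.
  rewrite cfdotE mulVKf ?neq0CG //.
  rewrite (eq_bigr phi) => [|x Gx]; last by rewrite cfun1E Gx conjC1 mulr1.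
  rewrite (big_setD1 1%g) //=; congr (_ + _).
  rewrite (bigID lt) /= -/beta mulr_natl mulr2n; congr (_ + _).
  rewrite (reindex_inj invg_inj) /=; apply: eq_big => [x | x _]; last first.
    by rewrite vchar_inv // -{2}realphi cfunE.
  rewrite !inE invg_eq1 groupV /lt invgK -leqNgt.
  have [-> | ntx] := eqVneq x 1%g; first by rewrite invg1.
  have [Gx | _] := boolP (x \in G) => //=.
  rewrite leq_eqVlt; case: eqP => //= /val_inj/enum_rank_inj eqx.
  case/eqP: ntx; apply/eqP; rewrite -order_eq1 -dvdn1.
  have /eqP <- : coprime 2 #|G| by rewrite coprime2n.
  by rewrite dvdn_gcd order_dvdG // andbT order_dvdn expgS expg1 {1}eqx mulVg.
have Zbeta : beta \is a Num.int.
  apply: Cint_rat_Aint => //.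
  have -> : beta = (#|G|%:R * '[phi, 1] - phi 1%g) / 2%:R.
    by rewrite sumE [phi 1%g + _]addrC addrK mulrC mulKf ?pnatr_eq0.
  have /intrP[c ->] := Zc; have /intrP[a ->] := Cint_vchar1 Zphi.
  by rewrite rpredM ?rpredV ?rpredB ?rpredM ?rpred_nat ?rpred_int.
have -> : (phi 1%g - '[phi, 1]) / 2%:R = (#|G|./2)%:R * '[phi, 1] - beta.
  have -> : phi 1%g = #|G|%:R * '[phi, 1] - 2%:R * beta by rewrite sumE addrK.
  have -> : #|G|%:R = 1 + 2%:R * (#|G|./2)%:R :> algC.
    by rewrite -{1}[#|G|]odd_double_half oddG natrD -mul2n natrM.
  by field.
by rewrite rpredB // rpredM ?rpred_nat.
Qed.

(** * Induction from a Sylow subgroup with trivial intersections *)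

Section TIInduction.
Variables (gT : finGroupType) (G : {group gT}) (p q : nat) (P Q : {group gT}).
Hypothesis fs : Frobenius_Sylow G p q P Q.
Implicit Types (j k : Iirr P).

Let sPG : P \subset G := FS_sub_Sylow fs.
Let sPN : P \subset 'N_G(P) := FS_sub_norm fs.
Let nPN : P <| 'N_G(P). Proof. by rewrite normalSG. Qed.
Let abP : abelian P := abelem_abelian (FS_abelem fs).

Lemma FS_index : #|'N_G(P) : P| = q.
Proof.
apply/eqP; rewrite -(eqn_pmul2l (cardG_gt0 P)) Lagrange // (FS_cardN fs) //.
Qed.

Lemma FS_Frobenius : [Frobenius 'N_G(P) with kernel P].
Proof.
apply/Frobenius_kerP; split=> //; first exact: FS_nt fs.
  by rewrite properE sPN -indexg_gt1 FS_index prime_gt1 // (FS_prime2 fs).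
by move=> x /(FS_cent fs) <-; rewrite setSI ?subsetIl.
Qed.

(** Only elements of ['N_G(P)] conjugate a non-trivial element of [P] into [P], so off 1 both
    inductions agree on [P]. *)
Lemma TI_cfdot_Ind (phi psi : 'CF(P)) : phi 1%g = 0 ->
  '['Ind[G] phi, 'Ind[G] psi] = '['Ind['N_G(P)] phi, 'Ind['N_G(P)] psi].
Proof.
move=> phi1; rewrite -!Frobenius_reciprocity !cfdotE; congr (_ * _).
apply: eq_bigr => x Px; have [-> | ntx] := eqVneq x 1%g; first by rewrite phi1 !mul0r.
congr (_ * _^*); rewrite !cfResE // !cfIndE //; congr (_ * _).
rewrite (big_setID 'N(P)) /= [X in _ + X]big1 ?addr0 // => y /setDP[Gy nNy].
apply: cfun0; apply: contra nNy => Pxy.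
have Px' : x \in P^#%g by rewrite in_setD1 ntx.
by case/setIP: (FS_norm_elt fs Px' Gy Pxy).
Qed.

Definition theta j : 'CF('N_G(P)) := 'Ind['N_G(P)] 'chi_j.

Lemma theta_irr j : j != 0 -> theta j \in irr 'N_G(P).
Proof. exact: irr_induced_Frobenius_ker FS_Frobenius j. Qed.

Lemma theta_dot j k : j != 0 -> k != 0 -> '[theta j, theta k] = (theta j == theta k)%:R.
Proof.
move=> /theta_irr/irrP[a ->] /theta_irr/irrP[b ->].
by rewrite cfdot_irr (inj_eq irr_inj).
Qed.

Lemma theta_dotE j k :
  '[theta j, theta k] = #|P|%:R^-1 * \sum_(y in 'N_G(P)) (j == conjg_Iirr k y)%:R.
Proof.
rewrite /theta -Frobenius_reciprocity cfResInd // cfdotZr.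
rewrite fmorphV rmorph_nat; congr (_ * _); rewrite cfdot_sumr.
by apply: eq_bigr => y _; rewrite -conjg_IirrE cfdot_irr.
Qed.

Lemma theta0_dot j : j != 0 -> '[theta 0, theta j] = 0.
Proof.
move=> nzj; rewrite theta_dotE big1 ?mulr0 // => y _.
by rewrite eq_sym conjg_Iirr_eq0 (negPf nzj).
Qed.

Lemma theta0_norm : '[theta 0] = q%:R.
Proof.
rewrite theta_dotE (eq_bigr (fun _ => 1)) => [|y _]; last by rewrite conjg_Iirr0 eqxx.
rewrite sumr_const -FS_index -(Lagrange sPN) natrM mulKf ?neq0CG //.
Qed.

Lemma theta_conjC j : theta (conjC_Iirr j) = ((theta j)^*)%CF.
Proof. by rewrite /theta conjC_IirrE cfAutInd. Qed.

Lemma theta1 j : theta j 1%g = q%:R.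
Proof.
rewrite /theta cfInd1 // FS_index lin_char1 ?mulr1 //.
by apply/char_abelianP.
Qed.

(** A real [theta j] is orthogonal to 1, so by [odd_real_vchar] its degree [q] would be even. *)
Lemma theta_conjC_neq j : odd #|G| -> j != 0 -> theta (conjC_Iirr j) != theta j.
Proof.
move=> oddG nzj; apply/eqP; rewrite theta_conjC => realj.
have oddN : odd #|'N_G(P)|.
  by move: oddG; rewrite -(Lagrange (subsetIl G 'N(P))) oddM => /andP[].
have Zj : theta j \in 'Z[irr 'N_G(P)] by rewrite cfInd_vchar ?irr_vchar.
have := odd_real_vchar oddN Zj realj.
have -> : '[theta j, 1] = 0.
  rewrite /theta -Frobenius_reciprocity rmorph1 -irr0 cfdot_irr (negPf nzj) //.
rewrite subr0 theta1 half_natr_int => /negP; apply.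
by move: oddN; rewrite (FS_cardN fs) oddM => /andP[].
Qed.

(** The restriction of [theta k] to [P] is the sum of the linear characters in the fibre, and its
    degree is [q]. *)
Lemma card_theta_fiber k : k != 0 ->
  #|[set j | (j != 0) && (theta j == theta k)]| = q.
Proof.
move=> nzk; apply/eqP; rewrite -(eqr_nat algC); apply/eqP.
rewrite -[RHS](theta1 k) -(cfRes1 P) ['Res[P] _]cfun_sum_cfdot.
rewrite sum_cfunE -sum1_card natr_sum big_mkcond /=; apply: eq_bigr => j _.
rewrite cfunE lin_char1 ?mulr1; last exact/char_abelianP.
rewrite inE cfdotC Frobenius_reciprocity -/(theta j).
have [-> | nzj] := eqVneq j 0; first by rewrite theta0_dot // conjC0.
by rewrite theta_dot //; case: eqP; rewrite ?conjC1 ?conjC0.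
Qed.
End TIInduction.

(** * Exceptional characters of one prime *)

Section ExceptionalCharacters.
Variables (gT : finGroupType) (G : {group gT}) (p q : nat) (P Q : {group gT}).
Hypothesis fs : Frobenius_Sylow G p q P Q.
Hypothesis oddG : odd #|G|.
Implicit Types (j k : Iirr P).

Let sPG : P \subset G := FS_sub_Sylow fs.
Let abP : abelian P := abelem_abelian (FS_abelem fs).
Let lin1 j : 'chi_j 1%g = 1.
Proof. by rewrite lin_char1 //; apply/char_abelianP. Qed.

(** The differences induced here and in [prindiff] vanish at 1, so their inner products can be
    computed in ['N_G(P)]; the norms are 2 and [q + 1]. *)
Definition excdiff j : 'CF(G) := 'Ind[G] ('chi_j - 'chi_(conjC_Iirr j)).
Definition prindiff j : 'CF(G) := 'Ind[G] ('chi[P]_0 - 'chi_j).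

Lemma dot_IndB j1 j2 k1 k2 :
  '['Ind[G] ('chi[P]_j1 - 'chi_j2), 'Ind[G] ('chi[P]_k1 - 'chi_k2)] =
  '[theta G j1, theta G k1] - '[theta G j1, theta G k2]
    - '[theta G j2, theta G k1] + '[theta G j2, theta G k2].
Proof.
rewrite (TI_cfdot_Ind fs) ?cfunE ?lin1 ?subrr //.
by rewrite !raddfB /= !cfdotBl /theta; ring.
Qed.

Lemma conjC_Iirr_neq0 j : j != 0 -> conjC_Iirr j != 0.
Proof. by rewrite conjC_Iirr_eq0. Qed.

Lemma excdiff_norm j : j != 0 -> '[excdiff j] = 2%:R.
Proof.
move=> nzj; have nzj' := conjC_Iirr_neq0 nzj; have neqj := theta_conjC_neq fs oddG nzj.
rewrite dot_IndB !(theta_dot fs) // !eqxx [theta G j == _]eq_sym (negPf neqj).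
by rewrite !subr0 -natrD.
Qed.

Lemma excdiff_vchar j : excdiff j \in 'Z[irr G, G^#].
Proof.
rewrite zcharD1E cfInd_vchar ?rpredB ?irr_vchar //= cfInd1 // !cfunE !lin1.
by rewrite subrr mulr0.
Qed.

Lemma excdiff_conjC j : ((excdiff j)^*)%CF = - excdiff j.
Proof.
by rewrite /excdiff cfAutInd rmorphB /= conjC_IirrE cfConjCK -raddfN opprB.
Qed.

Lemma excdiffP j : j != 0 -> exists r, excdiff j = 'chi_r - 'chi_(conjC_Iirr r).
Proof.
move=> nzj; have [r [s neqs defj]] := vchar_norm2 (excdiff_vchar j) (excdiff_norm nzj).
exists r; rewrite defj; congr (_ - 'chi_ _); apply/esym/eqP.
have := excdiff_conjC j; rewrite defj rmorphB /= -!conjC_IirrE opprB.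
move/(congr1 (cfdot^~ 'chi_s)); rewrite !cfdotBl !cfdot_irr eqxx [r == s]eq_sym.
rewrite (negPf neqs) subr0; case: (conjC_Iirr r == s) => //; rewrite sub0r => /eqP.
by rewrite eq_sym -subr_eq0 opprK -natrD pnatr_eq0 addn_eq0.
Qed.

(* The exceptional character attached to j: the difference induced from P has
   norm 2 and is opposite to its conjugate. *)
Definition exc j : Iirr G :=
  odflt 0 [pick r | excdiff j == 'chi_r - 'chi_(conjC_Iirr r)].

Lemma excE j : j != 0 -> excdiff j = 'chi_(exc j) - 'chi_(conjC_Iirr (exc j)).
Proof.
move=> /excdiffP[r defj]; rewrite /exc; case: pickP => [s /eqP // | /(_ r)].
by rewrite defj eqxx.
Qed.

Lemma exc_neq j : j != 0 -> conjC_Iirr (exc j) != exc j.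
Proof.
move=> nzj; apply/eqP=> eqr; have := excdiff_norm nzj; rewrite excE // eqr subrr.
by rewrite cfdot0l => /eqP; rewrite eq_sym pnatr_eq0.
Qed.

Lemma exc_neq0 j : j != 0 -> exc j != 0.
Proof. by move/exc_neq; apply: contraNneq => ->; rewrite conjC_Iirr0. Qed.

(** Equal exceptional characters give equal [excdiff], hence inner product 2; for distinct [theta]
    the inner product is at most 0. *)
Lemma exc_theta j k : j != 0 -> k != 0 -> exc j = exc k -> theta G j = theta G k.
Proof.
move=> nzj nzk eqr; apply/eqP/idPn=> neqt.
have nzj' := conjC_Iirr_neq0 nzj; have nzk' := conjC_Iirr_neq0 nzk.
have eqd : excdiff j = excdiff k by rewrite !excE // eqr.
have : '[excdiff j, excdiff k] = 2%:R by rewrite eqd excdiff_norm.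
rewrite dot_IndB !(theta_dot fs) // (negPf neqt).
have -> : (theta G (conjC_Iirr j) == theta G (conjC_Iirr k)) = false.
  apply: contraNF neqt => /eqP; rewrite !theta_conjC => /(congr1 (fun f => (f^*)%CF)).
  by rewrite !cfConjCK => ->.
rewrite sub0r addr0 -opprD -natrD => /eqP.
by rewrite eq_sym -subr_eq0 opprK -natrD pnatr_eq0.
Qed.

Lemma card_exc (E := exc @: [set j | j != 0]) : (#|P|.-1 <= #|E| * q)%N.
Proof.
have <- : #|[set j : Iirr P | j != 0]| = #|P|.-1.
  rewrite -(card_Iirr_abelian abP) -cardsT (cardsD1 0 setT) in_setT /=.
  by apply: eq_card => j; rewrite !inE andbT.
rewrite -sum1_card (partition_big_imset exc) /= -sum_nat_const.
apply: leq_sum => r /imsetP[k]; rewrite inE => nzk ->.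
rewrite -(card_theta_fiber fs nzk) sum1_card; apply: subset_leq_card.
apply/subsetP=> j /andP[]; rewrite !inE => nzj /eqP eqr.
by rewrite nzj; apply/eqP/exc_theta.
Qed.

Lemma prindiff_norm j : j != 0 -> '[prindiff j] = q%:R + 1.
Proof.
move=> nzj; rewrite dot_IndB (theta0_norm fs) (theta0_dot fs nzj) (theta_dot fs nzj nzj) eqxx.
by rewrite [X in _ - X + _]cfdotC (theta0_dot fs nzj) conjC0 !subr0.
Qed.

Lemma prindiff_dot1 j : j != 0 -> '[prindiff j, 1] = 1.
Proof.
move=> nzj; rewrite -Frobenius_reciprocity rmorph1 -irr0 cfdotBl !cfdot_irr eqxx.
by rewrite (negPf nzj) subr0.
Qed.

Lemma prindiff_excdiff j : j != 0 -> '[prindiff j, excdiff j] = -1.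
Proof.
move=> nzj; have nzj' := conjC_Iirr_neq0 nzj; have neqj := theta_conjC_neq fs oddG nzj.
rewrite dot_IndB !(theta0_dot fs) // !(theta_dot fs) // eqxx eq_sym (negPf neqj).
by rewrite !sub0r oppr0 add0r addr0.
Qed.

Lemma prindiff_vchar j : prindiff j \in 'Z[irr G].
Proof. by rewrite cfInd_vchar ?rpredB ?irr_vchar. Qed.

(** Conjugation changes [prindiff j] by [excdiff j], which is exactly the exceptional character
    minus its conjugate. *)
Lemma prindiff_real j : j != 0 ->
  ((prindiff j + 'chi_(exc j))^*)%CF = prindiff j + 'chi_(exc j).
Proof.
move=> nzj; rewrite rmorphD /= -conjC_IirrE /prindiff cfAutInd rmorphB /=.
have := excE nzj; rewrite /excdiff !raddfB /= => eqd.
rewrite -!conjC_IirrE conjC_Iirr0.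
move/eqP: eqd; rewrite subr_eq => /eqP->; rewrite opprD opprB.
by rewrite -[LHS]addrA -[RHS]addrA; congr (_ + _); rewrite [RHS]addrAC subrK addrC.
Qed.

(** The multiplicity of ['chi_k] in the restriction to [P] depends only on [theta G k], and drops by
    1 from the fibre of [j] to that of its conjugate, both of size [q]. The sum over [P^#] is [#|P|]
    times the sum of squared multiplicities minus the square of their sum, so [variance_bound]
    applies. *)
Lemma exc_row j : j != 0 ->
  (q * (#|P| - q))%:R <= \sum_(x in P^#%g) `|'chi_(exc j) x| ^+ 2.
Proof.
move=> nzj; have nzj' := conjC_Iirr_neq0 nzj; set r := exc j.
pose psi := 'Res[P] 'chi_r; pose a k := Num.floor '[psi, 'chi_k].
have aE k : '[psi, 'chi_k] = (a k)%:~R.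
  rewrite floorK // Cint_cfdot_vchar ?irr_vchar //.
  by rewrite char_vchar // cfRes_char ?irr_char.
have aT k : '[psi, 'chi_k] = '['chi_r, 'Ind[G] (theta G k)].
  by rewrite /theta cfIndInd ?subsetIl ?(FS_sub_norm fs) // cfdotC Frobenius_reciprocity -cfdotC.
pose A := [set k | (k != 0) && (theta G k == theta G j)].
pose B := [set k | (k != 0) && (theta G k == theta G (conjC_Iirr j))].
have oA : #|A| = q := card_theta_fiber fs nzj.
have oB : #|B| = q := card_theta_fiber fs nzj'.
have dAB : [disjoint A & B].
  apply/pred0P=> k /=; rewrite !inE; apply/negP=> /andP[/andP[_ /eqP->] /andP[_]].
  by rewrite eq_sym (negPf (theta_conjC_neq fs oddG nzj)).
have aA k : k \in A -> a k = a j.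
  by rewrite inE => /andP[_ /eqP eqt]; apply: (@intr_inj algC); rewrite -!aE !aT eqt.
have aB k : k \in B -> a k = a (conjC_Iirr j).
  by rewrite inE => /andP[_ /eqP eqt]; apply: (@intr_inj algC); rewrite -!aE !aT eqt.
have ajj : a j = a (conjC_Iirr j) + 1.
  have : '[psi, 'chi_j - 'chi_(conjC_Iirr j)] = 1.
    rewrite cfdotC Frobenius_reciprocity -cfdotC -/(excdiff j) excE //.
    by rewrite cfdotBr !cfdot_irr eqxx eq_sym (negPf (exc_neq nzj)) subr0.
  rewrite cfdotBr !aE => /eqP; rewrite subr_eq => /eqP aj.
  by apply: (@intr_inj algC); rewrite rmorphD rmorph1 aj addrC.
have := variance_bound oA oB dAB (fun k Ak => etrans (aA k Ak) ajj) aB.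
rewrite card_Iirr_abelian // -(ler_int algC) => le1.
have leqP : (q <= #|P|)%N by rewrite -(card_Iirr_abelian abP) -oA max_card.
have -> : (q * (#|P| - q))%:R = (q%:Z * (#|P|%:Z - q%:Z))%:~R :> algC.
  by rewrite subzn // -PoszM pmulrn.
apply: le_trans le1 _; rewrite rmorphB rmorphM rmorphXn /=.
have sumP : \sum_(x in P) `|'chi_r x| ^+ 2 = #|P|%:R * \sum_k (a k)%:~R ^+ 2.
  transitivity (#|P|%:R * '[psi]).
    rewrite cfdotE mulVKf ?neq0CG //; apply: eq_bigr => x Px.
    by rewrite -normCK cfResE.
  rewrite cfdot_sum_irr; congr (_ * _); apply: eq_bigr => k _.
  by rewrite !aE -normCK real_normK // realz.
have chi1 : 'chi_r 1%g = \sum_k (a k)%:~R.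
  rewrite -(cfRes1 P) -/psi [psi in LHS]cfun_sum_cfdot sum_cfunE.
  by apply: eq_bigr => k _; rewrite cfunE lin1 mulr1 aE.
move: sumP; rewrite (big_setD1 1%g) //= => sumP.
rewrite -pmulrn !rmorph_sum /= (eq_bigr (fun k => (a k)%:~R ^+ 2)) => [|k _]; last by rewrite rmorphXn.
by rewrite -sumP -chi1 ger0_norm ?char1_ge0 ?irr_char // addrAC subrr add0r.
Qed.

End ExceptionalCharacters.

(** * Exceptional characters of two different primes *)

Section CrossPrimes.
Variables (gT : finGroupType) (G : {group gT}) (oddG : odd #|G|).
Variables (p q : nat) (P Q : {group gT}) (p' q' : nat) (P' Q' : {group gT}).
Hypotheses (fs : Frobenius_Sylow G p q P Q) (fs' : Frobenius_Sylow G p' q' P' Q').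
Hypothesis neqp : p != p'.

(** Non-trivial elements of [P] and [P'] have different orders, so no conjugate of one lies in the
    other group. *)
Lemma cross_dot (phi : 'CF(P)) (psi : 'CF(P')) :
  phi 1%g = 0 -> '['Ind[G] phi, 'Ind[G] psi] = 0.
Proof.
move=> phi1; rewrite -Frobenius_reciprocity cfdotE big1 ?mulr0 // => x Px.
have [-> | ntx] := eqVneq x 1%g; first by rewrite phi1 mul0r.
rewrite cfResE ?(FS_sub_Sylow fs) // cfIndE ?(FS_sub_Sylow fs') // big1 ?mulr0.
  by rewrite conjC0 mulr0.
move=> y _; apply: cfun0; apply: contra neqp => P'xy; apply/eqP.
rewrite -(FS_order fs (x := x)) ?in_setD1 ?ntx // -(orderJ x y).
by apply: (FS_order fs'); rewrite in_setD1 conjg_eq1 ntx.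
Qed.

Let lin1 (k : Iirr P') : 'chi_k 1%g = 1.
Proof.
by rewrite lin_char1 //; apply/char_abelianP/(abelem_abelian (FS_abelem fs')).
Qed.
Let lin2 (k : Iirr P) : 'chi_k 1%g = 1.
Proof.
by rewrite lin_char1 //; apply/char_abelianP/(abelem_abelian (FS_abelem fs)).
Qed.

Lemma exc_cross_neq j j' : j != 0 -> j' != 0 -> exc G (P := P) j != exc G (P := P') j'.
Proof.
move=> nzj nzj'; apply/eqP=> eqr.
have : '[excdiff G (P := P) j, excdiff G (P := P') j'] = 0.
  by apply: cross_dot; rewrite !cfunE !lin2 subrr.
rewrite (excE fs oddG nzj) (excE fs' oddG nzj') -eqr -(excE fs oddG nzj).
by rewrite (excdiff_norm fs oddG nzj) => /eqP; rewrite pnatr_eq0.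
Qed.

Lemma exc_cross_neqC j j' :
  j != 0 -> j' != 0 -> conjC_Iirr (exc G (P := P) j) != exc G (P := P') j'.
Proof.
move=> nzj nzj'; apply/eqP=> eqr.
have : '[excdiff G (P := P) j, excdiff G (P := P') j'] = 0.
  by apply: cross_dot; rewrite !cfunE !lin2 subrr.
rewrite (excE fs' oddG nzj') -eqr (_ : _ - _ = - excdiff G j).
  by rewrite cfdotNr (excdiff_norm fs oddG nzj) => /eqP; rewrite oppr_eq0 pnatr_eq0.
by rewrite (excE fs oddG nzj) opprB !conjC_IirrE cfConjCK.
Qed.

(** The induced difference is 0 or a difference of two irreducible characters, and it is orthogonal
    to [excdiff j]. If the exceptional character occurred in it, its conjugate would have to occur
    with the same sign. *)
Lemma exc_const (j : Iirr P) (k k' : Iirr P') : j != 0 -> k != 0 -> k' != 0 ->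
  '['chi_(exc G j), 'Ind[G] ('chi_k - 'chi_k')] = 0.
Proof.
move=> nzj nzk nzk'; set D := 'Ind[G] _; set r := exc G j.
have D1 : '['chi_r - 'chi_(conjC_Iirr r), D] = 0.
  by rewrite -(excE fs oddG nzj) cross_dot // !cfunE !lin2 subrr.
have [eqt | neqt] := eqVneq (theta G k) (theta G k').
  suff -> : D = 0 by rewrite cfdot0r.
  apply/eqP; rewrite -cfnorm_eq0 (dot_IndB fs') !(theta_dot fs') // eqt !eqxx.
  by rewrite subrr sub0r addNr.
have Dnorm : '[D] = 2%:R.
  rewrite (dot_IndB fs') !(theta_dot fs') // !eqxx [theta G k' == _]eq_sym (negPf neqt).
  by rewrite !subr0 -natrD.
have ZD : D \in 'Z[irr G, G^#].
  rewrite zcharD1E cfInd_vchar ?rpredB ?irr_vchar //= cfInd1 ?(FS_sub_Sylow fs') //.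
  by rewrite !cfunE !lin1 subrr mulr0.
have [a [b neqab defD]] := vchar_norm2 ZD Dnorm.
have neqr := exc_neq fs oddG nzj; rewrite -/r in neqr.
move: D1; rewrite defD !cfdotBl !cfdotBr !cfdot_irr.
have [eqra | neqra] := eqVneq r a; have [eqrb | neqrb] := eqVneq r b; rewrite ?subrr //.
  rewrite -eqra (negPf neqr) subr0 sub0r opprK -natrD => /eqP.
  by rewrite pnatr_eq0.
rewrite -eqrb (negPf neqr) subr0 sub0r -opprD -natrD => /eqP.
by rewrite oppr_eq0 pnatr_eq0.
Qed.

(** By [exc_const] all non-principal characters of [P'] have the same multiplicity in the
    restriction, which is thus a multiple of the regular character plus [c] times the principal
    one. *)
Lemma exc_value (j : Iirr P) (k : Iirr P') x : j != 0 -> k != 0 -> x \in P'^#%g ->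
  'chi_(exc G j) x = '['chi_(exc G j), prindiff G k].
Proof.
move=> nzj nzk /setD1P[ntx P'x]; set r := exc G j; set c := '[_, _].
pose psi := 'Res[P'] 'chi_r.
have dotE k1 k2 : '[psi, 'chi_k1 - 'chi_k2] = '['chi_r, 'Ind[G] ('chi_k1 - 'chi_k2)].
  by rewrite cfdotC Frobenius_reciprocity -cfdotC.
have aE k1 : '[psi, 'chi_k1] = '[psi, 'chi_0] - c *+ (k1 != 0).
  have [-> | nzk1] := eqVneq k1 0; first by rewrite subr0.
  have -> : c = '[psi, 'chi_0] - '[psi, 'chi_k] by rewrite -cfdotBr dotE.
  have := exc_const nzj nzk nzk1; rewrite -dotE cfdotBr => /eqP.
  by rewrite subr_eq0 => /eqP->; rewrite mulr1n subKr.
rewrite -(cfResE _ (FS_sub_Sylow fs') P'x) -/psi [psi in LHS]cfun_sum_cfdot sum_cfunE.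
have reg0 : \sum_k1 'chi[P']_k1 x = 0.
  have : cfReg P' x = 0 by rewrite cfRegE (negPf ntx).
  rewrite cfReg_sum sum_cfunE => {2}<-; apply: eq_bigr => k1 _.
  by rewrite cfunE lin1 mul1r.
rewrite (eq_bigr (fun k1 => ('[psi, 'chi_0] - c) * 'chi_k1 x + c * (k1 == 0)%:R)).
  rewrite big_split /= -!big_distrr /= reg0 mulr0 add0r (bigD1 0) //= big1 ?addr0 ?mulr1 //.
  by move=> k1 /negPf->.
move=> k1 _; rewrite cfunE aE; have [-> | nzk1] := eqVneq k1 0.
  by rewrite subr0 irr0 cfun1E P'x !mulr1 subrK.
by rewrite mulr1n mulr0 addr0.
Qed.

(* D and D' are real and orthogonal to 1, so that in odd order D(1) and
   '[D, D'] = '[D * D', 1] are even. *)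
Lemma exc_parity (j : Iirr P) (j' : Iirr P') : j != 0 -> j' != 0 ->
  ('['chi_(exc G j), prindiff G j'] + '['chi_(exc G j'), prindiff G j] - 1) / 2%:R
    \is a Num.int.
Proof.
move=> nzj nzj'; set r := exc G j; set r' := exc G j'.
set Gm := prindiff G j; set Gm' := prindiff G j'.
have Zr := irr_vchar r; have Zr' := irr_vchar r'.
have ZG : Gm \in 'Z[irr G] := prindiff_vchar G j.
have ZG' : Gm' \in 'Z[irr G] := prindiff_vchar G j'.
have Z1 : 1 \in 'Z[irr G] by rewrite rpred1.
pose D := Gm + 'chi_r - 1; pose D' := Gm' + 'chi_r' - 1.
have ZD : D \in 'Z[irr G] by rewrite rpredB ?rpredD.
have ZD' : D' \in 'Z[irr G] by rewrite rpredB ?rpredD.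
have rD : (D^*)%CF = D by rewrite /D rmorphB rmorph1 /= (prindiff_real fs oddG nzj).
have rD' : (D'^*)%CF = D' by rewrite /D' rmorphB rmorph1 /= (prindiff_real fs' oddG nzj').
have r0 : r != 0 := exc_neq0 fs oddG nzj.
have r0' : r' != 0 := exc_neq0 fs' oddG nzj'.
have chi1 s : s != 0 -> '['chi[G]_s, 1] = 0 by move=> nzs; rewrite -irr0 cfdot_irr (negPf nzs).
have D1 : '[D, 1] = 0.
  by rewrite cfdotBl cfdotDl (prindiff_dot1 G nzj) chi1 // addr0 cfnorm1 subrr.
have D1' : '[D', 1] = 0.
  by rewrite cfdotBl cfdotDl (prindiff_dot1 G nzj') chi1 // addr0 cfnorm1 subrr.
have evD : D 1%g / 2%:R \is a Num.int.
  by have := odd_real_vchar oddG ZD rD; rewrite D1 subr0.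
have evDD : '[D, D'] / 2%:R \is a Num.int.
  have ZDD : D * D' \in 'Z[irr G] by rewrite mul_vchar.
  have rDD : ((D * D')^*)%CF = D * D' by rewrite rmorphM /= rD rD'.
  have := odd_real_vchar oddG ZDD rDD.
  have -> : '[D * D', 1] = '[D, D'].
    rewrite !cfdotE; congr (_ * _); apply: eq_bigr => x Gx.
    rewrite cfun1E Gx conjC1 mulr1 cfunE; congr (_ * _).
    by rewrite -{1}rD' cfunE.
  rewrite cfunE mulrBl mulrAC => evdiff.
  have := rpredB (rpredM evD (Cint_vchar1 ZD')) evdiff.
  by rewrite opprB addrC subrK.
have dotG : '[Gm, Gm'] = 0 by apply: cross_dot; rewrite !cfunE !lin2 subrr.
have defG : Gm = D + 1 - 'chi_r by rewrite /D subrK addrK.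
have defG' : Gm' = D' + 1 - 'chi_r' by rewrite /D' subrK addrK.
clearbody D D'.
have neqr : '['chi_r, 'chi_r'] = 0 by rewrite cfdot_irr (negPf (exc_cross_neq nzj nzj')).
have neqr' : '['chi_r', 'chi_r] = 0 by rewrite cfdotC neqr conjC0.
have D1c : '[1, D'] = 0 by rewrite cfdotC D1' conjC0.
have chi1c : '[1, 'chi_r'] = 0 by rewrite cfdotC chi1 // conjC0.
have c1 : '['chi_r', Gm] = '['chi_r', D].
  by rewrite defG cfdotBr cfdotDr chi1 // neqr' subr0 addr0.
have c1' : '['chi_r, Gm'] = '['chi_r, D'].
  by rewrite defG' cfdotBr cfdotDr chi1 // neqr subr0 addr0.
have c2 : '[D, 'chi_r'] = '['chi_r', D].
  by rewrite cfdotC; have /intrP[m ->] := Cint_cfdot_vchar Zr' ZD; rewrite rmorph_int.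
suff -> : '['chi_r, Gm'] + '['chi_r', Gm] - 1 = '[D, D'] by [].
rewrite c1 c1'; move: dotG; rewrite defG defG'.
rewrite cfdotBl cfdotDl !cfdotBr !cfdotDr D1 D1c chi1c cfnorm1 chi1 // neqr c2.
move: '[D, D'] '['chi_r, D'] '['chi_r', D] => x y z e.
by rewrite -[RHS]subr0 -e; ring.
Qed.
End CrossPrimes.

Lemma seq_argmin (s : seq nat) (f : nat -> nat) :
  s != [::] -> exists2 x, x \in s & {in s, forall y, (f x <= f y)%N}.
Proof.
elim: s => // a s IHs _; have [-> | nz] := eqVneq s [::].
  by exists a => [|y]; rewrite inE // => /eqP->.
have [x sx minx] := IHs nz; have [le | lt] := leqP (f a) (f x).
  exists a => [|y]; rewrite inE ?eqxx // => /predU1P[-> // | /minx].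
  exact: leq_trans.
exists x => [|y]; rewrite inE ?sx ?orbT // => /predU1P[-> | /minx //].
exact: ltnW.
Qed.

Lemma sum_le1 (s : seq nat) (B : pred nat) :
    uniq s -> {in s &, forall a b, B a -> B b -> a = b} ->
  (\sum_(l <- s) B l <= 1)%N.
Proof.
elim: s => [|a s IHs] /=; first by rewrite big_nil.
case/andP=> nsa us injB; rewrite big_cons.
have injs : {in s &, forall a b, B a -> B b -> a = b}.
  by move=> x y sx sy; apply: injB; rewrite inE ?sx ?sy orbT.
case Ba: (B a); last by rewrite add0n IHs.
rewrite big_seq big1 // => l sl; case Bl: (B l) => //.
by rewrite (injB a l) ?inE ?eqxx ?sl ?orbT // sl in nsa.
Qed.

Lemma sum_class_support (gT : finGroupType) (G L : {group gT}) (A : {set gT})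
    (phi : 'CF(G)) :
    normedTI A G L ->
  \sum_(x in class_support A G) `|phi x| ^+ 2 = (\sum_(x in A) `|phi x| ^+ 2) *+ #|G : L|.
Proof.
move=> tiA; rewrite (set_partition_big _ (partition_normedTI tiA)) /=.
have [_ _ /eqP defL] := and3P tiA.
rewrite -defL -card_conjugates -sumr_const; apply: eq_bigr => _ /imsetP[g Gg ->].
rewrite big_imset /=; last by move=> x y _ _; apply: conjg_inj.
by apply: eq_bigr => x _; rewrite cfunJ.
Qed.

(* N, q, w and m are the order of P, the index of P in its normaliser, the
   number of exceptional characters and the number of conjugates of P, for the
   Sylow subgroup P of least order; O and X are the numbers of elements of order
   l != p with [odd_on l] true and false, E the number of exceptional characters
   of the latter. The hypotheses are [row_bound], [column_bound] and
   [odd_class_cover]. *)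
Lemma odd_order_arith (q m w O X E : nat) (N := (w * q + 1)%N) :
    (2 < q)%N -> (0 < m)%N -> (2 * q <= w * q)%N ->
    (q * (N - q) * m + O <= m * (N * q))%N ->
    (2 + E <= q + 1)%N ->
    (m * (N * q) <= 1 + ((w * q) * m + (O + X)))%N ->
    (N.+1 * X <= E * (m * (N * q)))%N ->
    (0 < X -> N.+1 <= m * q)%N ->
  False.
Proof.
move=> q2 m0 w2 row col cover leX X0.
have {w2} w_ge2 : (2 <= w)%N by rewrite leq_pmul2r // in w2; lia.
have N_ge_q : (q <= N)%N by rewrite /N; nia.
pose M := (m * q)%N; have M3 : (3 <= M)%N by rewrite /M; nia.
have leO : (O <= q * M)%N.
  have : (q * (N - q) * m = M * (N - q))%N by rewrite /M; ring.
  have : (m * (N * q) = M * (N - q) + q * M)%N by rewrite -{1}(subnK N_ge_q) /M; ring.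
  lia.
have leX1 : (M * q.-1 <= X + 1)%N.
  have e1 : (m * (N * q) = M * N)%N by rewrite /M; ring.
  have e2 : (w * q * m = w * M)%N by rewrite /M; ring.
  rewrite e1 e2 in cover.
  (* The last two terms are what [P] and [O] can cover; the first one is left to [X]. *)
  have e3 : (M * N = M * (w.-1 * q.-1) + w * M + q * M)%N.
    have -> : N = (w.-1 * q.-1 + w + q)%N.
      rewrite /N; clear -q2 w_ge2; case: w w_ge2 => // a _; case: q q2 => // b _ /=; lia.
    by ring.
  have : (M * q.-1 <= M * (w.-1 * q.-1))%N by rewrite leq_mul2l leq_pmull ?orbT //; lia.
  lia.
have leN : (N.+1 <= M)%N by apply: X0; have : (3 * 2 <= M * q.-1)%N; [apply: leq_mul; lia | lia].
have leE : (E <= q.-1)%N by lia.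
have leX2 : (N.+1 * X <= q.-1 * (M * N))%N.
  apply: leq_trans leX _; rewrite (_ : m * (N * q) = M * N)%N; last by rewrite /M; ring.
  by rewrite leq_mul2r leE orbT.
(* What remains is [M * q.-1 <= N.+1 <= M], impossible for [q > 2]. *)
have : (N.+1 * (M * q.-1) <= q.-1 * (M * N) + N.+1)%N.
  by apply: leq_trans (leq_mul (leqnn _) leX1) _; rewrite mulnDr muln1 leq_add2r.
have -> : (N.+1 * (M * q.-1) = q.-1 * (M * N) + M * q.-1)%N by rewrite -addn1; ring.
rewrite leq_add2l => le3; have : (M * 2 <= M * q.-1)%N by rewrite leq_mul2l; lia.
lia.
Qed.

(** * The contradiction in odd order *)

Section OddOrder.
Variables (gT : finGroupType) (G : {group gT}).
Hypothesis FS : forall (p : nat) (P : {group gT}),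
  prime p -> p.-Sylow(G) P -> P :!=: 1%g ->
  exists q (Q : {group gT}), Frobenius_Sylow G p q P Q.
Hypotheses (oddG : odd #|G|) (ntG : G :!=: 1%g).

Local Notation Syl := (some_Sylow G).
Local Notation cs := (Sylow_support G).
Local Notation pi := (primes #|G|).

Let fsP l : l \in pi -> exists q Q, Frobenius_Sylow G l q (Syl l) Q.
Proof. by rewrite mem_primes => /and3P[l_pr _ lG]; apply: FS_Syl. Qed.

Let order_csP l x : l \in pi -> x \in cs l -> #[x]%g = l.
Proof. by rewrite mem_primes => /and3P[l_pr _ lG]; apply: order_cs. Qed.

Lemma card_FS l q Q : l \in pi -> Frobenius_Sylow G l q (Syl l) Q ->
  (#|cs l| * #|Syl l| * q = #|Syl l|.-1 * #|G|)%N.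
Proof.
move=> pil fs; rewrite (card_cs fs) -(Lagrange (subsetIl G 'N(Syl l))).
rewrite (FS_cardN fs); move: #|_ : _| #|Syl l|.-1 #|Syl l| => a b c; lia.
Qed.

Lemma odd_class_cover : (#|G| <= 1 + \sum_(l <- pi) #|cs l|)%N.
Proof.
have -> : (\sum_(l <- pi) #|cs l| = \sum_(x in G) \sum_(l <- pi) (x \in cs l))%N.
  rewrite exchange_big /=; apply: eq_bigr => l _; apply/esym/sum_mem_card.
  apply: class_support_subG; apply: subset_trans (subsetDl _ _) _.
  exact: pHall_sub (some_SylowP G l).
rewrite (bigD1 1%g) //= addnA -[X in (X <= _)%N](sum1_card (mem G)) (bigD1 1%g) //=.
apply: leq_add; first by [].
apply: leq_sum => x /andP[Gx ntx].
have [p [q [P [Q [fs Px]]]]] := FS_mem FS Gx ntx.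
have [p_pr pG] := FS_dvdG fs.
have pip : p \in pi by rewrite mem_primes p_pr pG cardG_gt0.
rewrite (bigD1_seq p) ?primes_uniq //= (mem_cs fs) //.
by rewrite in_setD1 ntx.
Qed.

Section Family.
Variables (p q : nat) (Q : {group gT}) (pip : p \in pi).
Let P := Syl p.
Hypothesis fs : Frobenius_Sylow G p q P Q.
Variable j : Iirr P.
Hypothesis nzj : j != 0.
Let r := exc G j.

Let inSyl l : Iirr (Syl l) := inord 1.
Let inSyl_neq0 l : l \in pi -> inSyl l != 0.
Proof. by move=> /fsP[q' [Q' fs']]; apply: Iirr1_neq0; apply: FS_nt fs'. Qed.

(** For a prime divisor [l != p], the scalar is the constant value of ['chi_r] on the elements of
    order [l], by [exc_value]; [inSyl l] is just some non-principal character. *)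
Definition odd_on l := '['chi_r, prindiff G (inSyl l)] / 2%:R \isn't a Num.int.

(** The norm of ['chi_r] is 1. The conjugates of [P^#] contribute through [exc_row], and an odd
    value is a non-zero integer, so it contributes at least 1 per element. *)
Lemma row_bound :
  (q * (#|P| - q) * #|G : 'N_G(P)| + \sum_(l <- pi | (l != p) && odd_on l) #|cs l| <= #|G|)%N.
Proof.
rewrite -(ler_nat algC) natrD natr_sum natrM.
have <- : \sum_(x in G) `|'chi_r x| ^+ 2 = #|G|%:R.
  have := cfnorm_irr r; rewrite cfdotE => e.
  apply: etrans (mulr1 _); apply: etrans (congr1 (fun c => #|G|%:R * c) e).
  by rewrite mulVKf ?neq0CG //; apply: eq_bigr => x _; rewrite normCK.
apply: (@le_trans _ _ (\sum_(l <- pi) \sum_(x in cs l) `|'chi_r x| ^+ 2)); last first.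
  rewrite (eq_bigr (fun l => \sum_(x in G) (x \in cs l)%:R * `|'chi_r x| ^+ 2)) => [|l _]; last first.
    rewrite big_mkcond [RHS]big_mkcond; apply: eq_bigr => x _ /=.
    case: ifP => [csx | _]; last by rewrite mul0r if_same.
    rewrite mul1r; suff -> : x \in G by [].
    case/imset2P: csx => y g /setD1P[_ Py] Gg ->; rewrite groupJ //.
    exact: subsetP (pHall_sub (some_SylowP G l)) y Py.
  rewrite exchange_big /=; apply: ler_sum => x _; rewrite -mulr_suml.
  rewrite ler_piMl ?exprn_ge0 // -natr_sum lern1 sum_le1 ?primes_uniq //.
  by move=> a b pia pib /(order_csP pia) <- /(order_csP pib) <-.
rewrite (bigD1_seq p) ?primes_uniq //=; apply: lerD.
  rewrite (sum_class_support _ (FS_TI fs)) -[leRHS]mulr_natr.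
  by rewrite ler_wpM2r ?ler0n // (exc_row fs oddG nzj).
rewrite big_mkcondr /= !(big_seq_cond (fun l => l != p)); apply: ler_sum => l /andP[pil neql].
case: ifP => [odl | _]; last by apply: sumr_ge0 => x _; apply: exprn_ge0.
rewrite -sum1_card natr_sum; apply: ler_sum => _ /imset2P[y g Py Gg ->].
have [q' [Q' fs']] := fsP pil; rewrite cfunJ //.
have neqpl : p != l by rewrite eq_sym.
rewrite (exc_value oddG fs fs' neqpl nzj (inSyl_neq0 pil) Py).
set c := '[_, _]; have Zc : c \is a Num.int.
  by rewrite Cint_cfdot_vchar ?irr_vchar ?prindiff_vchar.
rewrite exprn_ege1 // norm_intr_ge1 //; apply: contra odl => /eqP c0.
by rewrite /c in c0; rewrite c0 mul0r.
Qed.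

Definition exc_set l : {set Iirr G} := @exc gT G (Syl l) @: [set k | k != 0].

Lemma exc_setP l s : s \in exc_set l -> exists2 k : Iirr (Syl l), k != 0 & s = exc G k.
Proof. by case/imsetP=> k; rewrite inE => nzk ->; exists k. Qed.

(** By [exc_parity] an even value of ['chi_r] makes this multiplicity odd. *)
Lemma prindiff_exc_neq0 l s : l \in pi -> l != p -> ~~ odd_on l -> s \in exc_set l ->
  '[prindiff G j, 'chi_s] != 0.
Proof.
move=> pil neql; rewrite negbK => evl /exc_setP[k nzk ->].
have [q' [Q' fs']] := fsP pil; have neqpl : p != l by rewrite eq_sym.
apply/eqP=> n0.
have := exc_parity oddG fs fs' neqpl nzj nzk.
rewrite [X in _ + X - 1]cfdotC n0 conjC0 addr0.
have [x Px ntx] := trivgPn _ (FS_nt fs').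
have Px' : x \in (Syl l)^#%g by rewrite in_setD1 ntx.
rewrite -(exc_value oddG fs fs' neqpl nzj nzk Px').
move: evl; rewrite -(exc_value oddG fs fs' neqpl nzj (inSyl_neq0 pil) Px') => ev1 ev2.
have := rpredB ev1 ev2; rewrite -mulrBl subKr.
by have := half_natr_int 1; rewrite /= => ->.
Qed.

(** [prindiff G j] has norm [q + 1]. Its distinct constituents include the principal character, at
    least one of ['chi_r] and its conjugate, whose multiplicities differ by 1, and every exceptional
    character of an even prime. *)
Lemma column_bound :
  (2 + \sum_(l <- pi | (l != p) && ~~ odd_on l) #|exc_set l| <= q + 1)%N.
Proof.
set Gm := prindiff G j; pose n s := '[Gm, 'chi_s].
have Zn s : n s \is a Num.int.
  by rewrite Cint_cfdot_vchar ?irr_vchar ?prindiff_vchar.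
have nr : n r - n (conjC_Iirr r) = -1.
  by rewrite -cfdotBr -(excE fs oddG nzj) (prindiff_excdiff fs oddG nzj).
have [e0 [ne0 defe]] : exists e0, n e0 != 0 /\ (e0 = r \/ e0 = conjC_Iirr r).
  have [nr0 | nr0] := eqVneq (n r) 0; last by exists r; split=> //; left.
  exists (conjC_Iirr r); split; last by right.
  apply/eqP=> nr0'; move/eqP: nr; rewrite nr0 nr0' subr0 eq_sym oppr_eq0.
  by rewrite oner_eq0.
have e00 : e0 != 0.
  by case: defe => ->; rewrite ?conjC_Iirr_eq0 (exc_neq0 fs oddG nzj).
have exc_e0 l : l \in pi -> l != p -> e0 \notin exc_set l.
  move=> pil neql; apply/negP=> /exc_setP[k nzk eqe].
  have [q' [Q' fs']] := fsP pil; have neqpl : p != l by rewrite eq_sym.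
  case: defe => defe; rewrite defe in eqe.
    by have := exc_cross_neq oddG fs fs' neqpl nzj nzk; rewrite -/r eqe eqxx.
  by have := exc_cross_neqC oddG fs fs' neqpl nzj nzk; rewrite -/r eqe eqxx.
have exc_0 l : l \in pi -> 0 \notin exc_set l.
  move=> pil; apply/negP=> /exc_setP[k nzk eq0].
  have [q' [Q' fs']] := fsP pil.
  by have := exc_neq0 fs' oddG nzk; rewrite -eq0 eqxx.
pose In := [seq l <- pi | (l != p) && ~~ odd_on l].
have memIn l : l \in In -> [/\ l \in pi, l != p & ~~ odd_on l].
  by rewrite mem_filter => /andP[/andP[]].
pose ind s := ((s == 0%R) + (s == e0) + \sum_(l <- In) (s \in exc_set l))%N.
have n0 : n 0 = 1 by rewrite /n irr0 prindiff_dot1.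
have le_ind s : (ind s)%:R <= `|n s| ^+ 2.
  have n_ge1 : n s != 0 -> 1 <= `|n s| ^+ 2.
    by move=> nz; rewrite exprn_ege1 // norm_intr_ge1.
  rewrite /ind; have [-> | nz0] := eqVneq s 0.
    rewrite eq_sym (negPf e00) big_seq big1 => [|l /memIn[pil _ _]].
      by rewrite n0 normr1 expr1n.
    by rewrite (negPf (exc_0 l pil)).
  have [-> | neqe] := eqVneq s e0.
    rewrite big_seq big1 => [|l /memIn[pil neql _]]; last by rewrite (negPf (exc_e0 l pil neql)).
    by rewrite exprn_ege1 // norm_intr_ge1.
  rewrite !add0n; have [hasl | nol] := boolP (has (fun l => s \in exc_set l) In).
    have [l Inl sl] := hasP hasl; have [pil neql evl] := memIn l Inl.
    apply: le_trans (n_ge1 (prindiff_exc_neq0 pil neql evl sl)).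
    rewrite lern1 sum_le1 ?filter_uniq ?primes_uniq // => a b /memIn[pia _ _] /memIn[pib _ _].
    move=> /exc_setP[k nzk ->] /exc_setP[k' nzk' eqk]; apply/eqP/idPn=> neqab.
    have [qa [Qa fsa]] := fsP pia; have [qb [Qb fsb]] := fsP pib.
    by have := exc_cross_neq oddG fsa fsb neqab nzk nzk'; rewrite eqk eqxx.
  rewrite big_seq big1 ?exprn_ge0 // => l Inl.
  by case sl: (s \in exc_set l) => //; case/hasP: nol; exists l.
rewrite -(ler_nat algC) [leRHS]natrD -(prindiff_norm fs nzj) cfdot_sum_irr.
rewrite (eq_bigr (fun s => `|n s| ^+ 2)) => [|s _]; last by rewrite normCK.
apply: le_trans (ler_sum _ (fun s _ => le_ind s)); rewrite -natr_sum ler_nat /ind.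
have sum1 c : (\sum_(s : Iirr G) (s == c) = 1)%N.
  by rewrite (bigD1 c) //= eqxx big1 // => s /negPf->.
rewrite !big_split /= !sum1 leq_add2l exchange_big /= big_filter.
apply: leq_sum => l _; rewrite -sum1_card big_mkcond; apply: leq_sum => s _.
by case: (s \in _).
Qed.
End Family.

Lemma FS_order_gap p q Q (P := Syl p) : Frobenius_Sylow G p q P Q -> (2 * q <= #|P|.-1)%N.
Proof.
move=> fs; have nz1 : (inord 1 : Iirr P) != 0 by apply: Iirr1_neq0; apply: FS_nt fs.
have nz2 := conjC_Iirr_neq0 nz1.
set j : Iirr P := inord 1 in nz1 nz2.
pose A := [set k : Iirr P | (k != 0) && (theta G k == theta G j)].
pose B := [set k : Iirr P | (k != 0) && (theta G k == theta G (conjC_Iirr j))].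
have oA : #|A| = q := card_theta_fiber fs nz1.
have oB : #|B| = q := card_theta_fiber fs nz2.
have dAB : A :&: B = set0.
  apply/setP=> k; rewrite !inE; apply/negP=> /andP[/andP[_ /eqP->] /andP[_]].
  by rewrite eq_sym (negPf (theta_conjC_neq fs oddG nz1)).
have abP := abelem_abelian (FS_abelem fs).
have <- : #|[set k : Iirr P | k != 0]| = #|P|.-1.
  rewrite -(card_Iirr_abelian abP) -cardsT (cardsD1 0 setT) in_setT /=.
  by apply: eq_card => k; rewrite !inE andbT.
rewrite mul2n -addnn -{1}oA -oB -cardsUI dAB cards0 addn0.
by apply: subset_leq_card; apply/subsetP=> k; rewrite !inE => /orP[] /andP[].
Qed.

Theorem FS_odd_false : False.
Proof.
have nz_pi : pi != [::].
  apply: contra ntG => /eqP pi0; rewrite -subG1; apply/subsetP=> x Gx; rewrite inE.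
  apply/idPn=> ntx; have [p [q [P [Q [fs _]]]]] := FS_mem FS Gx ntx.
  have [p_pr pG] := FS_dvdG fs.
  have : p \in pi by rewrite mem_primes p_pr pG cardG_gt0.
  by rewrite pi0.
have [p pip minP] := seq_argmin (fun l => #|Syl l|) nz_pi.
have [q [Q fs]] := fsP pip; set P := Syl p in fs minP.
have nz1 : (inord 1 : Iirr P) != 0 by apply: Iirr1_neq0; apply: FS_nt fs.
have row := row_bound pip fs nz1; have col := column_bound fs nz1.
have cover := odd_class_cover; have gap := FS_order_gap fs.
set j : Iirr P := inord 1 in nz1 row col; set m := #|G : 'N_G(P)| in row.
have oG : #|G| = (m * (#|P| * q))%N.
  by rewrite -(Lagrange (subsetIl G 'N(P))) (FS_cardN fs) mulnC.
have ocs : #|cs p| = (#|P|.-1 * m)%N := card_cs fs.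
have [w defw] := dvdnP (FS_dvd fs).
have q_gt2 : (2 < q)%N.
  have := FS_prime2 fs; have := oddG; rewrite oG !oddM => /and3P[_ _ oddq] /prime_gt1.
  by case: q oddq {oG gap defw row col fs} => [|[|[|]]].
(* Minimality of [#|P|] turns [card_FS] and [card_exc] into a bound on [#|cs l|] with the common
   denominator [#|P|.+1]; the last inequality holds because [#|Syl l|] divides [#|G|] and is prime
   to [#|P|]. *)
have Nl l : l \in pi -> l != p ->
    (#|P| < #|Syl l|)%N /\ ((#|P|.+1 * #|cs l| <= #|exc_set l| * #|G|)%N /\ (#|Syl l| <= m * q)%N).
  move=> pil neql; have [q' [Q' fs']] := fsP pil.
  have coP : coprime #|P| #|Syl l|.
    apply: pnat_neq_coprime (abelem_pgroup (FS_abelem fs)) (abelem_pgroup (FS_abelem fs')).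
    by rewrite eq_sym.
  have ltN : (#|P| < #|Syl l|)%N.
    rewrite ltn_neqAle minP // andbT; apply: contraNneq (FS_nt fs) => eqN.
    by apply/eqP/card1_trivg; move: coP; rewrite -eqN /coprime gcdnn => /eqP.
  split=> //; split.
    have e1 := card_FS pil fs'; have e2 := card_exc fs' oddG.
    have q'0 : (0 < q')%N by rewrite prime_gt0 // (FS_prime2 fs').
    rewrite -(leq_pmul2r q'0); apply: (@leq_trans (#|cs l| * #|Syl l| * q')).
      by rewrite leq_pmul2r // mulnC leq_mul2l ltN orbT.
    by rewrite e1 mulnAC leq_mul2r [(_ <= _)%N]e2 orbT.
  apply: dvdn_leq; first by rewrite muln_gt0 indexg_gt0 prime_gt0 ?(FS_prime2 fs).
  rewrite -(Gauss_dvdr _ (n := #|P|)) 1?coprime_sym //.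
  rewrite mulnCA -oG cardSg // (pHall_sub (some_SylowP G l)) //.
rewrite (bigD1_seq p) ?primes_uniq //= (bigID (odd_on j)) /= in cover.
set O := (\sum_(l <- _ | _ && odd_on j l) _)%N in row cover.
set X := (\sum_(l <- _ | _ && ~~ odd_on j l) #|cs l|)%N in cover.
set E := (\sum_(l <- _ | _) _)%N in col.
have leX : (#|P|.+1 * X <= E * #|G|)%N.
  rewrite /X /E big_distrr big_distrl /= big_seq_cond [leqRHS]big_seq_cond.
  by apply: leq_sum => l /and3P[pil neql _]; have [_ []] := Nl l pil neql.
have X_gt0 : (0 < X -> #|P|.+1 <= m * q)%N.
  have [/hasP[l pil neql] _ | /hasPn nol] := boolP (has (fun l => l != p) pi).
    by have [lt1 [_ le2]] := Nl l pil neql; apply: leq_trans le2.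
  rewrite /X big_seq_cond big1 // => l /andP[/nol /negPf neql].
  by rewrite neql.
have N1 : #|P| = (w * q + 1)%N by rewrite -defw addn1 prednK ?cardG_gt0.
apply: (@odd_order_arith q m w O X E); rewrite -?N1 -?oG -?ocs -?defw //.
  by rewrite indexg_gt0.
by rewrite -ocs.
Qed.

End OddOrder.

End OddOrderCharacters.

(** * Recognition of A5 and of its double cover *)

Section Recognition.

Import GroupScope.

(** * The action on the five cosets of a subgroup *)

Section IndexFive.
Variables (gT : finGroupType) (G N : {group gT}).
Hypotheses (sNG : N \subset G) (iN : #|G : N| = 5).

Let S := rcosets N G.
Let oS : #|S| = 5 := iN.
Let S0 : gval N \in S. Proof. by apply/rcosetsP; exists 1; rewrite ?group1 ?mulg1. Qed.
Let e (i : 'I_5) : {set gT} := enum_val (cast_ord (esym oS) i).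
Let d (X : {set gT}) : 'I_5 := cast_ord oS (enum_rank_in S0 X).
Let eS i : e i \in S. Proof. exact: enum_valP. Qed.
Let deK : cancel e d.
Proof. by move=> i; rewrite /d /e enum_valK_in cast_ordKV. Qed.
Let edK X : X \in S -> e (d X) = X.
Proof. by move=> SX; rewrite /d /e cast_ordK enum_rankK_in. Qed.
Let SM X g : g \in G -> X \in S -> X :* g \in S.
Proof.
move=> Gg /rcosetsP[x Gx ->]; rewrite -rcosetM; apply/rcosetsP.
by exists (x * g); rewrite ?groupM.
Qed.

(** The identity outside [G] makes this a permutation for every [g]. *)
Let F g i := if g \in G then d (e i :* g) else i.
Let F_inj g : injective (F g).
Proof.
move=> i k; rewrite /F; case: ifP => // Gg /(congr1 e); rewrite !edK ?SM // => eqX.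
by apply: (can_inj deK); apply: rcoset_inj eqX.
Qed.

Definition coset_perm g : {perm 'I_5} := perm (@F_inj g).

Lemma coset_permM : {in G &, {morph coset_perm : x y / x * y}}.
Proof.
move=> x y Gx Gy; apply/permP=> i; rewrite permM !permE /F groupM // Gx Gy.
by rewrite edK ?SM // rcosetM.
Qed.
Canonical coset_perm_morphism := Morphism coset_permM.

(** The kernel is trivial because a trivial action would fix the coset [N]. The image is perfect,
    hence consists of even permutations, and the orders agree. *)
Lemma simple_index5_Alt : simple G -> ~~ solvable G -> #|G| = 60 -> G \isog 'Alt_('I_5).
Proof.
move=> simG nsolG oG; have defG' := simple_perfect simG nsolG.
have injf : 'injm coset_perm_morphism.
  have /simpleP[_ simG'] := simG.
  case: (simG' _ (ker_normal coset_perm_morphism)) => [-> // | /= kerG].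
  have: #|G : N| = 1%N; last by rewrite iN.
  apply/eqP; rewrite indexg_eq1; apply/subsetP=> g Gg.
  have := Gg; rewrite -{1}kerG => /mker/permP/(_ (d N)).
  rewrite perm1 permE /F Gg edK // => /(congr1 e); rewrite !edK ?SM // => eqN.
  by rewrite -eqN rcoset_refl.
apply/isogP; exists coset_perm_morphism => //.
have oI : #|coset_perm_morphism @* G| = 60 by rewrite card_injm.
apply/eqP; rewrite eqEcard oI; apply/andP; split.
  have <- : (coset_perm_morphism @* G)^`(1) = coset_perm_morphism @* G.
    by rewrite -morphim_der // defG'.
  rewrite gen_subG; apply/subsetP=> _ /imset2P[s t _ _ ->].
  by rewrite Alt_even commgEl odd_permM odd_permV odd_permJ addbb.
have := card_Alt (T := 'I_5); rewrite card_ord => /(_ isT).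
by move=> e5; rewrite -(leq_pmul2l (isT : 0 < 2)) e5.
Qed.
End IndexFive.

(** * Central extensions by 2-groups *)

Section CentralExtension.
Variable gT : finGroupType.
Implicit Types (H R P : {group gT}).

(** Two non-commuting elements [a] and [b] generate [P] over [R]. Then [P / R] is not cyclic, so
    [a ^+ 2] is central and [c = [~ a, b]] satisfies [c ^+ 2 = [~ a ^+ 2, b] = 1]; modulo [<[c]>]
    everything commutes. *)
Lemma der1_central_index4 (P R : {group gT}) :
  R \subset 'Z(P) -> #|P : R| = 4 -> #|P^`(1)| <= 2.
Proof.
move=> sRZ iR; have sRP := subset_trans sRZ (center_sub P).
have cRP x y : x \in R -> y \in P -> commute x y.
  by move=> /(subsetP sRZ)/centerP[_ cx] /cx.
have [abP | ] := boolP (abelian P); first by rewrite (derG1P abP) cards1.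
rewrite /abelian => /subsetPn[a Pa ncPa].
have [b Pb ncab] : exists2 b, b \in P & ~~ (b \in 'C[a]).
  by apply/subsetPn; rewrite sub_cent1.
have nRa : a \notin R by apply: contra ncab => Ra; apply/cent1P; apply/commute_sym/cRP.
pose M := R <*> <[a]>; have cR (X : {set gT}) : X \subset P -> X \subset 'C(R).
  move=> /subsetP sXP; apply/centsP=> x /sXP Px y Ry.
  exact/commute_sym/cRP.
have sMP : M \subset P by rewrite join_subG sRP cycle_subG.
have sMca : M \subset 'C[a].
  rewrite join_subG cycle_subG cent1id andbT sub_cent1.
  by rewrite -cycle_subG cR ?cycle_subG.
have nMb : b \notin M by apply: contra ncab; apply: subsetP.
have ltRM : R \proper M.
  by rewrite properE joing_subl; apply: contra nRa => /subsetP; apply; rewrite mem_gen // inE cycle_id orbT.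
pose K := M <*> <[b]>.
have ltMK : M \proper K.
  by rewrite properE joing_subl; apply: contra nMb => /subsetP; apply; rewrite mem_gen // inE cycle_id orbT.
have sKP : K \subset P by rewrite join_subG sMP cycle_subG.
have defK : K = P.
  apply/eqP; rewrite eqEcard sKP -(Lagrange sRP) iR.
  rewrite -(Lagrange (proper_sub ltMK)) -(Lagrange (proper_sub ltRM)) -mulnA.
  rewrite leq_pmul2l ?cardG_gt0 // -[4]/(2 * 2)%N leq_mul // indexg_gt1.
    by case/andP: ltRM.
  by case/andP: ltMK.
have nRP : P \subset 'N(R) by rewrite cents_norm ?cR.
have abPR : abelian (P / R).
  by apply: (@card_p2group_abelian _ 2) => //; rewrite card_quotient ?iR.
have a2R : a ^+ 2 \in R.
  apply: coset_idr; first by rewrite groupX ?(subsetP nRP).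
  rewrite morphX ?(subsetP nRP) //=; apply/eqP; rewrite -order_dvdn.
  have oa : #[coset R a] %| 2 ^ 2.
    by rewrite -[(2 ^ 2)%N]iR -(card_quotient nRP) order_dvdG ?mem_quotient.
  have /(dvdn_pfactor _ _ (isT : prime 2))[k lek ok] := oa.
  rewrite ok; case: k lek ok => [|[|[|k]]] // _ ok.
  case/negP: nMb; apply: (subsetP _ b Pb).
  rewrite -(quotientSGK nRP (proper_sub ltRM)).
  have -> : P / R = <[coset R a]>.
    apply/eqP; rewrite eq_sym eqEcard cycle_subG mem_quotient //= -orderE ok.
    by rewrite card_quotient ?iR.
  by rewrite cycle_subG mem_quotient // mem_gen // inE cycle_id orbT.
pose c := [~ a, b].
have Rc : c \in R by apply: (subsetP (der1_min nRP abPR)); apply: mem_commg.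
have c2 : c ^+ 2 = 1.
  by rewrite -commXg; [apply/eqP/commgP/cRP | apply/commute_sym/cRP].
have nCP : P \subset 'N(<[c]>).
  by rewrite cents_norm // (subset_trans (cR P (subxx P))) // centS ?cycle_subG.
have sC : P^`(1) \subset <[c]>.
  apply: der1_min => //.
  have nCX (X : {set gT}) : X \subset P -> X \subset 'N(<[c]>) by move/subset_trans; apply.
  have [sa sb] : <[a]> \subset P /\ <[b]> \subset P by rewrite !cycle_subG.
  have abM : abelian M by rewrite abelianY cycle_abelian /abelian !cR.
  have cab : commute (coset <[c]> a) (coset <[c]> b).
    apply/commgP; rewrite -morphR ?(subsetP nCP) //; apply/eqP/coset_id.
    exact: cycle_id.
  rewrite -defK quotientY ?nCX // abelianY !quotient_abelian ?cycle_abelian //= centsC.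
  rewrite quotientY ?nCX // join_subG quotient_cents 1?centsC ?cR //=.
  by rewrite !quotient_cycle ?(subsetP nCP) // cents_cycle.
by apply: leq_trans (subset_leq_card sC) _; rewrite -orderE dvdn_leq // order_dvdn c2.
Qed.

(** Powers of a central element have trivial commutators, so the transfer puts [R] into the derived
    subgroup of a Sylow 2-subgroup, where [R] has index 4. *)
Lemma central_2ext_bound H R :
    H^`(1) = H -> R \subset 'Z(H) -> 2.-group R -> (#|H : R|`_2 = 4)%N -> #|R| <= 2.
Proof.
move=> defH' sRZ pR iR; have sRH := subset_trans sRZ (center_sub H).
have [P sylP sRP] := Sylow_superset sRH pR.
have [sPH pP _] := and3P sylP.
have sRZP : R \subset 'Z(P).
  rewrite subsetI sRP; apply: subset_trans sRZ _.
  by rewrite subIset // orbC centS.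
have iP : #|P : R| = 4.
  apply/eqP; rewrite -(eqn_pmul2l (cardG_gt0 R)) Lagrange // (card_Hall sylP).
  by rewrite -(Lagrange sRH) partnM ?cardG_gt0 // iR part_pnat_id.
apply: leq_trans (subset_leq_card _) (der1_central_index4 sRZP iP).
apply/subsetP=> z Rz; have Pz := subsetP sRP z Rz.
apply: (Sylow_der1_transfer sylP (der_normal 1 P) (der_abelian 0 P) Pz).
  by rewrite defH' (subsetP sRH).
move=> k x Hx _; suff /commgP/eqP-> : commute (z ^+ k) x by apply: group1.
have /centerP[_ cz] := subsetP sRZ z Rz.
by apply/commute_sym/commuteX/commute_sym/cz.
Qed.
End CentralExtension.

(** * Uniqueness of a perfect double cover *)

Section FibreProduct.
Variables (gT rT aT : finGroupType) (H : {group gT}) (L : {group rT}).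
Variables (phi : {morphism H >-> aT}) (psi : {morphism L >-> aT}).
Hypothesis eq_im : phi @* H = psi @* L.
Hypotheses (defH' : H^`(1) = H) (defL' : L^`(1) = L).
Hypotheses (cphi : 'ker phi \subset 'Z(H)) (cpsi : 'ker psi \subset 'Z(L)).
Hypotheses (ophi : #|'ker phi| = 2) (opsi : #|'ker psi| = 2).
Hypothesis im2 : (#|phi @* H|`_2 = 4)%N.

Let D := [set u : gT * rT | [&& u.1 \in H, u.2 \in L & phi u.1 == psi u.2]].

Let D_group : group_set D.
Proof.
apply/group_setP; split=> [|[x y] [x' y']]; rewrite !inE /=.
  by rewrite !group1 !morph1 eqxx.
case/and3P=> Hx Ly /eqP exy /and3P[Hx' Ly' /eqP exy'].
by rewrite !groupM //= !morphM // exy exy' eqxx.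
Qed.
Let DG := Group D_group.

Let DP u : u \in DG -> [/\ u.1 \in H, u.2 \in L & phi u.1 = psi u.2].
Proof. by rewrite inE => /and3P[? ? /eqP]. Qed.

Let fstM : {in DG &, {morph (@fst gT rT) : u v / u * v}}. Proof. by []. Qed.
Let fst_m := Morphism fstM.
Let sndM : {in DG &, {morph (@snd gT rT) : u v / u * v}}. Proof. by []. Qed.
Let snd_m := Morphism sndM.
Let chiM : {in DG &, {morph (fun u => phi u.1) : u v / u * v}}.
Proof. by move=> u v /DP[Hu _ _] /DP[Hv _ _]; rewrite /= morphM. Qed.
Let chi := Morphism chiM.

Let im_fst : fst_m @* DG = H.
Proof.
apply/setP=> x; apply/morphimP/idP=> [[u Du _ ->] | Hx]; first by case: (DP Du).
have : phi x \in psi @* L by rewrite -eq_im mem_morphim.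
case/morphimP=> y _ Ly exy; have Dxy : (x, y) \in DG by rewrite inE /= Hx Ly exy eqxx.
by exists (x, y).
Qed.

Let im_snd : snd_m @* DG = L.
Proof.
apply/setP=> y; apply/morphimP/idP=> [[u Du _ ->] | Ly]; first by case: (DP Du).
have : psi y \in phi @* H by rewrite eq_im mem_morphim.
case/morphimP=> x _ Hx exy; have Dxy : (x, y) \in DG by rewrite inE /= Hx Ly exy eqxx.
by exists (x, y).
Qed.

Let K := 'ker chi.
Let mem_K u : (u \in K) = (u.1 \in 'ker phi) && (u.2 \in 'ker psi).
Proof.
apply/idP/andP=> [Ku | [k1 k2]].
  have Du : u \in DG := dom_ker Ku.
  have [Hu Lu eu] := DP Du; have ku : phi u.1 = 1 := mker Ku.
  by split; apply/kerP; rewrite // -eu.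
have Du : u \in DG by rewrite inE (dom_ker k1) (dom_ker k2) (mker k1) (mker k2) eqxx.
by apply/(kerP _ Du); exact: (mker k1).
Qed.

Let oK : #|K| = 4.
Proof.
have -> : #|K| = (#|'ker phi| * #|'ker psi|)%N; last by rewrite ophi opsi.
by rewrite -cardsX; apply: eq_card => -[x y]; rewrite mem_K in_setX.
Qed.

Let cK : K \subset 'Z(DG).
Proof.
apply/subsetP=> u Ku; have Du : u \in DG by apply: dom_ker Ku.
have := Ku; rewrite mem_K => /andP[/(subsetP cphi)/centerP[_ c1] /(subsetP cpsi)/centerP[_ c2]].
apply/centerP; split=> // v /DP[Hv Lv _].
by case: u v {Ku Du} c1 c2 Hv Lv => x y [x' y'] /= c1 c2 Hv Lv; congr (_, _); [apply: c1 | apply: c2].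
Qed.

Let iK : #|DG : K| = #|phi @* H|.
Proof.
have <- : chi @* DG = phi @* H.
  apply/setP=> a; apply/morphimP/morphimP=> [[u Du _ ->] | [x _ Hx ->]].
    by have [Hu _ _] := DP Du; exists u.1.
  have := Hx; rewrite -{1}im_fst => /morphimP[u _ Du /= ->]; by exists u.
by rewrite card_morphim setIid.
Qed.

Let oH : #|H| = (2 * #|phi @* H|)%N.
Proof. by rewrite card_morphim setIid -ophi Lagrange ?(normal_sub (ker_normal _)). Qed.
Let oL : #|L| = (2 * #|phi @* H|)%N.
Proof. by rewrite eq_im card_morphim setIid -opsi Lagrange ?(normal_sub (ker_normal _)). Qed.

(** The derived subgroup [E] of the fibre product maps onto both perfect factors. It is proper,
    since otherwise the central subgroup [K] of order 4 would violate [central_2ext_bound]. So [E]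
    has the order of [H], and both projections are injective on it. *)
Lemma fibre_isog : H \isog L.
Proof.
have oD : #|DG| = (4 * #|phi @* H|)%N by rewrite -iK -oK Lagrange ?(normal_sub (ker_normal _)).
pose E := DG^`(1)%G; have sED : E \subset DG := der_sub 1 DG.
have ltE : E \proper DG.
  rewrite properEneq sED andbT; apply/eqP=> defE.
  suff : #|K| <= 2 by rewrite oK.
  apply: (@central_2ext_bound _ DG) => //; last by rewrite iK.
  by rewrite /pgroup oK.
have imE1 : fst_m @* E = H by rewrite morphim_der // im_fst.
have imE2 : snd_m @* E = L by rewrite morphim_der // im_snd.
have oE : #|E| = #|H|.
  apply/eqP; rewrite eqn_leq -{2}imE1 leq_morphim andbT oH.
  have /dvdnP[k defk] := cardSg sED; rewrite oD in defk.
  have := proper_card ltE; rewrite oD; have := cardG_gt0 E.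
  by case: k defk => [|[|k]] defk; rewrite defk; lia.
have iso (rT' : finGroupType) (f : {morphism DG >-> rT'}) : #|f @* E| = #|E| -> E \isog f @* E.
  move=> ofE; have injf : 'injm (restrm sED f).
    by rewrite -card_im_injm morphim_restrm setIid ofE.
  apply/isogP; exists [morphism of restrm sED f] => //.
  by rewrite morphim_restrm setIid.
have iso1 : E \isog H by rewrite -imE1; apply: iso; rewrite imE1 oE.
have iso2 : E \isog L by rewrite -imE2; apply: iso; rewrite imE2 oE oL oH.
by rewrite isog_sym in iso1; apply: isog_trans iso2.
Qed.

End FibreProduct.

End Recognition.

(** * The group SL(2,5) *)

Section SL25Theory.

Import GroupScope GRing.Theory.

(** * Computations with 2 by 2 matrices modulo 5 *)

Section QuadArithmetic.
Local Open Scope nat_scope.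

(** The entries row by row, as plain numbers, so that finite checks are decided by evaluation. The
    constant 4 below stands for -1. *)
Definition quad := (nat * nat * nat * nat)%type.
Definition qmul (x y : quad) : quad :=
  let: (a, b, c, d) := x in let: (e, f, g, h) := y in
  ((a * e + b * g) %% 5, (a * f + b * h) %% 5, (c * e + d * g) %% 5, (c * f + d * h) %% 5).
Definition qone : quad := (1, 0, 0, 1).
Definition qneg : quad := (4, 0, 0, 4).
Definition qinv (x : quad) : quad :=
  let: (a, b, c, d) := x in (d, (4 * b) %% 5, (4 * c) %% 5, a).
Definition qdet1 (x : quad) := let: (a, b, c, d) := x in (a * d + 4 * (b * c)) %% 5 == 1.
Definition qtr0 (x : quad) := let: (a, b, c, d) := x in (a + d) %% 5 == 0.
Definition qall : seq quad :=
  [seq (p, d) | p <- [seq (p, c) | p <- [seq (a, b) | a <- iota 0 5, b <- iota 0 5], c <- iota 0 5],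
    d <- iota 0 5].
Definition qSL := [seq x <- qall | qdet1 x].
(** By Cayley-Hamilton the matrices of determinant 1 and trace 0 are the square roots of -1; they
    become involutions modulo the centre. *)
Definition qinvol := [seq x <- qSL | qtr0 x].
(* The 30 elements of order 4 lie in the five quaternion subgroups; two of them
   are in the same one exactly when they commute up to sign. *)
Definition qreps : seq quad :=
  [:: (0, 1, 4, 0); (1, 1, 3, 4); (1, 2, 4, 4); (1, 3, 1, 4); (1, 4, 2, 4)].
Definition qcommpm x y := (qmul x y == qmul y x) || (qmul x y == qmul qneg (qmul y x)).
Definition qlabel (x : quad) : nat := find (qcommpm x) qreps.
Definition qconj (x g : quad) := qmul (qmul (qinv g) x) g.
(** Conjugation on the five quaternion subgroups. [qlabel] yields 5 when no representative matches,
    a case excluded by [qact_lt]. *)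
Definition qact (g : quad) (k : nat) := qlabel (qconj (nth qone qreps k) g).

Lemma qSL_size : size qSL = 120 /\ uniq qSL.
Proof. by split; vm_compute. Qed.

Lemma qinv_ok : all (fun g => (qinv g \in qSL) && (qmul (qinv g) g == qone)) qSL.
Proof. by vm_compute. Qed.

Lemma qact_lt : all (fun g => all (fun k => qact g k < 5) (iota 0 5)) qSL.
Proof. by vm_compute. Qed.

Lemma qact_inj g j k : g \in qSL -> j < 5 -> k < 5 -> qact g j = qact g k -> j = k.
Proof.
have : all (fun g => all (fun j => all (fun k => (qact g j == qact g k) ==> (j == k))
  (iota 0 5)) (iota 0 5)) qSL by vm_compute.
have mem5 i : i < 5 -> i \in iota 0 5 by rewrite mem_iota.
move=> /allP chk /chk/allP {}chk /mem5/chk/allP {}chk /mem5/chk/implyP {}chk e.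
by apply/eqP/chk/eqP.
Qed.

Lemma qreps_ok : all (fun k => (nth qone qreps k \in qinvol) && (qlabel (nth qone qreps k) == k))
  (iota 0 5).
Proof. by vm_compute. Qed.

Lemma qlabel_conj :
  all (fun g => all (fun x => (qconj x g \in qinvol) && (qlabel (qconj x g) == qact g (qlabel x)))
    qinvol) qSL.
Proof. by vm_compute. Qed.

Lemma qact_ker :
  all (fun g => all (fun k => qact g k == k) (iota 0 5) == ((g == qone) || (g == qneg))) qSL.
Proof. by vm_compute. Qed.

Lemma qinvolution : all (fun g => (qmul g g == qone) ==> ((g == qone) || (g == qneg))) qSL.
Proof. by vm_compute. Qed.

Lemma mem_qSL a b c d : (((a, b, c, d) : quad) \in qSL) =
  [&& a < 5, b < 5, c < 5, d < 5 & qdet1 (a, b, c, d)].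
Proof.
rewrite mem_filter andbC !andbA; congr (_ && _).
apply/allpairsP/idP=> [[[[[a' b'] c'] d'] [/allpairsP[[[a1 b1] c1] [/allpairsP[[a2 b2] []]]]]]|].
  rewrite !mem_iota /= => a5 b5 [-> ->] c5 [-> -> ->] d5 [-> -> -> ->] .
  by rewrite a5 b5 c5 d5.
case/andP=> /andP[/andP[a5 b5] c5] d5; exists (a, b, c, d).
split; [| by rewrite mem_iota | by []].
apply/allpairsP; exists (a, b, c); split; [| by rewrite mem_iota | by []].
by apply/allpairsP; exists (a, b); split; rewrite ?mem_iota.
Qed.
Lemma qneg_central : all (fun g => qmul qneg g == qmul g qneg) qSL.
Proof. by vm_compute. Qed.

Lemma qneg_SL : qneg \in qSL. Proof. by vm_compute. Qed.
End QuadArithmetic.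

(** * The map from SL(2,5) onto A5 *)

Section SL25.
Local Notation GL25 := {'GL_2['F_5]}.
Let i0 : 'I_2 := ord0.
Let i1 : 'I_2 := lift ord0 ord0.

Definition mxcode (A : 'M['F_5]_2) : quad :=
  (A i0 i0 : nat, A i0 i1 : nat, A i1 i0 : nat, A i1 i1 : nat).
Definition code (M : GL25) : quad := mxcode (GLval M).

Let ord2P (i : 'I_2) : i = i0 \/ i = i1.
Proof. by case: i => [[|[|//]] lti]; [left | right]; apply: val_inj. Qed.

Lemma mxcode_inj : injective mxcode.
Proof.
move=> A B [e00 e01 e10 e11]; apply/matrixP=> i j; apply: val_inj => /=.
by case: (ord2P i) => ->; case: (ord2P j) => ->.
Qed.

Lemma code_inj : injective code.
Proof. by move=> M N e; apply: val_inj; apply: mxcode_inj e. Qed.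

Lemma det2 (R : comPzRingType) (A : 'M[R]_2) :
  (\det A = A i0 i0 * A i1 i1 - A i0 i1 * A i1 i0)%R.
Proof.
rewrite (expand_det_row _ i0) !big_ord_recl big_ord0 addr0 /cofactor !det_mx11 !mxE /=.
rewrite expr0 mul1r expr1 mulN1r mulrN; congr (_ * A _ _ - A _ _ * A _ _)%R.
all: by apply: val_inj.
Qed.

Lemma mxcode_det A : (\det A == 1)%R = qdet1 (mxcode A).
Proof.
rewrite det2 -val_eqE /=; congr (_ == _).
move: (A i0 i0 * A i1 i1)%N (A i0 i1 * A i1 i0)%N => x y.
change ((x %% 5 + (5 - y %% 5) %% 5) %% 5 = (x + 4 * y) %% 5)%N; lia.
Qed.

Lemma code_qSL M : (M \in SL25) = (code M \in qSL).
Proof.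
by rewrite inE mxcode_det [in RHS]/code /mxcode mem_qSL !ltn_ord.
Qed.

Lemma codeM M N : code (M * N) = qmul (code M) (code N).
Proof.
rewrite /code GL_MxE /mxcode /qmul !mxE !big_ord_recl !big_ord0 !addr0 /=.
by rewrite !modnDm.
Qed.

Lemma code1 : code 1 = qone.
Proof. by rewrite /code GL_1E /mxcode !mxE. Qed.

Definition mkmx (x : quad) : 'M['F_5]_2 :=
  let: (a, b, c, d) := x in
  (\matrix_(i, j) (if i == i0 then if j == i0 then a else b
                   else if j == i0 then c else d)%:R)%R.

Definition mkGL (x : quad) : GL25 := insubd (1 : GL25) (mkmx x).

Lemma mkmxK x : x \in qSL -> mxcode (mkmx x) = x.
Proof.
case: x => [[[a b] c] d]; rewrite mem_qSL => /and5P[a5 b5 c5 d5 _].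
by rewrite /mxcode !mxE /= !val_Fp_nat // !modn_small.
Qed.

Lemma mkGLK x : x \in qSL -> code (mkGL x) = x.
Proof.
move=> Sx; rewrite -[RHS](mkmxK Sx) /code; congr mxcode.
rewrite -[GLval _]/(val (mkGL x)) /mkGL insubdK // unfold_in /= unitmxE.
suff /eqP-> : (\det (mkmx x) == 1)%R by apply: unitr1.
rewrite mxcode_det mkmxK //; by move: Sx; rewrite mem_filter => /andP[].
Qed.

Lemma mkGL_SL x : x \in qSL -> mkGL x \in SL25.
Proof. by move=> Sx; rewrite code_qSL mkGLK. Qed.

Lemma card_SL25 : #|SL25| = 120.
Proof.
have [sz uq] := qSL_size; rewrite -sz -(size_map mkGL) cardE; apply: perm_size.
apply: uniq_perm; rewrite ?enum_uniq // ?map_inj_in_uniq //.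
  by move=> x y Sx Sy /(congr1 code); rewrite !mkGLK.
move=> M; rewrite mem_enum; apply/idP/mapP=> [SM | [x Sx ->]]; last exact: mkGL_SL.
exists (code M); first by rewrite -code_qSL.
by apply: code_inj; rewrite mkGLK // -code_qSL.
Qed.

Lemma SL25_group_set : group_set SL25.
Proof.
apply/group_setP; split=> [|M N]; first by rewrite inE GL_1E det1.
by rewrite !inE => /eqP dM /eqP dN; rewrite GL_MxE det_mulmx dM dN mulr1.
Qed.
Canonical SL25_group := Group SL25_group_set.

Lemma codeV M : M \in SL25 -> code M^-1 = qinv (code M).
Proof.
rewrite code_qSL => SM; have /andP[SV /eqP eV] := allP qinv_ok _ SM.
rewrite -(mkGLK SV); congr code; apply/eqP; rewrite eq_sym eq_mulgV1 invgK.
by apply/eqP/code_inj; rewrite codeM mkGLK // code1.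
Qed.

Lemma codeJ M N : N \in SL25 -> code (M ^ N) = qconj (code M) (code N).
Proof. by move=> SN; rewrite conjgE mulgA !codeM codeV. Qed.

Local Opaque qSL qinvol qreps qlabel qconj qmul.

Let label (M : GL25) := qlabel (code M).
Let rep k := mkGL (nth qone qreps k).

Let rep_ok k : (k < 5)%N ->
  [/\ rep k \in SL25, code (rep k) = nth qone qreps k, code (rep k) \in qinvol & label (rep k) = k].
Proof.
move=> k5; have k5' : k \in iota 0 5 by rewrite mem_iota.
have /andP[inv /eqP lab] := allP qreps_ok k k5'.
have SLk : nth qone qreps k \in qSL by move: inv; rewrite mem_filter => /andP[].
by rewrite /label /rep mkGLK // mkGL_SL.
Qed.

Definition SLact (M : GL25) (k : nat) := label (rep k ^ M).
Local Notation act := SLact.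

Let actE M k : M \in SL25 -> (k < 5)%N -> act M k = qact (code M) k.
Proof. by move=> SM /rep_ok[_ ek _ _]; rewrite /SLact /label codeJ // ek. Qed.

Let act_lt M k : M \in SL25 -> (k < 5)%N -> (act M k < 5)%N.
Proof.
move=> SM k5; rewrite actE //; move: SM; rewrite code_qSL => /(allP qact_lt)/allP.
by apply; rewrite mem_iota.
Qed.

Let actM M N k : M \in SL25 -> N \in SL25 -> (k < 5)%N -> act (M * N) k = act N (act M k).
Proof.
move=> SM SN k5; have [_ ek inv lab] := rep_ok k5.
have inv' : code (rep k ^ M) \in qinvol.
  rewrite codeJ //; move: SM; rewrite code_qSL => /(allP qlabel_conj)/allP.
  by move=> /(_ _ inv)/andP[].
rewrite [RHS]actE ?act_lt // /SLact conjgM /label [in LHS]codeJ //.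
move: SN; rewrite code_qSL => /(allP qlabel_conj)/allP/(_ _ inv')/andP[_ /eqP] //.
Qed.

Local Opaque SLact qact.

Definition SLactI (M : GL25) (k : 'I_5) : 'I_5 := if M \in SL25 then inord (act M k) else k.
Local Notation actI := SLactI.

Let inord5K a : (a < 5)%N -> nat_of_ord (inord a : 'I_5) = a.
Proof. exact: inordK. Qed.

Let actI_val M k : M \in SL25 -> nat_of_ord (actI M k) = act M k.
Proof. by move=> SM; rewrite /SLactI SM; apply: inord5K (act_lt SM (ltn_ord k)). Qed.

Let actI_inj M : injective (actI M).
Proof.
move=> j k; have [SM | nSM] := boolP (M \in SL25); last by rewrite /SLactI (negPf nSM).
move/(congr1 (@nat_of_ord 5)); rewrite (actI_val j SM) (actI_val k SM).
rewrite (actE SM (ltn_ord j)) (actE SM (ltn_ord k)) => eqjk; apply: val_inj.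
by apply: (qact_inj _ (ltn_ord j) (ltn_ord k) eqjk); rewrite -code_qSL.
Qed.

Local Opaque SLactI.

Definition SL25_perm (M : GL25) : {perm 'I_5} := perm (@actI_inj M).

Lemma SL25_permM : {in SL25 &, {morph SL25_perm : M N / M * N}}.
Proof.
move=> M N SM SN; have SMN : M * N \in SL25 by apply: groupM.
apply/permP=> k; apply: ord_inj; rewrite permM !permE (actI_val _ SMN) (actI_val _ SN).
by rewrite (actI_val _ SM) (actM SM SN (ltn_ord k)).
Qed.
Canonical SL25_perm_morphism := Morphism SL25_permM.

Lemma mem_ker_SL25_perm M :
  (M \in 'ker SL25_perm_morphism) = (M \in SL25) && ((code M == qone) || (code M == qneg)).
Proof.
have [SM | nSM] := boolP (M \in SL25); last first.
  by apply: contraNF nSM => /dom_ker.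
have := SM; rewrite code_qSL => /(allP qact_ker)/eqP <-.
apply/(kerP _ SM)/allP=> [kM k | kM].
  rewrite mem_iota => /andP[_ k5].
  have := congr1 (fun s : {perm 'I_5} => nat_of_ord (s (inord k))) kM.
  by rewrite perm1 permE (actI_val _ SM) (actE SM (ltn_ord _)) inord5K // => ->.
apply/permP=> k; apply: ord_inj; rewrite perm1 permE (actI_val _ SM) (actE SM (ltn_ord k)).
by apply/eqP/kM; rewrite mem_iota ltn_ord.
Qed.

Lemma ker_SL25_perm : 'ker SL25_perm_morphism = [set 1; mkGL qneg].
Proof.
apply/setP=> M; rewrite mem_ker_SL25_perm in_set2.
apply/idP/orP=> [/andP[_ /orP[/eqP e | /eqP e]] | [/eqP-> | /eqP->]].
- by left; apply/eqP/code_inj; rewrite e code1.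
- by right; apply/eqP/code_inj; rewrite e mkGLK // qneg_SL.
- by rewrite group1 code1 eqxx.
by rewrite mkGL_SL ?mkGLK ?qneg_SL // eqxx orbT.
Qed.

Lemma card_ker_SL25_perm : #|'ker SL25_perm_morphism| = 2.
Proof.
rewrite ker_SL25_perm cards2; case: eqP => // /(congr1 code).
by rewrite code1 mkGLK // qneg_SL.
Qed.

Lemma card_Alt5 : #|'Alt_('I_5)| = 60.
Proof.
have := card_Alt (T := 'I_5); rewrite card_ord => /(_ isT) e5.
by apply/eqP; rewrite -(eqn_pmul2l (isT : 0 < 2)%N) e5.
Qed.

(** The image has order 60, hence index 2, and is normal. Its intersection with the simple
    alternating group is not trivial, as the product of the two would be larger than the symmetric
    group. *)
Lemma im_SL25_perm : SL25_perm_morphism @* SL25 = 'Alt_('I_5).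
Proof.
pose I := (SL25_perm_morphism @* SL25)%G; rewrite -[LHS]/(gval I).
have oI : #|I| = 60.
  apply/eqP; rewrite -(eqn_pmul2l (isT : 0 < 2)%N) card_morphim setIid.
  have := Lagrange (normal_sub (ker_normal SL25_perm_morphism)).
  by rewrite card_ker_SL25_perm card_SL25 => ->.
have oA := card_Alt5.
have oS : #|[set: {perm 'I_5}]| = 120 by rewrite cardsT card_Sn.
have nI : I <| [set: {perm 'I_5}].
  apply: index2_normal; rewrite ?subsetT //; apply/eqP.
  by rewrite -(eqn_pmul2l (cardG_gt0 I)) Lagrange ?subsetT // oS oI.
have nIA : I :&: 'Alt_('I_5) <| 'Alt_('I_5).
  rewrite /normal subsetIr normsI ?normG //.
  exact: subset_trans (subsetT _) (normal_norm nI).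
have /simpleP[_ simA] : simple 'Alt_('I_5) by apply: simple_Alt5; rewrite card_ord.
case: (simA _ nIA) => [tiIA | /setIidPr sAI].
  have := subset_leq_card (subsetT (I * 'Alt_('I_5))).
  by rewrite TI_cardMg // oI oA oS.
by apply/eqP; rewrite eq_sym eqEcard sAI oI oA.
Qed.

(** The derived subgroup maps onto A5, so it has even order and contains an involution. The only
    involution is -1, so the kernel is included as well. *)
Lemma SL25_perfect : SL25^`(1) = SL25.
Proof.
pose L := SL25_group; rewrite -[SL25]/(gval L).
have sL'L : L^`(1) \subset L := der_sub 1 L.
have Alt' : ('Alt_('I_5))^`(1) = 'Alt_('I_5).
  have simA : simple 'Alt_('I_5) by apply: simple_Alt5; rewrite card_ord.
  apply: simple_perfect => //; apply/negP=> solA.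
  by have := simple_sol_prime solA simA; rewrite card_Alt5.
have imL' : SL25_perm_morphism @* L^`(1) = 'Alt_('I_5).
  by rewrite morphim_der // im_SL25_perm.
have oA := card_Alt5.
apply/eqP; rewrite eqEcard sL'L /= card_SL25.
have ev : 2 %| #|L^`(1)|.
  by apply: dvdn_trans (dvdn_morphim SL25_perm_morphism [group of L^`(1)]); rewrite /= imL' oA.
have [t L't ot] := Cauchy (isT : prime 2) ev.
have Lt : t \in SL25 := subsetP sL'L t L't.
have deft : t = mkGL qneg.
  have SLt : code t \in qSL by rewrite -code_qSL.
  have t2 : t * t = 1 by have := expg_order t; rewrite ot.
  have := allP qinvolution _ SLt; rewrite -codeM t2 code1 eqxx /=.
  case/orP=> /eqP e; last by apply: code_inj; rewrite e mkGLK ?qneg_SL.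
  have t1 : t = 1 by apply: code_inj; rewrite e code1.
  by rewrite t1 order1 in ot.
have kerL' : 'ker SL25_perm_morphism \subset L^`(1).
  by rewrite ker_SL25_perm subUset !sub1set group1 -deft.
have := card_morphim SL25_perm_morphism [group of L^`(1)]; rewrite /= imL' oA (setIidPr sL'L).
move=> i60; rewrite -(Lagrange kerL') card_ker_SL25_perm -i60.
by [].
Qed.

Lemma ker_SL25_central : 'ker SL25_perm_morphism \subset 'Z(SL25).
Proof.
rewrite ker_SL25_perm subUset !sub1set group1 /=; apply/centerP.
split=> [|M]; first by rewrite mkGL_SL ?qneg_SL.
rewrite code_qSL => SM; apply: code_inj; rewrite !codeM mkGLK ?qneg_SL //.
exact/eqP/(allP qneg_central).
Qed.

End SL25.

End SL25Theory.

(** * Finite groups *)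

Section FiniteClassification.

Import GroupScope.

Lemma FS_nnormal (gT : finGroupType) (G : {group gT}) p q (P Q : {group gT}) :
  Frobenius_Sylow G p q P Q -> ~~ (Q <| 'N_G(P)).
Proof.
move=> fs; apply/negP=> /andP[_ nQN].
have sPN := FS_sub_norm fs; have sQN := FS_sub fs.
have pP := abelem_pgroup (FS_abelem fs).
have qQ : q.-group Q by rewrite /pgroup (FS_card fs) pnat_id // (FS_prime2 fs).
have tiPQ : P :&: Q = 1.
  by apply: coprime_TIg; apply: pnat_neq_coprime (FS_neq fs) pP qQ.
have cPQ : [~: P, Q] = 1.
  apply/trivgP; rewrite -tiPQ subsetI commg_subl commg_subr.
  by rewrite (subset_trans sQN (subsetIr _ _)) (subset_trans sPN).
have [x Px ntx] := trivgPn _ (FS_nt fs).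
have ntQ : Q :!=: 1 by rewrite -cardG_gt1 (FS_card fs) prime_gt1 ?(FS_prime2 fs).
have [y Qy nty] := trivgPn _ ntQ.
have cxy : x ^ y = x.
  have := mem_commg Px Qy; rewrite cPQ => /set1P c1.
  by apply/conjg_fixP; rewrite c1.
have [x1 | Py] := FS_fpf fs Px (subsetP sQN y Qy) cxy; first by rewrite x1 eqxx in ntx.
have : y \in P :&: Q by rewrite inE Py.
by rewrite tiPQ => /set1P y1; rewrite y1 eqxx in nty.
Qed.

(** Conjugations act on a generator of [R] by powers, hence commute; so commutators, which generate
    [H], centralise [R]. *)
Lemma cyclic_normal_perfect_central (gT : finGroupType) (H R : {group gT}) :
  H^`(1) = H -> R <| H -> cyclic R -> R \subset 'Z(H).
Proof.
move=> defH' /andP[sRH nRH] /cyclicP[z defR]; rewrite subsetI sRH centsC defR cent_cycle.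
rewrite -{1}defH' gen_subG; apply/subsetP=> _ /imset2P[x y Hx Hy ->].
have pow u : u \in H -> exists i, z ^ u = z ^+ i.
  move=> Hu; apply/cycleP; rewrite -defR memJ_norm ?(subsetP nRH) // defR.
  exact: cycle_id.
have [i zx] := pow x Hx; have [j zy] := pow y Hy.
apply/cent1P/commute_sym/commgP/conjg_fixP.
have e : z ^ (x * y) = z ^ (y * x).
  by rewrite !conjgM zx zy !conjXg zx zy -!expgM mulnC.
have [k zk] := pow (y * x)^-1 (groupVr (groupM Hy Hx)).
have -> : [~ x, y] = (y * x)^-1 * (x * y) by rewrite commgEl conjgE invMg !mulgA.
by rewrite conjgM zk conjXg e -conjXg -zk conjgKV.
Qed.

Lemma FS_norm_proper (gT : finGroupType) (G : {group gT}) p q (P Q : {group gT}) :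
  simple G -> Frobenius_Sylow G p q P Q -> 'N_G(P) \proper G.
Proof.
move=> simG fs; apply: simple_norm_proper (FS_nt fs) => //.
rewrite properEcard (FS_sub_Sylow fs) /=.
apply: leq_trans (subset_leq_card (subsetIl G 'N(P))).
by rewrite (FS_cardN fs) ltn_Pmulr ?cardG_gt0 ?prime_gt1 ?(FS_prime2 fs).
Qed.

(** The second part of the conclusion is what the passage from [H] to a larger ambient group relies
    on. *)
Theorem finite_classification (gT : finGroupType) (H : {group gT}) :
    ~~ solvable H ->
    (forall K : {group gT}, K \proper H -> solvable K) ->
    (forall K : {group gT}, K \subset H -> K <| H \/ proper_nil K) ->
  (H \isog 'Alt_('I_5) \/ H \isog SL25) /\
  exists P : {group gT}, [/\ 2.-Sylow(H) P, ~~ nilpotent 'N_H(P) & ~~ ('N_H(P) <| H)].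
Proof.
move=> nsolH minH hamH.
have ntH : H :!=: 1 by apply: contraNneq nsolH => ->; apply: solvable1.
have [R maxR] := ex_maxnormal_ntrivg ntH.
have nRH : R <| H := maxnormal_normal maxR.
have simS : simple (H / R) by rewrite quotient_simple.
have solR : solvable R by apply: minH; apply: maxnormal_proper maxR.
have nsolS : ~~ solvable (H / R) by apply: contra nsolH; rewrite (series_sol nRH) solR.
have defH' : H^`(1) = H.
  apply/eqP; rewrite eqEproper der_sub; apply/negP=> /minH solH'.
  case/negP: nsolH; rewrite (series_sol (der_normal 1 H)) solH' /=.
  exact: abelian_sol (der_abelian 0 H).
have nilS (K : {group coset_of R}) : K \proper H / R -> proper_nil K.
  move=> ltK; have [K1 defK sRK1 sK1H] := inv_quotientS nRH (proper_sub ltK).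
  have nRK1 : R <| K1 := normalS sRK1 sK1H nRH.
  rewrite defK; case: (hamH K1 sK1H) => [nK1H | nilK1]; last exact: proper_nil_quo.
  have /simpleP[_ simS'] := simS; have := quotient_normal R nK1H.
  case/(simS' [group of K1 / R])=> /= eqK; rewrite -?defK in eqK.
    by rewrite -defK eqK => L; rewrite properE => /andP[_ /negP[]]; rewrite sub1G.
  by rewrite eqK properxx in ltK.
have FS := simple_Frobenius_Sylow simS nsolS nilS.
have ntS : H / R :!=: 1 by case/simpleP: simS.
have evS : 2 %| #|H / R|.
  rewrite dvdn2; apply/negP=> oddS; exact: (FS_odd_false FS oddS ntS).
have [oS [P2 [Q2 [fs2 i5]]] [P3 [Q3 fs3]] [P5 [Q5 fs5]]] := FS_even_order FS simS evS.
have isoS : H / R \isog 'Alt_('I_5).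
  by apply: simple_index5_Alt i5 simS nsolS oS; apply: subsetIl.
have preS p (P Q : {group coset_of R}) : Frobenius_Sylow (H / R) p 2 P Q ->
   exists K : {group gT}, [/\ R <| K, K \subset H, K / R = 'N_(H / R)(P)
     & exists p' q' (P' Q' : {group gT}), Schmidt p' q' K P' Q'].
  move=> fs; have ltN := FS_norm_proper simS fs; have nnilN := FS_nnil fs.
  have [K defK sRK sKH] := inv_quotientS nRH (proper_sub ltN).
  have nRK : R <| K := normalS sRK sKH nRH.
  exists K; split=> //; apply: Schmidt_exists; last first.
    by apply: contra nnilN => nilK; rewrite defK quotient_nil.
  case: (hamH K sKH) => // nKH; have /simpleP[_ simS'] := simS.
  have := quotient_normal R nKH.
  case/(simS' [group of K / R])=> /= eqK; rewrite -?defK in eqK.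
    by case/negP: nnilN; rewrite eqK nilpotent1.
  by rewrite eqK properxx in ltN.
(* The preimage of the normaliser has only two prime divisors, and they are already [p] and 2.
   Taking [p = 3] and [p = 5] leaves only 2 for [R]. *)
have piR p (P Q : {group coset_of R}) r : Frobenius_Sylow (H / R) p 2 P Q ->
    prime r -> r %| #|R| -> (r == p) || (r == 2).
  move=> fs r_pr rR; have [K [nRK sKH defK [p' [q' [P' [Q' sch]]]]]] := preS p P Q fs.
  have dvK s : s %| #|'N_(H / R)(P)| -> s %| #|K|.
    by rewrite -defK => /dvdn_trans; apply; apply: dvdn_quotient.
  have dvp : p %| #|K|.
    apply: dvK; rewrite (FS_cardN fs) dvdn_mulr //.
    by have [_ ->] := pgroup_pdiv (abelem_pgroup (FS_abelem fs)) (FS_nt fs).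
  have dv2 : 2 %| #|K| by apply: dvK; rewrite (FS_cardN fs) dvdn_mull.
  have dvr : r %| #|K| by apply: dvdn_trans rR (cardSg (normal_sub nRK)).
  have := Schmidt_pi sch (FS_prime1 fs) dvp; have := Schmidt_pi sch (isT : prime 2) dv2.
  have := Schmidt_pi sch r_pr dvr; have := FS_neq fs.
  by clear; lia.
have pR : 2.-group R.
  apply/pgroupP=> r r_pr rR; have := piR _ _ _ _ fs3 r_pr rR; have := piR _ _ _ _ fs5 r_pr rR.
  by rewrite inE => /orP[] // /eqP->.
have cycR : cyclic R.
  have [K [nRK sKH defK [p' [q' [P' [Q' sch]]]]]] := preS _ _ _ fs3.
  have [U sylU] := Sylow_exists 2 K.
  have sRU : R \subset U.
    apply: subset_trans (pcore_max pR nRK) _; exact: pcore_sub_Hall sylU.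
  (* The image of [U] is conjugate to the complement [Q3], which is not normal; so [U] is the cyclic
     Sylow subgroup of the minimal non-nilpotent group [K]. *)
  have nnU : ~~ (U <| K).
    apply: contra (FS_nnormal fs3) => nUK.
    have sylQ : 2.-Sylow('N_(H / R)(P3)) Q3.
      rewrite pHallE (FS_sub fs3) (FS_card fs3) (FS_cardN fs3) partnM ?cardG_gt0 //.
      rewrite part_p'nat ?mul1n ?part_pnat_id //.
      by apply: pi_pnat (abelem_pgroup (FS_abelem fs3)) _.
    have nUN : U / R <| 'N_(H / R)(P3) by rewrite -defK quotient_normal.
    have sylUN : 2.-Sylow('N_(H / R)(P3)) (U / R).
      by rewrite -defK quotient_pHall // (subset_trans (pHall_sub sylU)) ?normal_norm.
    have [x Nx ->] := Sylow_trans sylUN sylQ.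
    by rewrite (normP _) // (subsetP (normal_norm nUN)).
  have [_ cycU] := Schmidt_cyclic_Sylow sch (isT : prime 2) sylU nnU.
  exact: cyclicS sRU cycU.
have sRZ := cyclic_normal_perfect_central defH' nRH cycR.
have iR : #|H : R| = 60 by rewrite -card_quotient ?normal_norm.
have oR : #|R| <= 2 by apply: (central_2ext_bound defH' sRZ pR); rewrite iR p_part.
split.
  have [R1 | ntR] := eqVneq R 1%G.
    left; apply: isog_trans isoS; rewrite R1; apply: quotient1_isog.
  have oR2 : #|R| = 2 by apply/eqP; rewrite eqn_leq oR cardG_gt1.
  right; have /isogP[f injf imf] := isoS.
  have sH : H \subset coset R @*^-1 (H / R) by rewrite -sub_morphim_pre ?normal_norm.
  pose phi := restrm_morphism sH (comp_morphism (coset_morphism R) f).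
  have im_phi : phi @* H = 'Alt_('I_5).
    by rewrite morphim_restrm setIid morphim_comp -imf.
  have ker_phi : 'ker phi = R.
    rewrite ker_restrm ker_comp (trivgP injf).
    have -> : coset R @*^-1 1 = R by rewrite -kerE ker_coset.
    exact/setIidPr/normal_sub.
  apply: (@fibre_isog _ _ _ H SL25_group phi SL25_perm_morphism).
  - by rewrite im_phi im_SL25_perm.
  - exact: defH'.
  - exact: SL25_perfect.
  - by rewrite ker_phi.
  - exact: ker_SL25_central.
  - by rewrite ker_phi.
  - exact: card_ker_SL25_perm.
  by rewrite im_phi card_Alt5 p_part.
(* Both properties of ['N_H(P)] are read off modulo [R], where it becomes the proper, non-nilpotent
   normaliser of a Sylow 2-subgroup. *)
have [P sylP] := Sylow_exists 2 H.
have sRP : R \subset P.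
  by apply: subset_trans (pcore_max pR nRH) (pcore_sub_Hall sylP).
have nRP : R <| P := normalS sRP (pHall_sub sylP) nRH.
have sylPS : 2.-Sylow(H / R) (P / R).
  by rewrite quotient_pHall // (subset_trans (pHall_sub sylP)) ?normal_norm.
have ntPS : P / R :!=: 1.
  by rewrite -cardG_gt1 (card_Hall sylPS) p_part_gt1 mem_primes evS cardG_gt0.
have [q [Q fsP]] := FS _ _ (isT : prime 2) sylPS ntPS.
have eqN : 'N_H(P) / R = 'N_(H / R)(P / R) by apply: quotient_subnormG.
have nnilN : ~~ nilpotent 'N_H(P).
  by apply: contra (FS_nnil fsP) => nilN; rewrite -eqN quotient_nil.
exists P; split=> //; apply/negP=> nNH.
have /simpleP[_ simS'] := simS; have := quotient_normal R nNH; rewrite eqN.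
case/simS' => eqK; first by case/negP: (FS_nnil fsP); rewrite /= eqK nilpotent1.
by have := FS_norm_proper simS fsP; rewrite eqK properxx.
Qed.

End FiniteClassification.

(** * Subgroups of abstract groups *)

Section AbstractGroups.

Import GroupScope.

Section FinTypeGroup.
Variables (T : finType) (mul : T -> T -> T) (one : T) (inv : T -> T).
Hypotheses (mA : associative mul) (m1 : left_id one mul).
Hypothesis mV : left_inverse one inv mul.

(* Mentioning the axioms makes them parameters of the type that carries the
   group instance. *)
Definition finType_group : Type := let _ := (mA, m1, mV) in T.

HB.instance Definition _ := Finite.copy finType_group T.
HB.instance Definition _ := Finite_isGroup.Build finType_group mA m1 mV.
End FinTypeGroup.

(** * Elementary facts and finite models of finite subgroups *)

Section GrpTheory.
Variable G : Grp.
Implicit Types (x y z : G) (A B H K : G -> Prop).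

Lemma gmulI x y z : gmul x y = gmul x z -> y = z.
Proof. by move/(congr1 (gmul (ginv x))); rewrite !gmulA !gmulV !gmul1. Qed.

Lemma gmulg1 x : gmul x (gone G) = x.
Proof. by apply: (@gmulI (ginv x)); rewrite gmulA !gmulV gmul1. Qed.

Lemma gmulgV x : gmul x (ginv x) = gone G.
Proof. by apply: (@gmulI (ginv x)); rewrite gmulA gmulV gmul1 gmulg1. Qed.

Lemma ginvK x : ginv (ginv x) = x.
Proof. by apply: (@gmulI (ginv x)); rewrite gmulgV gmulV. Qed.

Lemma ginvM x y : ginv (gmul x y) = gmul (ginv y) (ginv x).
Proof.
apply: (@gmulI (gmul x y)); rewrite gmulgV gmulA -(gmulA x) gmulgV gmulg1.
by rewrite gmulgV.
Qed.

Definition gconj x g : G := gmul (gmul (ginv g) x) g.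

Lemma gconjM x g h : gconj x (gmul g h) = gconj (gconj x g) h.
Proof. by rewrite /gconj ginvM !gmulA. Qed.

Lemma gconj1 x : gconj x (gone G) = x.
Proof. by rewrite /gconj gmulg1 -[ginv _]gmulg1 gmulV gmul1. Qed.

Lemma gconjK x g : gconj (gconj x g) (ginv g) = x.
Proof. by rewrite -gconjM gmulgV gconj1. Qed.

Lemma gconjMl x y g : gconj (gmul x y) g = gmul (gconj x g) (gconj y g).
Proof. by rewrite /gconj !gmulA -(gmulA _ g) gmulgV gmulg1. Qed.

Lemma gconjV x g : gconj (ginv x) g = ginv (gconj x g).
Proof. by rewrite /gconj !ginvM ginvK gmulA. Qed.

Lemma gconj_inj x y g : gconj x g = gconj y g -> x = y.
Proof. by move/(congr1 (gconj^~ (ginv g))); rewrite !gconjK. Qed.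

Lemma commSub_mono A A' B B' :
  gsubset A A' -> gsubset B B' -> gsubset (commSub A B) (commSub A' B').
Proof.
move=> sA sB z zAB K gK sK; apply: zAB => // _ [x [y [Ax [By ->]]]].
by apply: sK; exists x, y; split; [apply: sA | split; [apply: sB |]].
Qed.

Lemma lcs_mono H K n : gsubset H K -> gsubset (lcs H n) (lcs K n).
Proof. by move=> sHK; elim: n => //= n IHn; apply: commSub_mono. Qed.

Lemma dser_mono H K n : gsubset H K -> gsubset (dser H n) (dser K n).
Proof. by move=> sHK; elim: n => //= n IHn; apply: commSub_mono. Qed.

Lemma nilpotent_subS H K : gsubset K H -> nilpotent_sub H -> nilpotent_sub K.
Proof. by move=> sKH [n tr]; exists n => x /(lcs_mono sKH)/tr. Qed.

(** The list may have repetitions and elements outside [H]; excluded middle decides, entry by entry,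
    whether to keep it. *)
Lemma finite_enum H s : (forall x, H x -> In x s) ->
  exists n (e : 'I_n -> G), injective e /\ forall x, H x <-> exists i, e i = x.
Proof.
elim: s H => [|a s IHs] H Hs.
  have i0 (i : 'I_0) : False by case: i.
  exists 0, (fun=> gone G); split=> [i | x]; first by case: (i0 i).
  by split=> [/Hs | [i]]; [case | case: (i0 i)].
have [|n [e [inj_e He]]] := IHs (fun x => H x /\ x <> a).
  by move=> x [/Hs[-> | //]].
have [Ha | nHa] := classic (H a); last first.
  exists n, e; split=> // x; rewrite -He; split=> [Hx | []//].
  by split=> // eq_xa; rewrite eq_xa in Hx.
have ea j : e j <> a by case: (proj2 (He (e j))) => //; exists j.
exists n.+1, (fun i => if unlift ord0 i is Some j then e j else a); split.
  move=> i j; case: unliftP => [i' | ] ->; case: unliftP => [j' | ] -> //.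
  - by move/inj_e->.
  - by move/ea.
  by move/esym/ea.
move=> x; split=> [Hx | [i]].
  have [-> | neq] := classic (x = a); first by exists ord0; rewrite unlift_none.
  by have [j <-] := proj1 (He x) (conj Hx neq); exists (lift ord0 j); rewrite liftK.
by case: unliftP => [j | ] _ <- //; case: (proj2 (He (e j))) => //; exists j.
Qed.

Lemma finite_subgroup_model H : is_subgroup H -> finite_sub H ->
  exists (gT : finGroupType) (f : gT -> G),
    [/\ injective f, {morph f : x y / x * y >-> gmul x y}
      & forall x, H x <-> exists i, f i = x].
Proof.
move=> [H1 [HM HV]] [s /finite_enum[n [e [inj_e He]]]].
have Hei i : H (e i) by apply/He; exists i.
have{} He x : H x -> {i | e i = x}.
  by move/He; apply: constructive_indefinite_description.
pose mul i j := sval (He _ (HM _ _ (Hei i) (Hei j))).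
pose one := sval (He _ H1); pose inv i := sval (He _ (HV _ (Hei i))).
have eM i j : e (mul i j) = gmul (e i) (e j) by apply: (svalP (He _ _)).
have e1 : e one = gone G by apply: (svalP (He _ _)).
have eV i : e (inv i) = ginv (e i) by apply: (svalP (He _ _)).
have mA : associative mul by move=> i j k; apply: inj_e; rewrite !eM gmulA.
have m1 : left_id one mul by move=> i; apply: inj_e; rewrite eM e1 gmul1.
have mV : left_inverse one inv mul.
  by move=> i; apply: inj_e; rewrite eM eV e1 gmulV.
exists (finType_group mA m1 mV), e; split=> // x.
by split=> [/He[i <-] | [i <-]]; first by exists i.
Qed.

End GrpTheory.

(** * Transfer of subgroup properties along an injective morphism *)

Section Image.
Variables (G : Grp) (gT : finGroupType) (f : gT -> G).
Hypotheses (inj_f : injective f) (fM : {morph f : x y / x * y >-> gmul x y}).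
Implicit Types (A B H K L : {group gT}) (S : G -> Prop).

Definition img (K : {set gT}) : G -> Prop := fun g => exists2 x, x \in K & g = f x.

Lemma mem_img (K : {set gT}) x : img K (f x) <-> x \in K.
Proof. by split=> [[y Ky /inj_f->] | Kx] //; exists x. Qed.

Lemma img_sub (K L : {set gT}) : K \subset L <-> gsubset (img K) (img L).
Proof.
split=> [sKL _ [x Kx ->] | sKL]; first by apply/mem_img/(subsetP sKL).
by apply/subsetP=> x /mem_img/sKL/mem_img.
Qed.

Lemma f_one : f 1 = gone G.
Proof. by apply: (@gmulI _ (f 1)); rewrite -fM mulg1 gmulg1. Qed.

Lemma f_inv x : f x^-1 = ginv (f x).
Proof. by apply: (@gmulI _ (f x)); rewrite -fM mulgV gmulgV f_one. Qed.

Lemma f_conj x y : f (x ^ y) = gconj (f x) (f y).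
Proof. by rewrite conjgE !fM f_inv /gconj !gmulA. Qed.

Lemma f_comm x y : f [~ x, y] = gcomm (f x) (f y).
Proof. by rewrite commgEl conjgE !fM !f_inv /gcomm !gmulA. Qed.

Lemma img_group K : is_subgroup (img K).
Proof.
split; first by exists 1; rewrite ?f_one.
split=> [_ _ [x Kx ->] [y Ky ->] | _ [x Kx ->]].
  by rewrite -fM; apply/mem_img; rewrite groupM.
by rewrite -f_inv; apply/mem_img; rewrite groupV.
Qed.

Lemma preim_group S : is_subgroup S ->
  exists K : {group gT}, forall x, x \in K <-> S (f x).
Proof.
move=> [S1 [SM _]].
pose A := [set x | if excluded_middle_informative (S (f x)) then true else false].
have inA x : x \in A <-> S (f x) by rewrite inE; case: excluded_middle_informative.
have gA : group_set A.
  apply/group_setP; split=> [|x y /inA Sx /inA Sy]; apply/inA; first by rewrite f_one.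
  by rewrite fM; apply: SM.
by exists (Group gA).
Qed.

Lemma sub_img_group S L : is_subgroup S -> gsubset S (img L) ->
  exists K : {group gT}, forall g, S g <-> img K g.
Proof.
move=> gS sSL; have [K inK] := preim_group gS; exists K => g.
split=> [Sg | [x Kx ->]]; last exact/inK.
by have [x _ eg] := sSL g Sg; rewrite eg in Sg *; apply/mem_img/inK.
Qed.

Lemma img_commg A B g : commSub (img A) (img B) g <-> img [~: A, B] g.
Proof.
split=> [| [x ABx ->] S gS sS].
  apply; first exact: img_group.
  move=> _ [_ [_ [[x Ax ->] [[y By ->] ->]]]].
  by rewrite -f_comm; apply/mem_img/mem_commg.
have [K inK] := preim_group gS; apply/inK; move: x ABx; apply/subsetP.
rewrite gen_subG; apply/subsetP=> _ /imset2P[x y Ax By ->]; apply/inK.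
by rewrite f_comm; apply: sS; exists (f x), (f y); split; [|split=> //]; apply/mem_img.
Qed.

(** The shift appears because [lcs] starts at index 0 and ['L_n] at index 1. *)
Lemma img_lcs K n g : lcs (img K) n g <-> img 'L_n.+1(K) g.
Proof.
elim: n g => [|n IHn] g /=; first by rewrite lcn1.
rewrite lcnSn -img_commg.
by split; apply: commSub_mono => // h; apply IHn.
Qed.

Lemma img_dser K n g : dser (img K) n g <-> img K^`(n) g.
Proof.
elim: n g => [|n IHn] g //=; rewrite dergSn -img_commg.
by split; apply: commSub_mono => // h; apply IHn.
Qed.

Lemma img_trivial K : is_trivial (img K) <-> K :=: 1.
Proof.
split=> [tr | -> _ [x /set1gP-> ->]]; last exact: f_one.
apply/trivgP/subsetP=> x /mem_img/tr fx1; apply/set1gP/inj_f.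
by rewrite fx1 f_one.
Qed.

Lemma img_nilpotent K : nilpotent_sub (img K) <-> nilpotent K.
Proof.
split=> [[n tr] | /lcnP[n L1]].
  by apply/lcnP; exists n; apply/img_trivial=> g /img_lcs; apply: tr.
by exists n => g /img_lcs; rewrite L1 => /(proj2 (img_trivial 1%G) erefl).
Qed.

Lemma img_solvable K : soluble_sub (img K) <-> solvable K.
Proof.
split=> [[n tr] | /derivedP[n d1]].
  by apply/derivedP; exists n; apply/img_trivial=> g /img_dser; apply: tr.
by exists n => g /img_dser; rewrite d1 => /(proj2 (img_trivial 1%G) erefl).
Qed.

Lemma img_min_non_nilpotent K : min_non_nilpotent_sub (img K) -> proper_nil K.
Proof.
move=> [_ [_ minK]] L /andP[sLK /subsetPn[x Kx nLx]]; apply/img_nilpotent/minK.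
split; first exact: img_group.
split; first exact/img_sub.
by exists (f x); split=> [|/mem_img]; [apply/mem_img | rewrite (negPf nLx)].
Qed.

Lemma img_normal K H : K \subset H -> Defs.normal_sub (img K) -> K <| H.
Proof.
move=> sKH nK; apply/andP; split=> //; apply/subsetP=> x Hx.
rewrite inE; apply/subsetP=> _ /imsetP[y Ky ->]; apply/mem_img.
by rewrite f_conj; apply/nK/mem_img.
Qed.

End Image.

(** * From the finite subgroup to the whole group *)

Section ParaNilHamiltonian.
Variables (G : Grp) (gT : finGroupType) (f : gT -> G).
Hypotheses (inj_f : injective f) (fM : {morph f : x y / x * y >-> gmul x y}).
Hypothesis paraG : forall S : G -> Prop, is_subgroup S -> ~ Defs.normal_sub S ->
  nilpotent_sub S \/ min_non_nilpotent_sub S.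
Implicit Types (H K P : {group gT}) (S : G -> Prop).

Lemma img_normal_or_proper_nil K H :
  K \subset H -> K <| H \/ proper_nil K.
Proof.
move=> sKH; have [nK | nK] := classic (Defs.normal_sub (img f K)).
  by left; apply: (img_normal inj_f fM).
right; case: (paraG (img_group inj_f fM K) nK) => [nilK L sLK|].
  by apply/(img_nilpotent inj_f fM); apply: nilpotent_subS nilK; apply/img_sub/proper_sub.
exact: img_min_non_nilpotent.
Qed.

Lemma over_nonnil_normal K S : is_subgroup S -> ~~ nilpotent K ->
  proper_subgroup (img f K) S -> Defs.normal_sub S.
Proof.
move=> gS nnilK pKS; apply: NNPP => nS; case/negP: nnilK.
apply/(img_nilpotent inj_f fM); case: (paraG gS nS) => [|[_ [_]]]; last exact.
by apply: nilpotent_subS; case: pKS => _ [].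
Qed.

Lemma insoluble_normal K : ~~ solvable K -> Defs.normal_sub (img f K).
Proof.
move=> nsolK; apply: NNPP => nK; case/negP: nsolK.
case: (paraG (img_group inj_f fM K) nK) => [/(img_nilpotent inj_f fM)/nilpotent_sol // |].
by move/(img_min_non_nilpotent inj_f fM)/proper_nil_sol.
Qed.

(** An equivalence instead of an inclusion, so that closure under inverses holds even for infinite
    [S]. *)
Definition gnorm S : G -> Prop :=
  fun g => forall x, S x <-> S (gconj x g).

Lemma gnorm_group S : is_subgroup (gnorm S).
Proof.
split; first by move=> x; rewrite gconj1.
split=> [g h ng nh x | g ng x]; first by rewrite gconjM -nh.
by rewrite (ng (gconj x _)) -{2}[g]ginvK gconjK.
Qed.

Lemma gnorm_img P x : gnorm (img f P) (f x) <-> x \in 'N(P).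
Proof.
split=> [nPx | nPx g].
  rewrite inE; apply/subsetP=> _ /imsetP[y Py ->]; apply/(mem_img inj_f).
  by rewrite (f_conj fM) -nPx; apply/(mem_img inj_f).
split=> [[y Py ->] | [y Py eq_y]].
  by rewrite -(f_conj fM); apply/(mem_img inj_f); rewrite memJ_norm.
exists (y ^ x^-1); first by rewrite memJ_norm ?groupV.
by rewrite (f_conj fM) (f_inv fM) -eq_y gconjK.
Qed.

(* The Frattini argument, with [phi] the conjugation by g read inside gT. *)
Lemma gFrattini p H P g : Defs.normal_sub (img f H) -> p.-Sylow(H) P ->
  exists2 h, h \in H & gnorm (img f P) (gmul g (f h)).
Proof.
move=> nH sylP; have sPH := pHall_sub sylP.
have [phi phiE] : exists phi, forall x, x \in H -> f (phi x) = gconj (f x) g.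
  apply: (@fin_all_exists _ (fun=> gT) (fun x y => x \in H -> f y = gconj (f x) g)).
  move=> x; case: (boolP (x \in H)) => [Hx | _]; last by exists 1.
  by have [y _ eq_y] := nH g _ (proj2 (mem_img inj_f H x) Hx); exists y.
have [||Q inQ] := @sub_img_group _ _ _ inj_f fM (fun x => img f P (gconj x (ginv g))) H.
- have [P1 [PM PV]] := img_group inj_f fM P; split; first by rewrite /gconj gmulg1 gmulV.
  by split=> [x y Px Py | x Px]; [rewrite gconjMl; apply: PM | rewrite gconjV; apply: PV].
- move=> x [y Py eq_y]; rewrite -[x](gconjK _ (ginv g)) ginvK eq_y; apply: nH.
  exact/(mem_img inj_f)/(subsetP sPH).
have eQ : Q :=: phi @: P.
  apply/setP=> y; apply/idP/imsetP=> [/(mem_img inj_f)/inQ[x Px eq_x] | [x Px ->]].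
    exists x => //; apply: inj_f; rewrite phiE ?(subsetP sPH) // -eq_x.
    by rewrite -{2}[g]ginvK gconjK.
  apply/(mem_img inj_f)/inQ; rewrite phiE ?(subsetP sPH) // gconjK.
  exact/(mem_img inj_f).
have sylQ : p.-Sylow(H) Q.
  rewrite pHallE; apply/andP; split.
    apply/subsetP=> y /(mem_img inj_f)/inQ[x Px eq_x]; apply/(mem_img inj_f).
    rewrite -[f y](gconjK _ (ginv g)) ginvK eq_x; apply: nH.
    exact/(mem_img inj_f)/(subsetP sPH).
  rewrite -(card_Hall sylP) eQ card_in_imset // => x y /(subsetP sPH) Hx.
  move=> /(subsetP sPH) Hy /(congr1 f); rewrite !phiE // => /gconj_inj; exact: inj_f.
have [h Hh eqP] := Sylow_trans sylQ sylP.
exists h => // x; rewrite gconjM; split=> [Px | [y Py eq_y]].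
  have /inQ[y Qy ->] : img f P (gconj (gconj x g) (ginv g)) by rewrite gconjK.
  by rewrite -(f_conj fM); apply/(mem_img inj_f); rewrite eqP memJ_conjg.
rewrite -[x](gconjK _ g); apply/inQ; exists (y ^ h^-1).
  by rewrite -mem_conjg -eqP.
by rewrite (f_conj fM) -eq_y (f_inv fM) gconjK.
Qed.

Lemma img_full H P : ~~ solvable H -> 2.-Sylow(H) P ->
  ~~ nilpotent 'N_H(P) -> ~~ ('N_H(P) <| H) -> forall g, img f H g.
Proof.
move=> nsolH sylP nnilN nnormN g; apply: NNPP => nHg; case/negP: nnormN.
have gH := img_group inj_f fM H.
have nH := insoluble_normal nsolH.
have [h Hh nPgh] := gFrattini g nH sylP.
apply: (img_normal inj_f fM); first exact: subsetIl.
have normN : Defs.normal_sub (gnorm (img f P)).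
  apply: (@over_nonnil_normal 'N_H(P)%G _ (gnorm_group _) nnilN).
  split; first exact: img_group.
  split=> [_ [x /setIP[_ nPx] ->] |]; first exact/gnorm_img.
  exists (gmul g (f h)); split=> // -[x /setIP[Hx _] eq_x]; apply: nHg.
  exists (x * h^-1); first by rewrite groupM ?groupV.
  by rewrite fM -eq_x (f_inv fM) -gmulA gmulgV gmulg1.
(* A conjugate of an element of ['N_H(P)] stays in [H] and in the normaliser of [P], both normal in
   [G]. *)
move=> y _ [x /setIP[Hx nPx] ->].
have [z Hz eq_z] := nH y _ (proj2 (mem_img inj_f H x) Hx); rewrite eq_z.
apply/(mem_img inj_f)/setIP; split=> //; apply/gnorm_img; rewrite -eq_z.
exact/normN/gnorm_img.
Qed.

Lemma img_isog (rT : finGroupType) (H : {group gT}) (K : {group rT}) :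
  (forall g, img f H g) -> H \isog K -> isomorphic_to G K.
Proof.
move=> fullH /isogP[phi inj_phi imphi].
have Hg g : {x | x \in H /\ g = f x}.
  by apply: constructive_indefinite_description; have [x] := fullH g; exists x.
pose r g := sval (Hg g).
have Hr g : r g \in H by case: (svalP (Hg g)).
have fr g : f (r g) = g by case: (svalP (Hg g)).
exists (phi \o r); split=> [x y /= |].
  by rewrite -morphM //; congr (phi _); apply: inj_f; rewrite fM !fr.
split=> [x y /= /(injmP inj_phi) eq_r | ].
  by rewrite -(fr x) -(fr y) eq_r.
split=> [x | y]; rewrite -imphi; first exact: mem_morphim.
by case/morphimP=> x _ Hx ->; exists (f x) => /=; congr (phi _); apply: inj_f.
Qed.

Lemma img_finite H : (forall g, img f H g) -> group_finite G.
Proof.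
move=> fullH; exists (List.map f (enum H)) => g _; have [x Hx ->] := fullH g.
apply: in_map; have: x \in enum H by rewrite mem_enum.
by elim: (enum H) => //= a s IHs; rewrite inE => /predU1P[->|/IHs]; [left | right].
Qed.

End ParaNilHamiltonian.

Lemma min_insoluble (gT : finGroupType) (H : {group gT}) : ~~ solvable H ->
  exists2 K : {group gT}, ~~ solvable K
    & forall L : {group gT}, L \proper K -> solvable L.
Proof.
elim: {H}_.+1 {-2}H (ltnSn #|H|) => // n IHn H leHn nsolH.
have [[L pLH nsolL] | minH] := classic (exists2 L : {group gT}, L \proper H & ~~ solvable L).
  by apply: (IHn L) => //; apply: leq_trans (proper_card pLH) _.
exists H => // L pLH; apply/idPn => nsolL; apply: minH; by exists L.
Qed.

End AbstractGroups.

Import GroupScope.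

Theorem mainTheorem11 (G : Grp) :
  para_Nil_Hamiltonian G ->
  (exists H : G -> Prop,
     is_subgroup H /\ finite_sub H /\ ~ soluble_sub H) ->
  group_finite G /\ (isomorphic_to G A5 \/ isomorphic_to G SL25).
Proof.
move=> [_ paraG] [S [gS [finS nsolS]]].
have [gT [f [inj_f fM fS]]] := finite_subgroup_model gS finS.
have [|H nsolH minH] := @min_insoluble gT [set: gT].
  apply/negP=> /(img_solvable inj_f fM)[n tr]; apply: nsolS; exists n => x.
  move/(@dser_mono _ _ (img f [set: gT]))=> Sx; apply/tr/Sx => y /fS[i <-].
  by exists i; rewrite ?inE.
have [|isoH [P [sylP nnilN nnormN]]] := finite_classification nsolH minH.
  by move=> K; apply: (img_normal_or_proper_nil inj_f fM paraG).
have fullH := img_full inj_f fM paraG nsolH sylP nnilN nnormN.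
split; first exact: img_finite fullH.
by case: isoH => /(img_isog inj_f fM fullH); [left | right].
Qed.
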